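(* Let $G$ be an undirected connected multigraph with vertex set $[n]$. The sequence $$\mathcal F_1(G):\quad F_{1,n-1}\xrightarrow{\delta_{1,n-1}}\cdots\xrightarrow{\delta_{1,2}}F_{1,1}\xrightarrow{\delta_{1,1}}F_{1,0}=R$$ is a minimal free resolution of the toppling ideal $I_G$; that is, it is a complex of free $R$-modules, exact in all positive homological degrees (with $0\to F_{1,n-1}$ on the left), the cokernel of $\delta_{1,1}$ is $R/I_G$, and the image of each $\delta_{1,k}$ lies in $\langle x_1,\dots,x_n\rangle F_{1,k-1}$.
   Context: $\mathbb K$ is a field, $R=\mathbb K[x_1,\dots,x_n]$. $G$ is given by a symmetric adjacency matrix $A_G=(a_{ij})$ of nonnegative integers. Its Laplacian is $\Lambda_G=\Delta-A_G$, $\Delta$ diagonal with $\Delta_{ii}=\sum_ja_{ij}$; the toppling ideal is $I_G=\langle\mathbf x^u-\mathbf x^v: u,v\in\mathbb N^n,\ u-v\in\mathbb Z^n\Lambda_G\rangle$. Acyclic partitions. A connected $k$-partition is a set partition $\Pi$ of $[n]$ into $k$ nonempty parts, each inducing a connected subgraph of $G$. $G_\Pi$ is the multigraph on the set $\Pi$ in which the weight between $U,W$ is $\sum_{u\in U,w\in W}a_{uw}$; distinct $U,W$ are joined by one edge iff this is positive. An acyclic $k$-partition $\mathcal C$ is a connected $k$-partition $\Pi=\Pi(\mathcal C)$ together with an acyclic orientation of $G_\Pi$ (each edge between distinct parts is directed, with no directed cycle); it is regarded as a directed graph on $\Pi$. For $u\in U\in\Pi(\mathcal C)$ put $out_{\mathcal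 C}(u)=\sum_{W:(U,W)\in\mathcal C}\sum_{w\in W}a_{uw}$ and $D(\mathcal C)=(out_{\mathcal C}(u))_{u\in[n]}\in\mathbb Z^n$. Chip firing equivalence. Two elements of $\mathbb Z^V$ are linearly equivalent on a multigraph with vertex set $V$ if they differ by an element of the row lattice of its Laplacian. For acyclic $k$-partitions with $\Pi(\mathcal C_1)=\Pi(\mathcal C_2)=\Pi$, write $\mathcal C_1\sim\mathcal C_2$ if $p(D(\mathcal C_1))$ and $p(D(\mathcal C_2))$ are linearly equivalent on $G_\Pi$, where $p(D)_U=\sum_{j\in U}D_j$. $[\mathcal C]$ is the class of $\mathcal C$; all its elements have the same $\Pi$. Contraction. An edge $e=(e^-,e^+)$ of $\mathcal C$ (directed from $e^-$ to $e^+$) is contractible in $\mathcal C$ if the directed graph $\mathcal C/e$ obtained by merging $e^-,e^+$ into $e^-\cup e^+$ (and deleting $e$) is acyclic (no directed cycles, including 2-cycles); then $\mathcal C/e$ is an acyclic $(k-1)$-partition. For a class $\mathfrak c$, a directed edge $e$ is a contractible edge of $\mathfrak c$ if it appears and is contractible in some $\mathcal C\in\mathfrak c$; then $\mathfrak c/e:=[\mathcal C/e]$ and $m_{\mathfrak c}(e):=\mathbf x^{D(\mathcal C)-D(\mathcal C/e)}$ do not depend on the choice of $\mathcal C$. $f/e$ denotes the edge of the contracted graph induced by an edge $f$ (other than $e$ and its reversal), again denoted $f$ when clear. Signs. Fix functions $\operatorname{sign}_{\mathfrak c}$ from contractible edges of $\mathfrak c$ to $\{\pm1\}$, one for each class $\mathfrak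 c$ of acyclic $k$-partitions (all $k$), such that (i) $\operatorname{sign}_{\mathfrak c}(e)\operatorname{sign}_{\mathfrak c/e}(f/e)=-\operatorname{sign}_{\mathfrak c}(f)\operatorname{sign}_{\mathfrak c/f}(e/f)$ for distinct contractible edges $e,f$ of $\mathfrak c$ such that $f/e$ is contractible in $\mathfrak c/e$ and $e/f$ is contractible in $\mathfrak c/f$; (ii) $\operatorname{sign}_{\mathfrak c}((A,B))=-\operatorname{sign}_{\mathfrak c}((B,A))$ whenever both are contractible edges of $\mathfrak c$. (Such functions exist.) The complex. For $0\le k\le n-1$, $F_{1,k}=\bigoplus_{\mathfrak c}R(-D(\mathfrak c))$, with one basis element (also denoted $\mathfrak c$) for each chip firing equivalence class of acyclic $(k+1)$-partitions, where $D(\mathfrak c)\in\mathbb Z^n/\mathbb Z^n\Lambda_G$ is the common class of $D(\mathcal C)$, $\mathcal C\in\mathfrak c$ (so the modules are $\mathbb Z^n/\mathbb Z^n\Lambda_G$-graded). For $1\le k\le n-1$, $\delta_{1,k}:F_{1,k}\to F_{1,k-1}$ is given by $\delta_{1,k}(\mathfrak c)=\sum_e\operatorname{sign}_{\mathfrak c}(e)\,m_{\mathfrak c}(e)\,(\mathfrak c/e)$, summed over the contractible edges $e$ of $\mathfrak c$. *)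

(* Defs.v *)
From HB Require Import structures.
From mathcomp Require Import all_boot all_order all_algebra.
From mathcomp Require Import boolp.
From mathcomp.multinomials Require Import mpoly.

Set Implicit Arguments.
Unset Strict Implicit.
Unset Printing Implicit Defensive.

Import GRing.Theory.
Local Open Scope ring_scope.

(* A multigraph on a finite vertex type is given by its weight function;      *)
(* loops are allowed but cancel in the Laplacian.                             *)

Definition laplacian (V : finType) (w : V -> V -> nat) (u v : V) : int :=
  (if u == v then \sum_x w u x else 0)%N%:Z - (w u v)%:Z.

Definition row_lattice (V : finType) (w : V -> V -> nat)
    (z : {ffun V -> int}) : Prop :=
  exists s : {ffun V -> int}, z = [ffun v => \sum_u s u * laplacian w u v].

Definition lin_equiv (V : finType) (w : V -> V -> nat)
    (D1 D2 : {ffun V -> int}) : Prop := row_lattice w (D1 - D2).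

Definition ideal_gen (R : comNzRingType) (S : R -> Prop) (p : R) : Prop :=
  exists2 s : seq (R * R),
    (forall q, q \in s -> S q.2) & p = \sum_(q <- s) q.1 * q.2.

Definition mnm_int n (m : 'X_{1..n}) : {ffun 'I_n -> int} :=
  [ffun i => (m i)%:Z].

Definition toppling_ideal (K : fieldType) n (A : 'M[nat]_n) :
    {mpoly K[n]} -> Prop :=
  ideal_gen (fun b : {mpoly K[n]} => exists u v : 'X_{1..n},
    lin_equiv A (mnm_int u) (mnm_int v) /\ b = 'X_[u] - 'X_[v]).

Definition irrelevant_ideal (K : fieldType) n : {mpoly K[n]} -> Prop :=
  ideal_gen (fun b : {mpoly K[n]} => exists i : 'I_n, b = 'X_i).

Definition connected_set n (A : 'M[nat]_n) (S : {set 'I_n}) : bool :=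
  (S != set0) &&
  [forall u in S, forall v in S,
     connect [rel x y | [&& x \in S, y \in S & (0 < A x y)%N]] u v].

Definition part_arc n := ({set 'I_n} * {set 'I_n})%type.
(* The second component is the set of arcs between the parts listed in the    *)
(* first component.                                                           *)
Definition part_digraph n := ({set {set 'I_n}} * {set part_arc n})%type.

Definition acyclic n (C : part_digraph n) : Prop :=
  forall s : seq {set 'I_n}, cycle [rel U W | (U, W) \in C.2] s -> s = [::].

Definition part_weight n (A : 'M[nat]_n) (U W : {set 'I_n}) : nat :=
  (\sum_(u in U) \sum_(w in W) A u w)%N.

Definition part_adj n (A : 'M[nat]_n) (P : {set {set 'I_n}})
    (U W : {set 'I_n}) : bool :=
  [&& U \in P, W \in P, U != W & (0 < part_weight A U W)%N].

Definition connected_partition n (A : 'M[nat]_n) (P : {set {set 'I_n}}) : bool :=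
  partition P [set: 'I_n] && [forall U in P, connected_set A U].

Definition orientation n (A : 'M[nat]_n) (C : part_digraph n) : bool :=
  [forall U, forall W,
     (((U, W) \in C.2) ==> part_adj A C.1 U W) &&
     (part_adj A C.1 U W ==> (((U, W) \in C.2) (+) ((W, U) \in C.2)))].

Definition acyclic_partitions n (A : 'M[nat]_n) : {set part_digraph n} :=
  [set C | [&& connected_partition A C.1, orientation A C & `[< acyclic C >]]].

Definition out_vec n (A : 'M[nat]_n) (C : part_digraph n) : 'X_{1..n} :=
  [multinom (\sum_(W | (pblock C.1 u, W) \in C.2) \sum_(w in W) A u w)%N | u < n].

Definition push n (P : {set {set 'I_n}}) (D : 'X_{1..n}) :
    {ffun {U : {set 'I_n} | U \in P} -> int} :=
  [ffun U : {U | U \in P} => \sum_(j in val U) (D j)%:Z].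

Definition chip_equiv n (A : 'M[nat]_n) (C1 C2 : part_digraph n) : bool :=
  (C1.1 == C2.1) &&
  `[< lin_equiv (fun U W : {U | U \in C1.1} => part_weight A (val U) (val W))
        (push C1.1 (out_vec A C1)) (push C1.1 (out_vec A C2)) >].

Definition chip_class n (A : 'M[nat]_n) (C : part_digraph n) :
    {set part_digraph n} :=
  [set C' in acyclic_partitions A | chip_equiv A C C'].

Definition chip_classes n (A : 'M[nat]_n) (k : nat) :
    {set {set part_digraph n}} :=
  [set chip_class A C | C in acyclic_partitions A & #|C.1| == k].

Definition merge_part n (e : part_arc n) (U : {set 'I_n}) : {set 'I_n} :=
  if (U == e.1) || (U == e.2) then e.1 :|: e.2 else U.

(* f/e *)
Definition contract_arc n (e f : part_arc n) : part_arc n := (merge_part e f.1, merge_part e f.2).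

(* C/e *)
Definition contract n (C : part_digraph n) (e : part_arc n) : part_digraph n :=
  (merge_part e @: C.1, contract_arc e @: (C.2 :\ e)).

Definition contractible n (C : part_digraph n) (e : part_arc n) : bool :=
  (e \in C.2) && `[< acyclic (contract C e) >].

Definition class_contractible n (c : {set part_digraph n}) (e : part_arc n) : bool :=
  [exists C in c, contractible C e].

(* In the next two definitions the value for a non-contractible e is junk;    *)
(* for a contractible e neither depends on the representative picked.         *)

(* c/e *)
Definition class_contract n (A : 'M[nat]_n) (c : {set part_digraph n})
    (e : part_arc n) : {set part_digraph n} :=
  if [pick C in c | contractible C e] is Some C
  then chip_class A (contract C e) else set0.

(* The truncated subtraction of exponents loses nothing: see                  *)
(* [out_vec_contract] below.                                                  *)
Definition class_exponent n (A : 'M[nat]_n) (c : {set part_digraph n})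
    (e : part_arc n) : 'X_{1..n} :=
  if [pick C in c | contractible C e] is Some C
  then (out_vec A C - out_vec A (contract C e))%MM else 0%MM.

(* Values outside the contractible edges of chip firing classes are           *)
(* unconstrained, and irrelevant to [delta].                                  *)
Definition sign_system n (A : 'M[nat]_n)
    (sgn : {set part_digraph n} -> part_arc n -> int) : Prop :=
  forall (k : nat) (c : {set part_digraph n}), c \in chip_classes A k ->
  [/\ forall e, class_contractible c e -> sgn c e = 1 \/ sgn c e = - 1,
      forall e f, e != f ->
        class_contractible c e -> class_contractible c f ->
        class_contractible (class_contract A c e) (contract_arc e f) ->
        class_contractible (class_contract A c f) (contract_arc f e) ->
        sgn c e * sgn (class_contract A c e) (contract_arc e f) =
        - (sgn c f * sgn (class_contract A c f) (contract_arc f e))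
    & forall U W,
        class_contractible c (U, W) -> class_contractible c (W, U) ->
        sgn c (U, W) = - sgn c (W, U)].

(* F_(1,k): its basis is indexed by the classes of acyclic (k+1)-partitions.  *)
Definition resF (K : fieldType) n (A : 'M[nat]_n) (k : nat) :=
  {ffun {c : {set part_digraph n} | c \in chip_classes A k.+1} ->
     {mpoly K[n]}^o}.

Definition resF_basis (K : fieldType) n (A : 'M[nat]_n) (k : nat)
    (c : {set part_digraph n}) : resF K A k :=
  [ffun d => (val d == c)%:R].

(* delta_(1,k+1) : F_(1,k+1) -> F_(1,k) *)
Definition delta (K : fieldType) n (A : 'M[nat]_n)
    (sgn : {set part_digraph n} -> part_arc n -> int) (k : nat)
    (v : resF K A k.+1) : resF K A k :=
  \sum_c v c *: \sum_(e | class_contractible (val c) e)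
    ((sgn (val c) e)%:~R * 'X_[class_exponent A (val c) e] : {mpoly K[n]}) *:
      resF_basis K A k (class_contract A (val c) e).

Arguments delta K {n} A sgn k v.

(* Homogeneity of degree (the class of) d in F_(1,k) = (+)_c R(-D(c)).        *)
Definition resF_homog (K : fieldType) n (A : 'M[nat]_n) (k : nat)
    (d : {ffun 'I_n -> int}) (v : resF K A k) : Prop :=
  forall (c : {c : {set part_digraph n} | c \in chip_classes A k.+1})
    (C : part_digraph n) (m : 'X_{1..n}),
    C \in val c -> m \in msupp (v c : {mpoly K[n]}) ->
    lin_equiv A (mnm_int (m + out_vec A C)%MM) d.

Section Contraction.
Variables (n : nat) (A : 'M[nat]_n).
Implicit Types (C : part_digraph n) (e f : part_arc n).

Lemma acyclic_arc C U W : acyclic C -> (U, W) \in C.2 ->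
  U != W /\ (W, U) \notin C.2.
Proof.
move=> acC UW; split.
  apply/eqP => eUW; move: UW; rewrite -eUW => UU.
  by have := acC [:: U]; rewrite /= UU => /(_ isT).
apply/negP => WU.
by have := acC [:: U; W]; rewrite /= UW WU => /(_ isT).
Qed.

Lemma part_weight_pos U W : (0 < part_weight A U W)%N =
  [exists u in U, exists w in W, (0 < A u w)%N].
Proof.
rewrite lt0n sum_nat_eq0 negb_forall_in; apply: eq_existsb => u.
congr (_ && _); rewrite sum_nat_eq0 negb_forall_in; apply: eq_existsb => w.
by rewrite lt0n.
Qed.

Lemma part_weightC U W : A^T = A -> part_weight A U W = part_weight A W U.
Proof.
move=> As; rewrite /part_weight exchange_big; apply: eq_bigr => u _.
by apply: eq_bigr => w _; rewrite -[in LHS]As mxE.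
Qed.

Lemma sub_merge_part e (U : {set 'I_n}) : U \subset merge_part e U.
Proof.
rewrite /merge_part; case: ifP => // /orP[]/eqP->; [exact: subsetUl|exact: subsetUr].
Qed.

Lemma merge_part_cover e (P : {set {set 'I_n}}) (U : {set 'I_n}) x :
  e.1 \in P -> e.2 \in P -> U \in P -> x \in merge_part e U ->
  exists2 V, V \in P & x \in V /\ merge_part e V = merge_part e U.
Proof.
move=> e1 e2 UP; rewrite {1}/merge_part; case: ifP => [h|_]; last by exists U.
have mU : merge_part e U = e.1 :|: e.2 by rewrite /merge_part h.
rewrite mU inE => /orP[]xe; [exists e.1 => //|exists e.2 => //];
  by split=> //; rewrite /merge_part eqxx ?orbT.
Qed.

Lemma partition_merge_part e (P : {set {set 'I_n}}) :
  e.1 \in P -> e.2 \in P -> partition P [set: 'I_n] ->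
  partition (merge_part e @: P) [set: 'I_n].
Proof.
move=> e1 e2 /and3P[/eqP cP tP nP]; apply/and3P; split.
- apply/eqP/setP => x; rewrite inE; apply/bigcupP.
  have : x \in cover P by rewrite cP inE.
  move=> /bigcupP[U UP xU]; exists (merge_part e U); first exact: imset_f.
  by apply: (subsetP (sub_merge_part _ _)).
- apply/trivIsetP => X Y /imsetP[U UP ->] /imsetP[V VP ->] neq.
  rewrite -setI_eq0; apply: contraNT neq => /set0Pn[x /setIP[xU xV]].
  have [U' U'P [xU' <-]] := merge_part_cover e1 e2 UP xU.
  have [V' V'P [xV' <-]] := merge_part_cover e1 e2 VP xV.
  apply/eqP; congr merge_part.
  by rewrite -(def_pblock tP U'P xU') -(def_pblock tP V'P xV').
- apply/imsetP => -[U UP U0]; case/negP: nP.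
  by have := sub_merge_part e U; rewrite -U0 subset0 => /eqP <-.
Qed.

Lemma connected_setU (S T : {set 'I_n}) : A^T = A ->
  connected_set A S -> connected_set A T -> (0 < part_weight A S T)%N ->
  connected_set A (S :|: T).
Proof.
move=> As /andP[S0 cS] /andP[T0 cT]; rewrite part_weight_pos.
move=> /exists_inP[s sS /exists_inP[t tT st]].
set r := [rel x y | [&& x \in S :|: T, y \in S :|: T & (0 < A x y)%N]].
have rC : ssrbool.symmetric r.
  by move=> x y; rewrite /= -[in RHS]As mxE andbCA.
have cr : connect_sym r by apply: sym_connect_sym.
have toS (x y : 'I_n) : x \in S -> y \in S -> connect r x y.
  move=> xS yS; move/forall_inP: cS => /(_ x xS)/forall_inP/(_ y yS).
  apply: connect_sub => u v /and3P[uS vS uv]; apply: connect1.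
  by rewrite /r /= !inE uS vS.
have toT (x y : 'I_n) : x \in T -> y \in T -> connect r x y.
  move=> xS yS; move/forall_inP: cT => /(_ x xS)/forall_inP/(_ y yS).
  apply: connect_sub => u v /and3P[uS vS uv]; apply: connect1.
  by rewrite /r /= !inE uS vS !orbT.
have rst : connect r s t by apply: connect1; rewrite /r /= !inE sS tT orbT.
have tos x : x \in S :|: T -> connect r x s.
  rewrite inE => /orP[xS|xT]; first exact: toS.
  by apply: connect_trans (toT _ _ xT tT) _; rewrite cr.
apply/andP; split; first by apply/set0Pn; exists s; rewrite inE sS.
apply/forall_inP => x xX; apply/forall_inP => y yX.
by apply: connect_trans (tos _ xX) _; rewrite cr; apply: tos.
Qed.

Lemma acyclic_partitionsP C :
  reflect [/\ connected_partition A C.1,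
              forall U W, (U, W) \in C.2 -> part_adj A C.1 U W,
              forall U W, part_adj A C.1 U W ->
                ((U, W) \in C.2) (+) ((W, U) \in C.2) & acyclic C]
          (C \in acyclic_partitions A).
Proof.
rewrite inE; apply: (iffP and3P) => [[cP oC /asboolP aC]|[cP o1 o2 aC]].
  split=> // U W; move/forallP: oC => /(_ U)/forallP/(_ W)/andP[/implyP h1 /implyP h2] //.
split=> //; last exact/asboolP.
by apply/forallP => U; apply/forallP => W; apply/andP; split; apply/implyP; [exact: o1|exact: o2].
Qed.

Lemma contract_acyclic_partition C e : A^T = A ->
  C \in acyclic_partitions A -> contractible C e ->
  contract C e \in acyclic_partitions A.
Proof.
move=> As /acyclic_partitionsP[/andP[pP cP] o1 o2 aC] /andP[eC /asboolP aCe].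
have [e1 e2 ne we] : [/\ e.1 \in C.1, e.2 \in C.1, e.1 != e.2 &
    (0 < part_weight A e.1 e.2)%N].
  by apply/and4P; apply: o1; rewrite -surjective_pairing.
apply/acyclic_partitionsP; split=> //=.
- rewrite /connected_partition partition_merge_part //=.
  apply/forall_inP => X /imsetP[U UP ->]; rewrite /merge_part.
  case: ifP => _; last exact: (forall_inP cP).
  by apply: connected_setU => //; apply: (forall_inP cP).
- move=> X Y XY; have [nXY _] := acyclic_arc aCe XY.
  move: XY nXY => /imsetP[[U W]]; rewrite inE => /andP[_ UW] [-> ->] nm.
  have /and4P[UP WP nUW] := o1 _ _ UW; rewrite part_weight_pos.
  move=> /exists_inP[u uU /exists_inP[w wW uw]].
  apply/and4P; split=> //; try exact: imset_f.
  rewrite part_weight_pos; apply/exists_inP; exists u.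
    exact: (subsetP (sub_merge_part _ _)).
  apply/exists_inP; exists w => //; exact: (subsetP (sub_merge_part _ _)).
- move=> X Y /and4P[/imsetP[U UP ->] /imsetP[W WP ->] nm].
  rewrite part_weight_pos => /exists_inP[u uU /exists_inP[w wW uw]].
  have [U' U'P [uU' eU]] := merge_part_cover e1 e2 UP uU.
  have [W' W'P [wW' eW]] := merge_part_cover e1 e2 WP wW.
  rewrite -eU -eW in nm *.
  have nUW : U' != W' by apply: contraNneq nm => ->.
  have adj : part_adj A C.1 U' W'.
    apply/and4P; split=> //; rewrite part_weight_pos.
    by apply/exists_inP; exists u => //; apply/exists_inP; exists w.
  have inE' (S T : {set 'I_n}) : merge_part e S != merge_part e T -> (S, T) \in C.2 ->
      (merge_part e S, merge_part e T) \in contract_arc e @: (C.2 :\ e).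
    move=> nST ST; apply/imsetP; exists (S, T) => //; rewrite !inE ST andbT.
    by apply: contra_neqN nST => /eqP <-; rewrite /merge_part /= !eqxx orbT.
  have := o2 _ _ adj; have [UW _|_ WU] := boolP ((U', W') \in C.2).
    have h := inE' _ _ nm UW; rewrite h.
    by have [_] := acyclic_arc aCe h => /negPf ->.
  rewrite eq_sym in nm; have h := inE' _ _ nm WU; rewrite h.
  by have [_] := acyclic_arc aCe h => /negPf ->.
Qed.

Lemma out_vecE C u : partition C.1 [set: 'I_n] ->
  (forall U W, (U, W) \in C.2 -> W \in C.1) ->
  out_vec A C u =
  (\sum_(w | (pblock C.1 u, pblock C.1 w) \in C.2) A u w)%N.
Proof.
move=> /and3P[/eqP cP tP nP] h; rewrite mnmE.
rewrite (exchange_big_dep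
  (fun w => (pblock C.1 u, pblock C.1 w) \in C.2)) /=; last first.
  by move=> W w UW wW; rewrite (def_pblock tP (h _ _ UW) wW).
apply: eq_bigr => w uw; rewrite (big_pred1 (pblock C.1 w)) // => W /=.
apply/andP/eqP => [[UW wW]|->]; last by rewrite mem_pblock cP inE.
by rewrite (def_pblock tP (h _ _ UW) wW).
Qed.

Lemma out_vec_contract C e : A^T = A ->
  C \in acyclic_partitions A -> contractible C e ->
  (out_vec A (contract C e) <= out_vec A C)%MM.
Proof.
move=> As aC ce; have aCe := contract_acyclic_partition As aC ce.
move: aC ce => /acyclic_partitionsP[/andP[pP cP] o1 o2 aC] /andP[eC _].
have [e1 e2 ne we] : [/\ e.1 \in C.1, e.2 \in C.1, e.1 != e.2 &
    (0 < part_weight A e.1 e.2)%N].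
  by apply/and4P; apply: o1; rewrite -surjective_pairing.
move: aCe => /acyclic_partitionsP[/andP[pP' cP'] o1' o2' aC'].
have cov w : w \in cover C.1 by case/and3P: pP => /eqP-> _ _; rewrite inE.
have pb w : pblock (contract C e).1 w = merge_part e (pblock C.1 w).
  case/and3P: pP' => _ tP' _; apply: def_pblock => //.
    by apply: imset_f; apply: pblock_mem.
  by apply: (subsetP (sub_merge_part _ _)); rewrite mem_pblock.
apply/mnm_lepP => u; rewrite !out_vecE //; last 2 first.
- by move=> U W /o1 /and4P[].
- by move=> U W /o1' /and4P[].
rewrite [X in (_ <= X)%N]big_mkcond [X in (X <= _)%N]big_mkcond /=.
apply: leq_sum => w _; case: ifP => // uwE'; case: ifPn => // uwE.
rewrite leqNgt; apply/negP => uw; rewrite !pb in uwE'.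
have [nm nE'] := acyclic_arc aC' uwE'.
have /o2 : part_adj A C.1 (pblock C.1 u) (pblock C.1 w).
  apply/and4P; split; rewrite ?pblock_mem //.
    by apply: contraNneq nm => ->.
  rewrite part_weight_pos; apply/exists_inP; exists u; first by rewrite mem_pblock.
  by apply/exists_inP; exists w; rewrite ?mem_pblock.
rewrite (negPf uwE) /= => wuE; case/negP: nE'.
apply/imsetP; exists (pblock C.1 w, pblock C.1 u) => //; rewrite !inE wuE andbT.
apply: contraNneq nm => <- /=.
by rewrite /merge_part !eqxx orbT.
Qed.

Lemma class_contract_in k (c : {set part_digraph n}) e : A^T = A ->
  c \in chip_classes A k.+1 -> class_contractible c e ->
  class_contract A c e \in chip_classes A k.
Proof.
move=> As /imsetP[C0]; rewrite inE => /andP[_ /eqP kC0] -> ce; rewrite /class_contract.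
case: pickP => [C|h]; last first.
  by case/exists_inP: ce => C Cc Ce; have := h C; rewrite Cc Ce.
rewrite inE => /andP[/andP[aC /andP[/eqP eqC _]] Ce]; rewrite {}eqC in kC0.
apply/imsetP; exists (contract C e) => //.
rewrite inE; apply/andP; split; first exact: contract_acyclic_partition.
move: aC Ce => /acyclic_partitionsP[/andP[pP _] o1 _ _] /andP[eC _].
have [e1 e2 ne _] : [/\ e.1 \in C.1, e.2 \in C.1, e.1 != e.2 &
    (0 < part_weight A e.1 e.2)%N].
  by apply/and4P; apply: o1; rewrite -surjective_pairing.
have -> : (contract C e).1 = merge_part e @: (C.1 :\ e.2).
  apply/setP => X; apply/imsetP/imsetP => -[Y YP ->].
    have [->|nY] := eqVneq Y e.2; last by exists Y; rewrite // !inE nY.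
    by exists e.1; rewrite ?inE ?ne // /merge_part !eqxx orbT.
  by exists Y; last by []; move: YP; rewrite !inE => /andP[].
rewrite card_in_imset; last first.
  move=> X Y; rewrite !inE => /andP[nX XP] /andP[nY YP] eXY.
  case/and3P: pP => _ tP nP.
  have [/set0Pn[x xX] /set0Pn[y yY]] : X != set0 /\ Y != set0.
    by split; apply: contraNneq nP => <-.
  have h (S T : {set 'I_n}) s : S \in C.1 -> T \in C.1 -> s \in S -> s \in T -> S = T.
    by move=> SP TP sS sT; rewrite -(def_pblock tP SP sS) (def_pblock tP TP sT).
  move: eXY; rewrite /merge_part (negPf nX) (negPf nY) !orbF.
  case: eqP => [->|nX1]; case: eqP => [->|nY1] //.
    have /set0Pn[z z1] : e.1 != set0 by apply: contraNneq nP => <-.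
    move=> eY.
    by apply: (h _ _ z) => //; rewrite -eY inE z1.
  have /set0Pn[z z1] : e.1 != set0 by apply: contraNneq nP => <-.
  move=> eX.
  by apply: (h _ _ z) => //; rewrite eX inE z1.
by apply/eqP; have := cardsD1 e.2 C.1; rewrite e2 kC0 => -[].
Qed.

End Contraction.

Lemma delta_linear (K : fieldType) n (A : 'M[nat]_n)
    (sgn : {set part_digraph n} -> part_arc n -> int) k :
  linear (delta K A sgn k).
Proof.
move=> a u v; rewrite /delta scaler_sumr -big_split; apply: eq_bigr => c _.
by rewrite !ffunE /= scalerA -scalerDl.
Qed.

HB.instance Definition _ (K : fieldType) n (A : 'M[nat]_n)
    (sgn : {set part_digraph n} -> part_arc n -> int) k :=
  GRing.isLinear.Build {mpoly K[n]} (resF K A k.+1) (resF K A k) _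
    (delta K A sgn k) (@delta_linear K n A sgn k).

(* Main.v *)
Require Import Defs.
From HB Require Import structures.
From mathcomp Require Import all_boot all_order all_algebra.
From mathcomp Require Import boolp.
From mathcomp.multinomials Require Import mpoly.
From mathcomp Require Import zify ring.

Set Implicit Arguments.
Unset Strict Implicit.
Unset Printing Implicit Defensive.

Import Order.TTheory GRing.Theory Num.Theory.
Local Open Scope ring_scope.

(* The classes of acyclic partitions are the cells of the quotient, by integral
   translations, of the arrangement of the hyperplanes f_u - f_w = integer (u, w
   adjacent) in the space of potentials f on the vertices modulo constants.  An
   acyclic partition is recorded by the set O of its oriented vertex pairs; these
   sets are exactly those of the form {(u, w) adjacent | h w < h u}, and two of
   them are chip firing equivalent iff their difference is the coboundary of an
   integral potential.

   Fix a vertex q.  Each class contains a unique acyclic partition whose only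
   sink is the part Q of q.  The basis x^m c of the complex over K is matched as
   follows.  Given such an O and m, let S be the largest set avoiding q that can
   fire legally inside the parts of O, and let X be O together with the pairs
   leaving S.  Among the parts of X lying directly above that of q choose one, T,
   depending on X only: if T is contained in Q, split T off Q; otherwise T is a
   part of O, and contract the arc (T, Q).  This involution does not change X.
   Any other facet of a cell that is itself matched by splitting has a smaller X,
   or a divisor obtained by firing sets avoiding q.  So the matching is acyclic,
   and its only unmatched cells are, in degree 0, the monomials without nonempty
   legal firing set (the q-reduced divisors, one per linear equivalence class). *)

(** Working with vertex pairs makes contraction of an arc (U, W) a deletion of U x W and splitting
    an insertion, so statements about merged parts become identities between 0/1 indicators. The
    obstacle is that the facets of a class come from all of its representatives, while a matching
    has to look at one orientation. The representative with its sink at q is the one whose potential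
    towards any other representative is minimal at q. A facet seen only from another representative
    therefore moves the divisor by a nonzero firing s >= 0 with s(q) = 0, and on a connected graph
    such a move can never be undone; this gives a well-founded measure. The matching lives on
    monomial multiples, over K, because minimality leaves no unit among the coefficients over R;
    over K the matched coefficients are signs, invertible in every characteristic. Two facts are
    independent of the matching: the composite of two differentials vanishes by the sign rule, and
    the image of the last differential is I_G because a q-reduced divisor is unique in its linear
    equivalence class, by a maximum principle. *)

Lemma connect_ind (T : finType) (r : rel T) (P : T -> Prop) x y :
  P x -> (forall a b, P a -> r a b -> P b) -> connect r x y -> P y.
Proof.
move=> Px step /connectP[p rp ->]; elim: p x Px rp => //= z p IH x Px /andP[xz].
by apply: IH; apply: step xz.
Qed.

Lemma connect_ind_rev (T : finType) (r : rel T) (P : T -> Prop) x y :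
  P y -> (forall a b, P b -> r a b -> P a) -> connect r x y -> P x.
Proof.
move=> Py step /connectP[p rp yE]; move: Py; rewrite {}yE.
elim: p x rp => //= z p IH x /andP[xz rp] Py.
by apply: step xz; apply: IH.
Qed.

Lemma connect_restrict (T : finType) (r : rel T) (D : {pred T}) x y :
  (forall a b, a \in D -> r a b -> b \in D) -> x \in D -> connect r x y ->
  connect [rel a b | [&& a \in D, b \in D & r a b]] x y.
Proof.
move=> closedD xD xy.
pose P z := (z \in D) && connect [rel a b | [&& a \in D, b \in D & r a b]] x z.
suff: P y by case/andP.
apply: (connect_ind (P := P)) xy; first by rewrite /P xD connect0.
move=> a b /andP[aD xa] ab; have bD := closedD _ _ aD ab.
rewrite /P bD; apply: connect_trans xa _.
by apply: connect1; rewrite /= aD bD.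
Qed.

Lemma cycle_decreasing (T : eqType) (r : rel T) (H : T -> nat) (s : seq T) :
  (forall x y, r x y -> (H y < H x)%N) -> cycle r s -> s = [::].
Proof.
move=> rH; case: s => // x p /= cyc.
have trH : transitive [rel x y | (H y < H x)%N].
  by move=> a b c /= ab bc; apply: ltn_trans bc ab.
have := sub_path (e' := [rel x y | (H y < H x)%N]) rH cyc.
move=> /(order_path_min trH) /allP /(_ x).
by rewrite mem_rcons mem_head /= ltnn => /(_ isT).
Qed.

(** * Acyclic partitions as orientations of vertex pairs *)

Section Orientations.
Variables (n : nat) (A : 'M[nat]_n).
Hypothesis A_sym : A^T = A.
Implicit Types (O : {set 'I_n * 'I_n}) (h : 'I_n -> nat) (C : part_digraph n).
Implicit Types (e : part_arc n) (U W : {set 'I_n}).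

Definition adj u w : bool := (0 < A u w)%N.

Lemma AC u w : A u w = A w u. Proof. by rewrite -[in LHS]A_sym mxE. Qed.

Lemma adjC u w : adj u w = adj w u. Proof. by rewrite /adj AC. Qed.

Definition height_orient h : {set 'I_n * 'I_n} :=
  [set p | adj p.1 p.2 && (h p.2 < h p.1)%N].

Lemma in_height_orient h u w :
  ((u, w) \in height_orient h) = adj u w && (h w < h u)%N.
Proof. by rewrite inE. Qed.

(** For the orientation of an acyclic partition these are the edges inside the parts, so the
    partition is recovered as the components of this relation. *)
Definition unoriented O : rel 'I_n :=
  [rel u w | [&& adj u w, (u, w) \notin O & (w, u) \notin O]].

Lemma unorientedC O u w : unoriented O u w = unoriented O w u.
Proof. by rewrite /unoriented /= adjC [X in _ && X]andbC. Qed.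

Lemma unoriented_height h u w :
  unoriented (height_orient h) u w = adj u w && (h u == h w).
Proof.
rewrite /unoriented /= !in_height_orient (adjC w u) /=.
by case: (adj u w) => //=; rewrite -!leqNgt eqn_leq.
Qed.

Definition comp O u : {set 'I_n} := [set w | connect (unoriented O) u w].

Lemma mem_comp O u : u \in comp O u. Proof. by rewrite inE connect0. Qed.

Lemma unoriented_sym O : connect_sym (unoriented O).
Proof. by apply: sym_connect_sym => x y; apply: unorientedC. Qed.

Lemma comp_eq O u w : w \in comp O u -> comp O w = comp O u.
Proof.
rewrite inE => uw; apply/setP => x; rewrite !inE.
by rewrite (same_connect (@unoriented_sym O) uw).
Qed.

Lemma unoriented_comp O u w : unoriented O u w -> comp O w = comp O u.
Proof. by move=> uw; apply: comp_eq; rewrite inE connect1. Qed.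

Lemma comp_const O (T : Type) (f : 'I_n -> T) u w :
  (forall x y, unoriented O x y -> f x = f y) -> w \in comp O u -> f w = f u.
Proof.
move=> fc; rewrite inE => uw.
apply: (connect_ind (P := fun z => f z = f u)) uw => // a b <- ab.
by rewrite (fc _ _ ab).
Qed.

Lemma height_comp h u w : w \in comp (height_orient h) u -> h w = h u.
Proof.
apply: comp_const => x y.
by rewrite unoriented_height => /andP[_ /eqP].
Qed.

Definition ori C : {set 'I_n * 'I_n} :=
  [set p | adj p.1 p.2 && ((pblock C.1 p.1, pblock C.1 p.2) \in C.2)].

Lemma in_ori C u w :
  ((u, w) \in ori C) = adj u w && ((pblock C.1 u, pblock C.1 w) \in C.2).
Proof. by rewrite inE. Qed.

Lemma ori_adj C u w : (u, w) \in ori C -> adj u w.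
Proof. by rewrite in_ori => /andP[]. Qed.

Local Notation AP := (acyclic_partitions A).

Lemma AP_partition C : C \in AP -> partition C.1 [set: 'I_n].
Proof. by case/acyclic_partitionsP => /andP[]. Qed.

Lemma mem_cover_AP C u : C \in AP -> u \in cover C.1.
Proof. by move=> /AP_partition/and3P[/eqP->]; rewrite inE. Qed.

Lemma AP_pblock C U u : C \in AP -> U \in C.1 -> u \in U -> pblock C.1 u = U.
Proof. by move=> /AP_partition/and3P[_ tP _]; apply: def_pblock. Qed.

Lemma pblock_AP C u : C \in AP -> pblock C.1 u \in C.1.
Proof. by move=> CA; apply: pblock_mem; apply: mem_cover_AP. Qed.

Lemma mem_pblock_AP C u : C \in AP -> u \in pblock C.1 u.
Proof. by move=> CA; rewrite mem_pblock mem_cover_AP. Qed.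

Lemma AP_nonempty C U : C \in AP -> U \in C.1 -> exists u, u \in U.
Proof.
move=> /AP_partition/and3P[_ _ nP] UP; apply/set0Pn.
by apply: contraNneq nP => <-.
Qed.

Lemma part_adj_pblock C u w : C \in AP -> adj u w ->
  pblock C.1 u != pblock C.1 w ->
  part_adj A C.1 (pblock C.1 u) (pblock C.1 w).
Proof.
move=> CA uw ne; rewrite /part_adj !pblock_AP //= ne part_weight_pos.
apply/exists_inP; exists u; first exact: mem_pblock_AP.
by apply/exists_inP; exists w; rewrite ?mem_pblock_AP.
Qed.

Lemma AP_unoriented C u w : C \in AP ->
  unoriented (ori C) u w = adj u w && (pblock C.1 u == pblock C.1 w).
Proof.
move=> CA; rewrite /unoriented /= !in_ori (adjC w u) /=.
case uw: (adj u w) => //=; case: eqVneq => [->|ne].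
  case/acyclic_partitionsP: CA => _ _ _ aC.
  by rewrite andbb; apply/negP => /(acyclic_arc aC)[]; rewrite eqxx.
have:= part_adj_pblock CA uw ne; case/acyclic_partitionsP: CA => _ _ o2 _ /o2.
by case: (_ \in _) => //= ->.
Qed.

Lemma AP_comp C u : C \in AP -> pblock C.1 u = comp (ori C) u.
Proof.
move=> CA; have UP := pblock_AP u CA; apply/setP => w; apply/idP/idP => [wU|].
  case/acyclic_partitionsP: (CA) => /andP[_ /forall_inP/(_ _ UP)/andP[_]].
  move=> /forall_inP/(_ u (mem_pblock_AP _ CA))/forall_inP/(_ w wU) uw _ _ _.
  rewrite inE; apply: connect_sub uw => x y /= /and3P[xU yU xy].
  apply: connect1; rewrite AP_unoriented // [adj x y]xy.
  by rewrite (AP_pblock CA UP xU) (AP_pblock CA UP yU) /=.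
move=> uw; have <- : pblock C.1 w = pblock C.1 u; last exact: mem_pblock_AP.
by apply: comp_const uw => x y; rewrite AP_unoriented // => /andP[_ /eqP].
Qed.

Lemma part_comp C U u : C \in AP -> U \in C.1 -> u \in U -> U = comp (ori C) u.
Proof. by move=> CA UP uU; rewrite -AP_comp // (AP_pblock CA UP uU). Qed.

Lemma comp_part C u : C \in AP -> comp (ori C) u \in C.1.
Proof. by move=> CA; rewrite -AP_comp // pblock_AP. Qed.

Lemma AP_arc C U W : C \in AP -> (U, W) \in C.2 ->
  [/\ U \in C.1, W \in C.1 & exists u w, [/\ u \in U, w \in W & (u, w) \in ori C]].
Proof.
move=> CA UW; case/acyclic_partitionsP: (CA) => _ o1 _ _.
case/and4P: (o1 _ _ UW) => UP WP ne.
rewrite part_weight_pos => /exists_inP[u uU /exists_inP[w wW uw]].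
split=> //; exists u, w; split=> //.
by rewrite in_ori [adj _ _]uw (AP_pblock CA UP uU) (AP_pblock CA WP wW).
Qed.

Lemma ori_arc C u w : C \in AP -> (u, w) \in ori C ->
  (comp (ori C) u, comp (ori C) w) \in C.2.
Proof. by move=> CA; rewrite -!AP_comp // in_ori => /andP[]. Qed.

Lemma arc_ori C U W u w : C \in AP -> (U, W) \in C.2 -> u \in U -> w \in W ->
  adj u w -> (u, w) \in ori C.
Proof.
move=> CA UW uU wW uw; have [UP WP _] := AP_arc CA UW.
by rewrite in_ori uw (AP_pblock CA UP uU) (AP_pblock CA WP wW).
Qed.

Lemma ori_parts C1 C2 : C1 \in AP -> C2 \in AP ->
  (forall u, comp (ori C1) u = comp (ori C2) u) -> C1.1 = C2.1.
Proof.
move=> CA1 CA2 eqc; apply/setP => U.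
wlog suff: C1 C2 CA1 CA2 eqc / (U \in C1.1) -> (U \in C2.1).
  by move=> H; apply/idP/idP; apply: H.
move=> UP; have [u uU] := AP_nonempty CA1 UP.
by rewrite (part_comp CA1 UP uU) eqc comp_part.
Qed.

Lemma ori_inj C1 C2 : C1 \in AP -> C2 \in AP -> ori C1 = ori C2 -> C1 = C2.
Proof.
move=> CA1 CA2 eqO; have eP : C1.1 = C2.1 by apply: ori_parts => // u; rewrite eqO.
suff: C1.2 = C2.2 by case: C1 C2 eP {CA1 CA2 eqO} => [? ?] [? ?] /= -> ->.
apply/setP => -[U W]; wlog suff: C1 C2 CA1 CA2 eqO eP /
    ((U, W) \in C1.2) -> ((U, W) \in C2.2).
  by move=> H; apply/idP/idP; apply: H.
move=> UW; have [UP WP [u [w [uU wW uw]]]] := AP_arc CA1 UW.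
rewrite (part_comp CA1 UP uU) (part_comp CA1 WP wW) eqO.
by apply: ori_arc => //; rewrite -eqO.
Qed.

(** The number of parts reachable from the part of a vertex serves as height: along an arc it drops
    strictly, since acyclicity keeps the tail out of reach of the head. *)
Lemma AP_height C : C \in AP -> exists h, ori C = height_orient h.
Proof.
move=> CA; case/acyclic_partitionsP: (CA) => _ _ o2 aC.
pose r := [rel U W | (U, W) \in C.2].
have nocyc U W : (U, W) \in C.2 -> ~~ connect r W U.
  move=> UW; apply/negP => /connectP[p rp lp].
  suff: cycle r (W :: p) by move/aC.
  by rewrite /= rcons_path rp -lp.
exists (fun u => #|[set W | connect r (pblock C.1 u) W]|).
have lt U W : (U, W) \in C.2 ->
    (#|[set X | connect r W X]| < #|[set X | connect r U X]|)%N.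
  move=> UW; apply: proper_card; apply/properP; split.
    by apply/subsetP => X; rewrite !inE; apply: connect_trans; apply: connect1.
  by exists U; rewrite !inE ?connect0 // nocyc.
apply/setP => -[u w]; rewrite in_ori in_height_orient.
case uw: (adj u w) => //=; apply/idP/idP => [/lt//|ltuw].
case: (eqVneq (pblock C.1 u) (pblock C.1 w)) => [E|ne].
  by rewrite E ltnn in ltuw.
have /o2 := part_adj_pblock CA uw ne; case: (_ \in _) => //= /lt lt2.
by have := ltn_trans ltuw lt2; rewrite ltnn.
Qed.

(** The parts are the connected components of the level sets of [h]; each has a single height, which
    excludes loops and directed cycles. *)
Lemma exists_AP h : exists2 C, C \in AP & ori C = height_orient h.
Proof.
set O := height_orient h.
pose C : part_digraph n :=
  ([set comp O u | u in 'I_n], [set (comp O p.1, comp O p.2) | p in O]).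
have mC u : comp O u \in C.1 by apply: imset_f.
have cC u w : w \in comp O u -> comp O u = comp O w by move/comp_eq.
have pP : partition C.1 [set: 'I_n].
  apply/and3P; split.
  - apply/eqP/setP => u; rewrite inE; apply/bigcupP.
    exists (comp O u); [exact: mC|exact: mem_comp].
  - apply/trivIsetP => X Y /imsetP[u _ ->] /imsetP[w _ ->] ne.
    rewrite -setI_eq0; apply: contraNT ne => /set0Pn[x /setIP[/cC-> /cC->]] //.
  - by apply/imsetP => -[u _ E]; have := mem_comp O u; rewrite -E inE.
have pb u : pblock C.1 u = comp O u.
  by case/and3P: pP => _ tP _; apply: def_pblock => //; apply: mem_comp.
have arcP u w : adj u w -> ((comp O u, comp O w) \in C.2) = (h w < h u)%N.
  move=> uw; apply/imsetP/idP => [[[x y] xy [ex ey]]|lt]; last first.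
    by exists (u, w) => //; rewrite in_height_orient uw.
  have xu : x \in comp O u by rewrite ex mem_comp.
  have yw : y \in comp O w by rewrite ey mem_comp.
  rewrite -(height_comp xu) -(height_comp yw).
  by move: xy; rewrite in_height_orient => /andP[].
have CA : C \in AP.
  apply/acyclic_partitionsP; split.
  - apply/andP; split=> //; apply/forall_inP => U /imsetP[u _ ->].
    apply/andP; split; first by apply/set0Pn; exists u; apply: mem_comp.
    apply/forall_inP => x xu; apply/forall_inP => y yu.
    have xy : connect (unoriented O) x y.
      by move: yu; rewrite -(comp_eq xu) inE.
    have cl a b : a \in comp O u -> unoriented O a b -> b \in comp O u.
      by move=> au /unoriented_comp ab; rewrite -(comp_eq au) -ab mem_comp.
    apply: connect_sub (connect_restrict cl xu xy) => a b /= /and4P[au bu ab _].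
    by apply: connect1; rewrite /= au bu.
  - move=> U W /imsetP[[u w] uw [-> ->]]; apply/and4P; split=> //=.
      apply: contraTneq uw => E; rewrite in_height_orient.
      have uw : u \in comp O w by rewrite -E mem_comp.
      by rewrite (height_comp uw) ltnn andbF.
    rewrite part_weight_pos; apply/exists_inP; exists u; first exact: mem_comp.
    apply/exists_inP; exists w; first exact: mem_comp.
    by move: uw; rewrite in_height_orient => /andP[].
  - move=> U W /and4P[/imsetP[u _ ->] /imsetP[w _ ->] ne].
    rewrite part_weight_pos => /exists_inP[x xu /exists_inP[y yw xy]].
    rewrite -(comp_eq xu) -(comp_eq yw) !arcP // 1?adjC //.
    have : h x != h y.
      apply: contraNneq ne => E; rewrite -(comp_eq xu) -(comp_eq yw).
      by rewrite (@unoriented_comp O x y) // unoriented_height E eqxx andbT.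
    by case: ltngtP.
  - move=> s; apply: (@cycle_decreasing _ _ (fun U => \max_(x in U) h x)%N).
    move=> U W /imsetP[[u w] uw [-> ->]] /=.
    have hm v : (\max_(x in comp O v) h x)%N = h v.
      apply/eqP; rewrite eqn_leq; apply/andP; split.
        by apply/bigmax_leqP => x xv; rewrite (height_comp xv).
      by apply: (leq_bigmax_cond (F := h)); apply: mem_comp.
    by rewrite !hm; move: uw; rewrite in_height_orient => /andP[].
exists C => //; apply/setP => -[u w]; rewrite in_ori in_height_orient !pb.
by case uw: (adj u w) => //=; rewrite arcP.
Qed.

(* Contraction of the arc (U, W) deletes the pairs of U * W. *)
Definition arc_pairs e : {set 'I_n * 'I_n} := setX e.1 e.2.

Lemma in_arc_pairs e u w : ((u, w) \in arc_pairs e) = (u \in e.1) && (w \in e.2).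
Proof. by rewrite in_setX. Qed.

Lemma in_setDpairs O e u w : ((u, w) \in O :\: arc_pairs e) =
  ~~ ((u \in e.1) && (w \in e.2)) && ((u, w) \in O).
Proof. by rewrite in_setD in_arc_pairs. Qed.

Lemma pblock_contract C e u : C \in AP -> e \in C.2 ->
  pblock (contract C e).1 u = merge_part e (pblock C.1 u).
Proof.
move=> CA; rewrite [e]surjective_pairing => eC.
have [e1 e2 _] := AP_arc CA eC; rewrite -surjective_pairing.
have /and3P[_ tP _] := partition_merge_part e1 e2 (AP_partition CA).
apply: def_pblock => //; first by apply: imset_f; apply: pblock_AP.
by apply: (subsetP (sub_merge_part _ _)); apply: mem_pblock_AP.
Qed.

(** An arc between merged parts might stem from parts other than those of [u] and [w]; but if [C]
    directed these two the opposite way, the contraction would contain a 2-cycle. *)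
Lemma ori_contract C e : C \in AP -> contractible C e ->
  ori (contract C e) = ori C :\: arc_pairs e.
Proof.
move=> CA ce; have CA' := contract_acyclic_partition A_sym CA ce.
case/andP: (ce) => eC /asboolP aC'.
have [e1 e2 _] : [/\ e.1 \in C.1, e.2 \in C.1 & True].
  by case: (e) eC => U W /(AP_arc CA)[].
have me12 : merge_part e e.1 = merge_part e e.2.
  by rewrite /merge_part !eqxx orbT.
apply/setP => -[u w]; rewrite in_setDpairs !in_ori !pblock_contract //.
case uw: (adj u w); last by rewrite andbF.
have inE1 x U : U \in C.1 -> (x \in U) = (pblock C.1 x == U).
  move=> UP; apply/idP/eqP => [|<-]; [exact: AP_pblock|exact: mem_pblock_AP].
rewrite !inE1 //=; apply/imsetP/andP => [[[X Y]]|[ne uwC]]; last first.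
  exists (pblock C.1 u, pblock C.1 w) => //; rewrite !inE uwC andbT.
  by apply: contraNneq ne => <-; rewrite /= !eqxx.
move=> XY E.
have uwC' : (merge_part e (pblock C.1 u), merge_part e (pblock C.1 w)) \in
    (contract C e).2 by rewrite E; apply: imset_f.
have [neM nwu] := acyclic_arc aC' uwC'.
have ne : pblock C.1 u != pblock C.1 w by apply: contraNneq neM => ->.
split.
  apply: contraNN neM => /andP[/eqP-> /eqP->]; exact/eqP.
have /acyclic_partitionsP[_ _ o2 _] := CA.
have /o2 := part_adj_pblock CA uw ne; case: (_ \in _) => //= wuC.
case/negP: nwu; apply/imsetP; exists (pblock C.1 w, pblock C.1 u) => //.
rewrite !inE wuC andbT; apply: contraNneq neM => E2.
by rewrite -[pblock C.1 u]/((pblock C.1 w, pblock C.1 u).2)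
  -[pblock C.1 w]/((pblock C.1 w, pblock C.1 u).1) E2 me12.
Qed.

(** The height is constant on each part of [C] and, since the deleted pairs become level, on
    [e.1 :|: e.2]; so it decreases along every arc of the contraction. *)
Lemma contractible_height C e h : C \in AP -> e \in C.2 ->
  ori C :\: arc_pairs e = height_orient h -> contractible C e.
Proof.
move=> CA eC Oh; rewrite /contractible eC; apply/asboolP => s.
have [e1P e2P [u0 [w0 [u0e w0e uw0]]]] : [/\ e.1 \in C.1, e.2 \in C.1 &
    exists u w, [/\ u \in e.1, w \in e.2 & (u, w) \in ori C]].
  by case: (e) eC => U W /(AP_arc CA)[].
have hU U x y : U \in C.1 -> x \in U -> y \in U -> h x = h y.
  move=> UP xU yU; have : y \in comp (ori C) x by rewrite -(part_comp CA UP xU).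
  move/comp_const => -> // a b; rewrite AP_unoriented // => /andP[ab /eqP eab].
  have: (a, b) \notin height_orient h.
    rewrite -Oh in_setDpairs in_ori eab; case/acyclic_partitionsP: CA => _ _ _ aC.
    by apply: contraTN isT => /and3P[_ _ /(acyclic_arc aC)[]]; rewrite eqxx.
  have: (b, a) \notin height_orient h.
    rewrite -Oh in_setDpairs in_ori eab; case/acyclic_partitionsP: CA => _ _ _ aC.
    by apply: contraTN isT => /and3P[_ _ /(acyclic_arc aC)[]]; rewrite eqxx.
  rewrite !in_height_orient (adjC b a) ab /= -!leqNgt => ba ab'.
  by apply/eqP; rewrite eqn_leq ab' ba.
have h12 : h u0 = h w0.
  have /acyclic_partitionsP[_ _ _ aC] := CA.
  have ab := ori_adj uw0.
  have n1 : (u0, w0) \notin height_orient h by rewrite -Oh in_setDpairs u0e w0e.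
  have n2 : (w0, u0) \notin height_orient h.
    rewrite -Oh in_setDpairs negb_and orbC in_ori (AP_pblock CA e1P u0e).
    rewrite (AP_pblock CA e2P w0e) (adjC w0) ab /=.
    by case: (acyclic_arc aC (_ : (e.1, e.2) \in C.2)); rewrite -?surjective_pairing // => _ ->.
  move: n1 n2; rewrite !in_height_orient (adjC w0) ab /=; lia.
have hm U x y : U \in C.1 -> x \in merge_part e U -> y \in merge_part e U -> h x = h y.
  move=> UP; rewrite /merge_part; case: ifP => _; last exact: hU.
  by rewrite !inE => /orP[]xe /orP[]ye;
    rewrite ?(hU _ _ _ e1P xe u0e) ?(hU _ _ _ e2P xe w0e)
            ?(hU _ _ _ e1P ye u0e) ?(hU _ _ _ e2P ye w0e) ?h12.
apply: (@cycle_decreasing _ _ (fun U => \max_(x in U) h x)%N) => X Y /=.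
move=> /imsetP[[U W]]; rewrite !inE => /andP[neE UWC] [-> ->].
have [UP WP [u [w [uU wW uw]]]] := AP_arc CA UWC.
have maxE V x : V \in C.1 -> x \in V -> (\max_(y in merge_part e V) h y)%N = h x.
  move=> VP xV; have xm := subsetP (sub_merge_part e V) _ xV.
  apply/eqP; rewrite eqn_leq; apply/andP; split.
    by apply/bigmax_leqP => y ym; rewrite (hm _ _ _ VP ym xm).
  by apply: (leq_bigmax_cond (F := h)).
rewrite (maxE U u) // (maxE W w) //.
have : (u, w) \in height_orient h; last by rewrite in_height_orient => /andP[].
rewrite -Oh in_setDpairs uw andbT; apply: contraNN neE => /andP[ue we].
by rewrite -(AP_pblock CA UP uU) (AP_pblock CA e1P ue) -(AP_pblock CA WP wW)
  (AP_pblock CA e2P we) -surjective_pairing.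
Qed.

End Orientations.

(** * Chip firing equivalence *)

Local Notation b2z b := (Posz (nat_of_bool b)).

Lemma laplacian_sum (V : finType) (w : V -> V -> nat) (s : V -> int) v :
  (forall x y, w x y = w y x) ->
  \sum_u s u * laplacian w u v = \sum_u (w v u)%:Z * (s v - s u).
Proof.
move=> wC; under eq_bigr => u _ do rewrite /laplacian mulrBr.
under [RHS]eq_bigr => u _ do rewrite mulrBr.
rewrite !sumrB; congr (_ - _); last first.
  by apply: eq_bigr => u _; rewrite mulrC wC.
rewrite (bigD1 v) //= eqxx [X in _ + X]big1; last by move=> u /negPf ->; rewrite mulr0.
rewrite addr0 -natz natr_sum mulr_sumr.
by apply: eq_bigr => u _; rewrite natz mulrC.
Qed.

Section ChipFiring.
Variables (n : nat) (A : 'M[nat]_n).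
Hypothesis A_sym : A^T = A.
Implicit Types (O : {set 'I_n * 'I_n}) (h : 'I_n -> nat) (C : part_digraph n).
Implicit Types (e : part_arc n) (U W : {set 'I_n}) (s : 'I_n -> int).

Local Notation AP := (acyclic_partitions A).
Local Notation adj := (adj A).
Local Notation comp := (comp A).
Local Notation ori := (ori A).
Local Notation unoriented := (unoriented A).
Local Notation height_orient := (height_orient A).

Definition lap s u : int := \sum_w (A u w)%:Z * (s u - s w).

Lemma lapB s1 s2 u : lap (fun x => s1 x - s2 x) u = lap s1 u - lap s2 u.
Proof. by rewrite /lap -sumrB; apply: eq_bigr => w _; ring. Qed.

Lemma lapD s1 s2 u : lap (fun x => s1 x + s2 x) u = lap s1 u + lap s2 u.
Proof. by rewrite /lap -big_split; apply: eq_bigr => w _ /=; ring. Qed.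

Lemma lin_equivP (D1 D2 : {ffun 'I_n -> int}) :
  lin_equiv A D1 D2 <-> exists s, forall u, D1 u - D2 u = lap s u.
Proof.
have AC' := AC A_sym.
split=> [[s /ffunP E]|[s E]].
  by exists s => u; have := E u; rewrite !ffunE laplacian_sum.
exists [ffun u => s u]; apply/ffunP => u; rewrite !ffunE laplacian_sum //.
rewrite E; apply: eq_bigr => w _; by rewrite !ffunE.
Qed.

Definition outv O : 'X_{1..n} := [multinom (\sum_w A u w * ((u, w) \in O))%N | u < n].

Lemma out_vec_ori C : C \in AP -> out_vec A C = outv (ori C).
Proof.
move=> CA; apply/mnmP => u; rewrite out_vecE; last 2 first.
- exact: AP_partition CA.
- by move=> U W /(AP_arc CA)[].
rewrite mnmE big_mkcond; apply: eq_bigr => w _; rewrite in_ori.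
case: (_ \in C.2); rewrite ?andbT ?andbF ?muln0 //.
by rewrite /adj; case: (A u w) => //= a; rewrite muln1.
Qed.

Definition arr O u w : int := b2z ((u, w) \in O).

Lemma arr_ge0 O u w : 0 <= arr O u w.
Proof. by []. Qed.

Lemma arr_le1 O u w : arr O u w <= 1.
Proof. by rewrite /arr; case: (_ \in _). Qed.

Lemma arr_height h u w : adj u w -> arr (height_orient h) u w = b2z (h w < h u)%N.
Proof. by rewrite /arr in_height_orient => ->. Qed.

(** The edge by edge form of chip firing equivalence, see [chip_equivP]. *)
Definition orient_equiv O1 O2 := exists s, forall u w, adj u w ->
  s u - s w = arr O1 u w - arr O2 u w.

Lemma orient_equiv_refl O : orient_equiv O O.
Proof. by exists (fun _ => 0) => u w _; rewrite !subrr. Qed.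

Lemma orient_equiv_sym O1 O2 : orient_equiv O1 O2 -> orient_equiv O2 O1.
Proof. by case=> s E; exists (fun u => - s u) => u w /E; lia. Qed.

Lemma orient_equiv_trans O1 O2 O3 :
  orient_equiv O1 O2 -> orient_equiv O2 O3 -> orient_equiv O1 O3.
Proof.
move=> [s E] [t F]; exists (fun u => s u + t u) => u w uw.
by have := E _ _ uw; have := F _ _ uw; rewrite /=; lia.
Qed.

Lemma outvB_lap O1 O2 s : (forall u w, adj u w ->
    s u - s w = arr O1 u w - arr O2 u w) ->
  forall u, (outv O1 u)%:Z - (outv O2 u)%:Z = lap s u.
Proof.
move=> E u; rewrite !mnmE -!natz !natr_sum -sumrB; apply: eq_bigr => w _.
have := E u w; rewrite /arr /adj !natz; case: (A u w) => [|a]; first by rewrite !mul0n mul0r subrr.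
by move=> /(_ isT) ->; rewrite !PoszM; ring.
Qed.

Lemma ori_swap C u w : C \in AP -> adj u w ->
  arr (ori C) u w + arr (ori C) w u =
  b2z (pblock C.1 u != pblock C.1 w).
Proof.
move=> CA uw; have := AP_unoriented A_sym u w CA; rewrite /unoriented /arr /= uw /=.
have [h ->] := AP_height CA; rewrite !in_height_orient (adjC A_sym w) uw /=.
by case: eqP; lia.
Qed.

Lemma arr_part C u w : C \in AP -> adj u w -> pblock C.1 u = pblock C.1 w ->
  arr (ori C) u w = 0.
Proof.
move=> CA uw E; have := ori_swap CA uw; rewrite E eqxx /=.
have := arr_ge0 (ori C) u w; have := arr_ge0 (ori C) w u; lia.
Qed.

Lemma sum_parts C (F : 'I_n -> int) (CA : C \in AP) :
  \sum_k F k = \sum_(U : {U | U \in C.1}) \sum_(k in val U) F k.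
Proof.
pose p k : {U | U \in C.1} := exist _ (pblock C.1 k) (pblock_AP k CA).
rewrite (partition_big p predT) //=; apply: eq_bigr => -[U UP] _.
apply: eq_bigl => k; rewrite -val_eqE /=; apply/eqP/idP => [<-|kU].
  exact: (mem_pblock_AP k CA).
exact: (AP_pblock CA UP kU).
Qed.

(* Summing the balance over a union M of parts leaves only the arcs leaving M,
   where every term has the same sign. *)
Lemma cut_balance C1 C2 (M : {set 'I_n}) s :
  C1 \in AP -> C2 \in AP -> C1.1 = C2.1 ->
  (forall U, U \in C1.1 ->
    \sum_(j in U) ((outv (ori C1) j)%:Z - (outv (ori C2) j)%:Z) =
    \sum_(j in U) lap s j) ->
  (forall j w, pblock C1.1 j = pblock C1.1 w -> j \in M -> w \in M) ->
  let x j w := arr (ori C1) j w - arr (ori C2) j w - (s j - s w) in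
  (forall j w, adj j w -> j \in M -> w \notin M -> x j w <= 0) ->
  forall j w, adj j w -> j \in M -> w \notin M -> x j w = 0.
Proof.
move=> CA1 CA2 eP bal closedM x xle.
have balx U : U \in C1.1 -> \sum_(j in U) \sum_w (A j w)%:Z * x j w = 0.
  move=> /bal E; rewrite (eq_bigr (fun j =>
    ((outv (ori C1) j)%:Z - (outv (ori C2) j)%:Z) - lap s j)); last first.
    move=> j _; rewrite /lap !mnmE -!natz !natr_sum -!sumrB.
    by apply: eq_bigr => w _; rewrite /x /arr !natz !PoszM; ring.
  by rewrite sumrB E subrr.
have balM : \sum_(j in M) \sum_w (A j w)%:Z * x j w = 0.
  rewrite big_mkcond (sum_parts _ CA1) big1 // => -[U UP] _ /=.
  have [u uU] := AP_nonempty CA1 UP.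
  case uM: (u \in M).
    rewrite -[RHS](balx U UP); apply: eq_bigr => j jU.
    by rewrite (closedM u) ?(AP_pblock CA1 UP) ?(AP_pblock CA1 UP jU).
  rewrite big1 // => j jU; rewrite ifN //; apply: contraFN uM => jM.
  by rewrite (closedM j) ?(AP_pblock CA1 UP) ?(AP_pblock CA1 UP jU).
(* Both orientations orient the same edges, so [x] is antisymmetric and the terms inside [M]
   cancel. *)
have inM : \sum_(j in M) \sum_(w in M) (A j w)%:Z * x j w = 0.
  set Y := LHS; suff : Y = - Y by lia.
  rewrite {1}/Y exchange_big /= -sumrN; apply: eq_bigr => j _.
  rewrite -sumrN; apply: eq_bigr => w _; rewrite (AC A_sym w j) -mulrN.
  case jw: (adj j w); last by move: jw; rewrite /adj lt0n => /negbFE/eqP->; rewrite !mul0r.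
  congr (_ * _); rewrite /x.
  have := ori_swap CA1 jw; have := ori_swap CA2 jw; rewrite eP.
  lia.
have outM : \sum_(j in M) \sum_(w | w \notin M) - ((A j w)%:Z * x j w) = 0.
  under eq_bigr => j _ do rewrite sumrN.
  rewrite sumrN -[RHS]oppr0; congr (- _); rewrite -[RHS]balM -[LHS]add0r -{1}inM.
  rewrite -big_split /=; apply: eq_bigr => j _.
  by rewrite [RHS](bigID (mem M)).
have term j w : j \in M -> w \notin M -> 0 <= - ((A j w)%:Z * x j w).
  move=> jM wM; case jw: (adj j w); first by have := xle j w jw jM wM; nia.
  by move: jw; rewrite /adj lt0n => /negbFE/eqP->; lia.
move=> j w jw jM wM.
have := Num.Theory.psumr_eq0P _ outM; move=> /(_ _ j jM) E1.
have {E1} E1 : \sum_(w | w \notin M) - ((A j w)%:Z * x j w) = 0.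
  by apply: E1 => i iM; apply: Num.Theory.sumr_ge0 => k; apply: term.
have := Num.Theory.psumr_eq0P _ E1; move=> /(_ _ w wM) E2.
have {E2} E2 : - ((A j w)%:Z * x j w) = 0 by apply: E2 => k; apply: term.
move: E2 jw; rewrite /adj; nia.
Qed.

(** Equal sums over the parts force equality on every edge. The sets [M t k] follow the
    lexicographic order by decreasing [s], then increasing height. On an edge leaving such a set
    either [s] drops by at least 1, or [s] is level and [C1] does not orient the edge outwards; so
    the excess in [cut_balance] is at most 0. Every edge between distinct parts leaves such a set in
    one of its directions. *)
Lemma balance_orient_equiv C1 C2 s :
  C1 \in AP -> C2 \in AP -> C1.1 = C2.1 ->
  (forall j w, pblock C1.1 j = pblock C1.1 w -> s j = s w) ->
  (forall U, U \in C1.1 ->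
    \sum_(j in U) ((outv (ori C1) j)%:Z - (outv (ori C2) j)%:Z) =
    \sum_(j in U) lap s j) ->
  forall u w, adj u w ->
    s u - s w = arr (ori C1) u w - arr (ori C2) u w.
Proof.
move=> CA1 CA2 eP sc bal.
have [h hE] := AP_height CA1.
pose M t k := [set a | (s a > t)%R || (s a == t) && (h a <= k)%N].
have key j w : adj j w -> (s w < s j)%R \/ s w = s j /\ (h j < h w)%N ->
    s j - s w = arr (ori C1) j w - arr (ori C2) j w.
  move=> jw lt.
  have := @cut_balance C1 C2 (M (s j) (h j)) s CA1 CA2 eP bal.
  have cl : forall a b, pblock C1.1 a = pblock C1.1 b ->
    a \in M (s j) (h j) -> b \in M (s j) (h j).
    move=> a b ab; rewrite !inE (sc _ _ ab).
    have -> // : h a = h b.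
    have : b \in comp (ori C1) a by rewrite -AP_comp // ab (mem_pblock_AP _ CA1).
    by rewrite hE => /(height_comp A_sym).
  move=> /(_ cl) /= key; have {}key := key _ j w jw.
  suff : arr (ori C1) j w - arr (ori C2) j w - (s j - s w) = 0 by lia.
  apply: key.
  - move=> a b ab; rewrite hE arr_height // !inE.
    have := arr_ge0 (ori C2) a b; have := arr_le1 (ori C2) a b; lia.
  - by rewrite inE; lia.
  - rewrite inE; lia.
move=> u w uw; have wu : adj w u by rewrite adjC.
case: (ltgtP (s u) (s w)) => [lt|lt|E].
- have := key w u wu (or_introl lt); have := ori_swap CA1 uw; have := ori_swap CA2 uw.
  rewrite eP; lia.
- exact: key uw (or_introl lt).
case: (ltngtP (h u) (h w)) => [lt|lt|E2].
- by apply: key => //; right.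
- have := key w u wu (or_intror (conj E lt)).
  have := ori_swap CA1 uw; have := ori_swap CA2 uw; rewrite eP; lia.
have pE : pblock C1.1 u = pblock C1.1 w.
  have := AP_unoriented A_sym u w CA1; rewrite hE unoriented_height // uw E2 eqxx.
  by move=> /esym/eqP.
by rewrite !arr_part ?E ?subrr // -eP.
Qed.

(** A coboundary is antisymmetric, so the sum of [arr] over both directions of an edge is the same
    for both orientations; it tells whether the edge lies inside a part. *)
Lemma orient_equiv_parts C1 C2 : C1 \in AP -> C2 \in AP ->
  orient_equiv (ori C1) (ori C2) -> C1.1 = C2.1.
Proof.
move=> CA1 CA2 [s E]; apply: (ori_parts A_sym) => // u.
apply/setP => w; rewrite !inE; apply: eq_connect => x y.
rewrite !AP_unoriented //; case xy: (adj x y) => //=.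
have := ori_swap CA1 xy; have := ori_swap CA2 xy.
have := E x y xy; have := E y x; rewrite adjC // => /(_ xy); lia.
Qed.

Lemma part_const C s u w : C \in AP ->
  (forall x y, unoriented (ori C) x y -> s x = s y) ->
  pblock C.1 u = pblock C.1 w -> s u = s w.
Proof.
move=> CA sc E; apply/esym; apply: (comp_const sc (A := A)).
by rewrite -AP_comp // E (mem_pblock_AP _ CA).
Qed.

Lemma part_sum_lap C s U (UP : U \in C.1) (t : {U | U \in C.1} -> int) : C \in AP ->
  (forall (V : {U | U \in C.1}) j, j \in val V -> s j = t V) ->
  \sum_(V : {U | U \in C.1}) (part_weight A U (val V))%:Z * (t (exist _ U UP) - t V) =
  \sum_(j in U) lap s j.
Proof.
move=> CA st; rewrite /lap.
under [RHS]eq_bigr => j jU.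
  rewrite (sum_parts _ CA).
  under eq_bigr => V _.
    rewrite (eq_bigr (fun k => (A j k)%:Z * (t (exist _ U UP) - t V))); last first.
      by move=> k kV; rewrite (st _ _ kV) (st (exist _ U UP)).
    rewrite -mulr_suml; over.
  over.
rewrite exchange_big /=; apply: eq_bigr => V _.
rewrite -mulr_suml; congr (_ * _); rewrite /part_weight -natz natr_sum.
by apply: eq_bigr => j _; rewrite natr_sum; apply: eq_bigr => k _; rewrite natz.
Qed.

(** The definition compares divisors only after summation over parts; [balance_orient_equiv]
    recovers the relation on edges. Conversely, a potential for the edge relation is constant on
    parts and descends to the quotient graph. *)
Lemma chip_equivP C1 C2 : C1 \in AP -> C2 \in AP ->
  chip_equiv A C1 C2 <-> orient_equiv (ori C1) (ori C2).
Proof.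
move=> CA1 CA2.
have pwC (P : {set {set 'I_n}}) (x y : {U | U \in P}) :
    part_weight A (val x) (val y) = part_weight A (val y) (val x).
  exact: part_weightC.
split=> [/andP[/eqP eP /asboolP[t /ffunP E]]|oe].
  pose p k : {U | U \in C1.1} := exist _ (pblock C1.1 k) (pblock_AP k CA1).
  have pU (V : {U | U \in C1.1}) j : j \in val V -> t (p j) = t V.
    by move=> jV; congr (t _); apply: val_inj; apply: (AP_pblock CA1 (valP V) jV).
  exists (fun k => t (p k)); apply: balance_orient_equiv => //.
    by move=> j w jw; congr (t _); apply: val_inj.
  move=> U UP; have := E (exist _ U UP).
  rewrite !ffunE laplacian_sum // => E'.
  rewrite -(part_sum_lap UP CA1 (t := t)) // -E' -sumrB !out_vec_ori //.
have eP := orient_equiv_parts CA1 CA2 oe.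
case: oe => s E; rewrite /chip_equiv eP eqxx; apply/asboolP.
have sc : forall j w, pblock C2.1 j = pblock C2.1 w -> s j = s w.
  move=> j w; rewrite -eP; apply: part_const => // x y.
  rewrite AP_unoriented // => /andP[xy /eqP exy].
  by have := E _ _ xy; rewrite !arr_part -?eP // => /eqP; rewrite subrr subr_eq0 => /eqP.
pose t (V : {U | U \in C2.1}) := if [pick k in val V] is Some k then s k else 0.
exists [ffun V => t V]; apply/ffunP => -[U UP]; rewrite !ffunE laplacian_sum //.
have st (V : {U | U \in C2.1}) j : j \in val V -> s j = t V.
  move=> jV; rewrite /t; case: pickP => [k kV|/(_ j)]; last by rewrite jV.
  by apply: sc; rewrite !(AP_pblock CA2 (valP V)).
transitivity (\sum_(j in U) lap s j); last first.
  by rewrite -(part_sum_lap UP CA2 st); apply: eq_bigr => V _; rewrite !ffunE.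
rewrite -sumrB /=; apply: eq_bigr => j _; rewrite !out_vec_ori //.
exact: outvB_lap.
Qed.

End ChipFiring.

(** * Contraction of chip firing classes *)

Section Classes.
Variables (n : nat) (A : 'M[nat]_n).
Hypothesis A_sym : A^T = A.
Implicit Types (O : {set 'I_n * 'I_n}) (h : 'I_n -> nat) (C D : part_digraph n).
Implicit Types (e : part_arc n) (U W : {set 'I_n}) (s : 'I_n -> int).
Implicit Types (c : {set part_digraph n}).

Local Notation AP := (acyclic_partitions A).
Local Notation adj := (adj A).
Local Notation comp := (comp A).
Local Notation ori := (ori A).
Local Notation height_orient := (height_orient A).
Local Notation orient_equiv := (orient_equiv A).
Local Notation outv := (outv A).

Lemma in_chip_class C C' : C \in AP ->
  C' \in chip_class A C <-> C' \in AP /\ orient_equiv (ori C) (ori C').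
Proof.
move=> CA; rewrite inE; split=> [/andP[CA' /(chip_equivP A_sym CA CA')]|[CA']] //.
by move=> /(chip_equivP A_sym CA CA') ->; rewrite CA'.
Qed.

Lemma mem_chip_class C : C \in AP -> C \in chip_class A C.
Proof. by move=> CA; apply/in_chip_class => //; split=> //; apply: orient_equiv_refl. Qed.

Lemma chip_class_eq C C' : C \in AP -> C' \in AP ->
  orient_equiv (ori C) (ori C') -> chip_class A C = chip_class A C'.
Proof.
move=> CA CA' E; apply/setP => X; apply/idP/idP => /in_chip_class[] // XA F;
  apply/in_chip_class => //; split=> //; apply: orient_equiv_trans F => //.
exact: orient_equiv_sym.
Qed.

Lemma chip_classes_mem k c C : c \in chip_classes A k -> C \in c ->
  [/\ C \in AP, #|C.1| = k & c = chip_class A C].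
Proof.
case/imsetP => C0; rewrite inE => /andP[C0A /eqP <-] -> /in_chip_class[] // CA E.
by split=> //; [rewrite (orient_equiv_parts A_sym C0A CA E)|apply: chip_class_eq].
Qed.

Lemma chip_class_in C : C \in AP -> chip_class A C \in chip_classes A #|C.1|.
Proof. by move=> CA; apply/imsetP; exists C; rewrite // inE CA eqxx. Qed.

Lemma chip_classes_mem_equiv k c C C' : c \in chip_classes A k -> C \in c -> C' \in c ->
  orient_equiv (ori C) (ori C').
Proof.
move=> ck Cc; have [CA _ ->] := chip_classes_mem ck Cc.
by case/in_chip_class.
Qed.

Lemma chip_classes_size k k' c : c \in chip_classes A k -> c \in chip_classes A k' -> k = k'.
Proof.
move=> ck ck'; case/imsetP: (ck) => C; rewrite inE => /andP[CA _] E.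
have Cc : C \in c by rewrite E mem_chip_class.
by have [_ <- _] := chip_classes_mem ck Cc; have [_ <- _] := chip_classes_mem ck' Cc.
Qed.

(** The exponent of the monomial attached to [e], written without reference to a representative; see
    [class_exponentE]. *)
Definition mexp e : 'X_{1..n} :=
  [multinom (\sum_w A u w * ((u \in e.1) && (w \in e.2)))%N | u < n].

Lemma outv_arc_pairs O O' e :
  (forall u w, adj u w -> arr O u w = arr O' u w + b2z ((u \in e.1) && (w \in e.2))) ->
  outv O = (mexp e + outv O')%MM.
Proof.
move=> E; apply/mnmP => u; rewrite mnmDE !mnmE -big_split; apply: eq_bigr => w _ /=.
rewrite -mulnDr; case uw: (adj u w); last first.
  by move: uw; rewrite /adj lt0n => /negbFE/eqP->.
by congr muln; move: (E _ _ uw); rewrite /arr;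
  case: ((u, w) \in O); case: ((u, w) \in O'); case: (_ && _).
Qed.

Lemma arr_setD O e u w : ((u \in e.1) && (w \in e.2) -> (u, w) \in O) ->
  arr O u w = arr (O :\: arc_pairs e) u w + b2z ((u \in e.1) && (w \in e.2)).
Proof. by rewrite /arr in_setDpairs; case: (_ && _) => /= [->//|_]; rewrite addr0. Qed.

Lemma arr_contract C e u w : C \in AP -> contractible C e -> adj u w ->
  arr (ori C) u w = arr (ori (contract C e)) u w + b2z ((u \in e.1) && (w \in e.2)).
Proof.
move=> CA ce uw; rewrite (ori_contract A_sym CA ce); apply: arr_setD => /andP[ue we].
case/andP: ce; rewrite [e]surjective_pairing => eC _.
exact: arc_ori CA eC ue we uw.
Qed.

(** Contraction subtracts the same indicator from all representatives, so a potential relating two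
    of them also relates their contractions. *)
Lemma class_contractE k c C e : c \in chip_classes A k -> C \in c -> contractible C e ->
  class_contract A c e = chip_class A (contract C e).
Proof.
move=> ck Cc ce; have [CA _ _] := chip_classes_mem ck Cc.
rewrite /class_contract; case: pickP => [C'|/(_ C)]; last by rewrite Cc ce.
case/andP => Cc' ce'; have [CA' _ _] := chip_classes_mem ck Cc'.
apply: chip_class_eq; try exact: contract_acyclic_partition.
have [s E] := chip_classes_mem_equiv ck Cc' Cc.
exists s => u w uw; rewrite E // (arr_contract CA ce uw) (arr_contract CA' ce' uw); ring.
Qed.

Lemma class_exponentE k c e : c \in chip_classes A k -> class_contractible c e ->
  class_exponent A c e = mexp e.
Proof.
move=> ck /exists_inP[C Cc ce]; rewrite /class_exponent.
case: pickP => [C'|/(_ C)]; last by rewrite Cc ce.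
case/andP => Cc' ce'; have [CA' _ _] := chip_classes_mem ck Cc'.
rewrite !(out_vec_ori) //; last exact: contract_acyclic_partition.
rewrite (outv_arc_pairs (O' := ori (contract C' e)) (e := e)) ?addmK //.
by move=> u w; apply: arr_contract.
Qed.

Lemma contract_in_class k c C e : c \in chip_classes A k -> C \in c -> contractible C e ->
  contract C e \in class_contract A c e.
Proof.
move=> ck Cc ce; have [CA _ _] := chip_classes_mem ck Cc.
rewrite (class_contractE ck Cc ce); apply: mem_chip_class.
exact: contract_acyclic_partition.
Qed.

Lemma class_contract_classes k c e : c \in chip_classes A k -> class_contractible c e ->
  class_contract A c e \in chip_classes A k.-1.
Proof.
case: k => [|k] ck ce; last exact: class_contract_in.
case/exists_inP: (ce) => C Cc /andP[eC _]; have [CA + _] := chip_classes_mem ck Cc.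
move: eC; rewrite [e]surjective_pairing => /(AP_arc CA)[e1P _ _].
by rewrite (cardD1 e.1) e1P.
Qed.

(** Doubling makes room between consecutive heights: raising [U] by one then orients only level
    edges leaving [U] and disturbs no existing pair. *)
Lemma arr_insert h U u w : adj u w ->
  arr (height_orient (fun x => (h x).*2 + (x \in U))%N) u w =
  arr (height_orient h) u w + b2z [&& h u == h w, u \in U & w \notin U].
Proof.
move=> uw; rewrite !arr_height //.
by case: (u \in U); case: (w \in U); lia.
Qed.

Lemma arc_parts C e : C \in AP -> e \in C.2 ->
  [/\ e.1 \in C.1, e.2 \in C.1, e.1 != e.2 & exists u w,
      [/\ u \in e.1, w \in e.2 & (u, w) \in ori C]].
Proof.
move=> CA; rewrite [e]surjective_pairing => eC; have [e1 e2 ex] := AP_arc CA eC.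
split=> //; case/acyclic_partitionsP: CA => _ _ _ aC.
by case: (acyclic_arc aC eC).
Qed.

Lemma disjoint_parts C U W u : C \in AP -> U \in C.1 -> W \in C.1 -> U != W ->
  u \in U -> u \notin W.
Proof.
move=> CA UP WP ne uU; apply: contraNN ne => uW.
by rewrite -(AP_pblock CA UP uU) -(AP_pblock CA WP uW).
Qed.

Lemma arr_split D h e u w : D \in AP -> ori D = height_orient h ->
  e.1 :|: e.2 \in D.1 -> [disjoint e.1 & e.2] -> adj u w ->
  arr (height_orient (fun x => (h x).*2 + (x \in e.1))%N) u w =
  arr (ori D) u w + b2z ((u \in e.1) && (w \in e.2)).
Proof.
move=> DA hE eP dis uw; rewrite arr_insert // hE; congr (_ + b2z _).
apply/and3P/andP => [[/eqP E ue wne]|[ue we]]; split=> //.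
- have : w \in e.1 :|: e.2; last by rewrite inE (negPf wne).
  rewrite (part_comp (A := A) A_sym DA eP (u := u)) ?inE ?ue //.
  by apply: connect1; rewrite hE unoriented_height // uw E eqxx.
- have : w \in comp (height_orient h) u.
    rewrite -hE -(part_comp A_sym DA eP) !inE ?ue // we orbT //.
  by move/(height_comp A_sym) ->.
- by apply/negP => we1; have := disjointFr dis we1; rewrite we.
Qed.

Lemma mem_arc C e u w : C \in AP -> e.1 \in C.1 -> e.2 \in C.1 ->
  u \in e.1 -> w \in e.2 -> (u, w) \in ori C -> e \in C.2.
Proof.
move=> CA e1P e2P ue we /(ori_arc A_sym CA).
by rewrite -(part_comp A_sym CA e1P ue) -(part_comp A_sym CA e2P we) -surjective_pairing.
Qed.

(** Splitting the merged part of [D] by raising [e.1] inserts the pairs of [e]; the potential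
    relating [contract C' e] to [D] then relates [C'] to the result. *)
Lemma contract_lift k c e D : c \in chip_classes A k -> class_contractible c e ->
  D \in class_contract A c e ->
  exists C, [/\ C \in c, contractible C e & contract C e = D].
Proof.
move=> ck /exists_inP[C' Cc' ce'].
have [CA' _ _] := chip_classes_mem ck Cc'.
have CeA := contract_acyclic_partition A_sym CA' ce'.
have [e1P e2P ne [u0 [w0 [u0e w0e uw0]]]] : [/\ e.1 \in C'.1, e.2 \in C'.1,
   e.1 != e.2 & exists u w, [/\ u \in e.1, w \in e.2 & (u, w) \in ori C']].
  by apply: arc_parts => //; case/andP: ce'.
have auw0 := ori_adj uw0.
rewrite (class_contractE ck Cc' ce') => /in_chip_class[] // DA [s E].
have [h hE] := AP_height DA.
have [C CA CE] := exists_AP A_sym (fun x => (h x).*2 + (x \in e.1))%N.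
have D1 : D.1 = (contract C' e).1.
  by apply/esym/(orient_equiv_parts A_sym CeA DA); exists s.
have eP : e.1 :|: e.2 \in D.1.
  by rewrite D1; apply/imsetP; exists e.1; rewrite // /merge_part eqxx.
have dis : [disjoint e.1 & e.2].
  by rewrite disjoint_subset; apply/subsetP => x /(disjoint_parts CA' e1P e2P ne).
have CD u w : adj u w -> arr (ori C) u w =
    arr (ori D) u w + b2z ((u \in e.1) && (w \in e.2)).
  by rewrite CE; apply: arr_split.
have equ : orient_equiv (ori C') (ori C).
  by exists s => u w uw; rewrite E // CD // (arr_contract CA' ce' uw); ring.
have C1 := orient_equiv_parts A_sym CA' CA equ.
have Cc : C \in c.
  by have [_ _ ->] := chip_classes_mem ck Cc'; apply/in_chip_class.
have eC : e \in C.2.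
  apply: (mem_arc CA (u := u0) (w := w0)); rewrite -?C1 //.
  have := CD _ _ auw0; have := arr_ge0 (ori D) u0 w0; rewrite u0e w0e /=.
  move: (arr (ori D) u0 w0) => a a0 E0; have : arr (ori C) u0 w0 != 0.
    by rewrite E0; clear -a0; lia.
  by rewrite /arr; apply: contraNT => /negPf ->.
have CeD : ori C :\: arc_pairs e = ori D.
  apply/setP => -[u w]; rewrite in_setDpairs.
  case uw: (adj u w); last by rewrite !in_ori uw andbF.
  by have := CD _ _ uw; rewrite /arr; case: (_ && _); case: (_ \in _); case: (_ \in _).
have ce : contractible C e.
  by apply: (contractible_height A_sym CA eC (h := h)); rewrite CeD.
exists C; split=> //; apply: (ori_inj A_sym) => //.
  exact: contract_acyclic_partition.
by rewrite ori_contract.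
Qed.

End Classes.

(** * Representatives with a unique sink *)

Section Sink.
Variables (n : nat) (A : 'M[nat]_n).
Hypothesis A_sym : A^T = A.
Hypothesis A_conn : connected_set A [set: 'I_n].
Variable q : 'I_n.
Implicit Types (O X : {set 'I_n * 'I_n}) (h : 'I_n -> nat) (C D : part_digraph n).
Implicit Types (e : part_arc n) (S T U W : {set 'I_n}) (s : 'I_n -> int).
Implicit Types (c : {set part_digraph n}) (m : 'X_{1..n}).

Local Notation AP := (acyclic_partitions A).
Local Notation adj := (adj A).
Local Notation comp := (comp A).
Local Notation ori := (ori A).
Local Notation height_orient := (height_orient A).
Local Notation orient_equiv := (orient_equiv A).
Local Notation outv := (outv A).
Local Notation lap := (lap A).
Local Notation mexp := (mexp A).

Lemma connected_ind (P : 'I_n -> Prop) x y :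
  P x -> (forall a b, P a -> adj a b -> P b) -> P y.
Proof.
move=> Px step; case/andP: A_conn => _.
move=> /forall_inP/(_ x (in_setT _))/forall_inP/(_ y (in_setT _)).
apply: connect_ind => // a b Pa /and3P[_ _]; exact: step.
Qed.

Definition descends O : rel 'I_n := [rel u w | adj u w && ((w, u) \notin O)].

(** For height orientations this says that the part of [q] is the only sink; in this form it visibly
    survives the deletion of pairs ([sink_sub]). *)
Definition sink O : bool := [forall u, connect (descends O) u q].

Lemma sinkP O : reflect (forall u, connect (descends O) u q) (sink O).
Proof. exact: forallP. Qed.

Lemma sink_sub O1 O2 : O1 \subset O2 -> sink O2 -> sink O1.
Proof.
move=> sub /sinkP sk; apply/sinkP => u; apply: connect_sub (sk u) => x y.
move=> /andP[xy yx]; apply: connect1; rewrite /descends /= xy.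
by apply: contraNN yx; apply: (subsetP sub).
Qed.

Lemma descends_height h u w : descends (height_orient h) u w = adj u w && (h w <= h u)%N.
Proof. by rewrite /descends /= in_height_orient adjC //; case: (adj _ _); rewrite //= -leqNgt. Qed.

Lemma sink_height_min h u : sink (height_orient h) -> (h q <= h u)%N.
Proof.
move=> /sinkP/(_ u); apply: (connect_ind_rev (P := fun u => (h q <= h u)%N)) => // a b qb.
by rewrite descends_height => /andP[_]; apply: leq_trans.
Qed.

Lemma sink_comp h u : sink (height_orient h) ->
  (u \in comp (height_orient h) q) = (h u == h q).
Proof.
move=> sk; apply/idP/eqP => [/(height_comp A_sym)//|].
have /sinkP/(_ u) := sk.
apply: (connect_ind_rev (P := fun u => h u = h q -> u \in comp _ q)).
  by rewrite mem_comp.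
move=> a b IH; rewrite descends_height => /andP[ab le] aq.
have bq : h b = h q by apply/eqP; rewrite eqn_leq -{1}aq le sink_height_min.
rewrite -(comp_eq A_sym (IH bq)) inE connect1 // unoriented_height //.
by rewrite adjC // ab aq bq eqxx.
Qed.

(** The potential cannot increase along a weakly descending step of [O1], and every vertex descends
    to [q]. *)
Lemma sink_potential O1 O2 s u : sink O1 ->
  (forall u w, adj u w -> s u - s w = arr O1 u w - arr O2 u w) -> s q <= s u.
Proof.
move=> /sinkP/(_ u) sk E; apply: (connect_ind_rev (P := fun u => s q <= s u)) sk => // a b qb.
case/andP => ab; rewrite adjC // in ab => ba; have := E _ _ ab.
have -> : arr O1 b a = 0 by rewrite /arr (negPf ba).
by have := arr_ge0 O2 b a; move: qb; clear; lia.
Qed.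

Lemma sink_unique C1 C2 : C1 \in AP -> C2 \in AP -> sink (ori C1) -> sink (ori C2) ->
  orient_equiv (ori C1) (ori C2) -> C1 = C2.
Proof.
move=> CA1 CA2 sk1 sk2 [s E]; apply: (ori_inj A_sym) => //.
have sc u : s u = s q.
  have := sink_potential u sk1 E.
  have : - s q <= - s u; last by lia.
  apply: (@sink_potential (ori C2) (ori C1) (fun u => - s u)) => // x y /E; lia.
apply/setP => -[u w]; case uw: (adj u w); last by rewrite !in_ori uw.
have := E _ _ uw; rewrite !sc subrr /arr.
by case: (_ \in _); case: (_ \in _).
Qed.

(** All edges between the set [Z] of vertices not descending to [q] and its complement point into
    [Z]. Raising [Z] reverses them, which is a coboundary change, and [Z] shrinks because the graph
    is connected. *)
Lemma sink_exists C : C \in AP ->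
  exists C', [/\ C' \in AP, orient_equiv (ori C) (ori C') & sink (ori C')].
Proof.
have [k] := ubnP #|[set u | ~~ connect (descends (ori C)) u q]|.
elim: k C => // k IH C + CA; rewrite ltnS.
set Z := [set u | _] => Zk.
case: (pickP (mem Z)) => [z zZ|Z0]; last first.
  exists C; split=> //; first exact: orient_equiv_refl.
  by apply/sinkP => u; apply: contraFT (Z0 u) => nu; rewrite /= inE.
have [h hE] := AP_height CA.
have qZ : q \notin Z by rewrite inE connect0.
(* [B] exceeds all heights, so adding it on [Z] reverses the whole cut. *)
pose B := (\max_u h u).+1.
have hB u : (h u < B)%N by rewrite ltnS; apply: (leq_bigmax (F := h)).
have cut u w : adj u w -> u \notin Z -> w \in Z -> (h w < h u)%N.
  move=> uw; rewrite !inE negbK => uq; apply: contraNT; rewrite -leqNgt => le.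
  apply: connect_trans uq; apply: connect1.
  by rewrite hE descends_height // adjC // uw.
have [C' CA' CE'] := exists_AP A_sym (fun u => h u + B * (u \in Z))%N.
have equ : orient_equiv (ori C) (ori C').
  exists (fun u => b2z (u \notin Z)) => u w uw; rewrite hE CE' !arr_height //.
  have := hB u; have := hB w; have := cut u w uw.
  have := cut w u; rewrite (adjC A_sym w) => /(_ uw).
  case: (u \in Z); case: (w \in Z) => /=; rewrite ?muln0 ?muln1; lia.
have [|C2 [CA2 equ2 sk]] := IH C' _ CA'; last first.
  exists C2; split=> //; exact: orient_equiv_trans equ2.
apply: leq_trans Zk.
have keep u : u \notin Z -> connect (descends (ori C')) u q.
  rewrite inE negbK => uq.
  suff: u \notin Z /\ connect (descends (ori C')) u q by case.
  apply: (connect_ind_rev (P := fun u => u \notin Z /\ connect (descends (ori C')) u q)) uq => //.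
  move=> a b [bZ bq] ab; have aZ : a \notin Z.
    rewrite inE negbK; apply: connect_trans (connect1 ab) _.
    by move: bZ; rewrite inE negbK.
  split=> //; apply: connect_trans (connect1 _) bq.
  move: ab; rewrite hE CE' !descends_height // (negPf aZ) (negPf bZ); lia.
have [u [w [uw uZ wZ]]] : exists u w, [/\ adj u w, u \notin Z & w \in Z].
  apply: contrapT => no; have : z \notin Z; last by rewrite [z \in Z]zZ.
  apply: (connected_ind (P := fun z => z \notin Z)) qZ _ => a b aZ ab.
  by apply/negP => bZ; apply: no; exists a, b.
apply: proper_card; apply/properP; split.
  apply/subsetP => x; rewrite inE => nx; apply/negPn/negP => /keep xq.
  by rewrite xq in nx.
exists w => //; rewrite inE negbK; apply: connect_trans (keep _ uZ).
apply: connect1; rewrite CE' descends_height // adjC // uw.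
have := hB u; rewrite wZ (negPf uZ); lia.
Qed.

Lemma class_sink k c : c \in chip_classes A k -> exists2 C, C \in c & sink (ori C).
Proof.
case/imsetP => C0; rewrite inE => /andP[C0A _] ->.
have [C [CA E sk]] := sink_exists C0A.
by exists C => //; apply/in_chip_class.
Qed.

Lemma class_sink_unique k c C1 C2 : c \in chip_classes A k -> C1 \in c -> C2 \in c ->
  sink (ori C1) -> sink (ori C2) -> C1 = C2.
Proof.
move=> ck c1 c2 s1 s2; apply: sink_unique => //.
- by have [] := chip_classes_mem A_sym ck c1.
- by have [] := chip_classes_mem A_sym ck c2.
- exact: chip_classes_mem_equiv ck c1 c2.
Qed.

(** Compare [C] with a representative [C'] contracting to [C2]: normalised at [q], the potential is
    nonnegative since [C] has its sink there, and if it vanishes then [C = C']. *)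
Lemma facet_firing k c e C C2 : c \in chip_classes A k -> class_contractible c e ->
  C \in c -> sink (ori C) -> C2 \in class_contract A c e ->
  exists s, [/\ s q = 0, forall u, 0 <= s u,
    forall u, (outv (ori C) u)%:Z - ((mexp e + outv (ori C2))%MM u)%:Z = lap s u &
    (forall u, s u = 0) -> contractible C e /\ contract C e = C2].
Proof.
move=> ck ce Cc sk C2c.
have [C' [Cc' ce' CE']] := contract_lift A_sym ck ce C2c.
have [CA _ _] := chip_classes_mem A_sym ck Cc.
have [CA' _ _] := chip_classes_mem A_sym ck Cc'.
have [s E] := chip_classes_mem_equiv A_sym ck Cc Cc'.
exists (fun u => s u - s q); split.
- by rewrite subrr.
- by move=> u; rewrite subr_ge0; apply: sink_potential sk E.
- move=> u; rewrite -(outv_arc_pairs (A := A) (O := ori C')).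
    by apply: outvB_lap => x y /E <-; ring.
  by move=> x y xy; rewrite -CE'; apply: arr_contract.
move=> s0; suff -> : C = C' by [].
apply: (ori_inj A_sym) => //; apply/setP => -[u w].
case uw: (adj u w); last by rewrite !in_ori uw.
have sc x : s x = s q by apply/eqP; rewrite -subr_eq0 s0.
have := E _ _ uw; rewrite !sc subrr /arr.
by case: (_ \in _); case: (_ \in _).
Qed.

End Sink.

(** * Legal firing sets and the matching *)

Section Firing.
Variables (n : nat) (A : 'M[nat]_n).
Hypothesis A_sym : A^T = A.
Hypothesis A_conn : connected_set A [set: 'I_n].
Variable q : 'I_n.
Implicit Types (O X : {set 'I_n * 'I_n}) (h : 'I_n -> nat).
Implicit Types (e : part_arc n) (S T U W : {set 'I_n}) (m : 'X_{1..n}).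

Local Notation adj := (adj A).
Local Notation comp := (comp A).
Local Notation unoriented := (unoriented A).
Local Notation height_orient := (height_orient A).
Local Notation mexp := (mexp A).
Local Notation sink := (sink A q).

(* Within the parts of O, the vertices of S can fire simultaneously. *)
Definition legal O m S : bool :=
  (q \notin S) &&
  [forall u in S, (\sum_(w | (w \notin S) && unoriented O u w) A u w <= m u)%N].

Definition max_legal O m : {set 'I_n} := \bigcup_(S | legal O m S) S.

Lemma legal_set0 O m : legal O m set0.
Proof. by rewrite /legal inE; apply/forall_inP => u; rewrite inE. Qed.

(** Enlarging a set only removes edges leaving it at a given vertex; hence a largest legal set
    exists. *)
Lemma legalU O m S1 S2 : legal O m S1 -> legal O m S2 -> legal O m (S1 :|: S2).
Proof.
move=> /andP[q1 /forall_inP l1] /andP[q2 /forall_inP l2].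
rewrite /legal inE negb_or q1 q2; apply/forall_inP => u uS.
have sub S : S \subset S1 :|: S2 ->
    (\sum_(w | (w \notin S1 :|: S2) && unoriented O u w) A u w <=
     \sum_(w | (w \notin S) && unoriented O u w) A u w)%N.
  move=> sS; rewrite [X in (X <= _)%N]big_mkcond [X in (_ <= X)%N]big_mkcond.
  apply: leq_sum => w _; case wS: (w \in S1 :|: S2); first by [].
  rewrite /=; have -> // : w \notin S.
  by apply: contraFN wS; apply: (subsetP sS).
case/setUP: uS => [/l1|/l2]; apply: leq_trans; apply: sub.
  exact: subsetUl.
exact: subsetUr.
Qed.

Lemma max_legalP O m : legal O m (max_legal O m).
Proof.
apply: (big_ind (legal O m)) => //; [exact: legal_set0|exact: legalU].
Qed.

Lemma legal_sub O m S : legal O m S -> S \subset max_legal O m.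
Proof. by move=> lS; apply: bigcup_sup. Qed.

Lemma notin_max_legal O m : q \notin max_legal O m.
Proof. by have /andP[] := max_legalP O m. Qed.

(** No unoriented edge leaves this set, so firing it costs nothing. Consequently every vertex
    outside [max_legal] lies in the part of [q]. *)
Lemma legal_comp O m : legal O m (~: comp O q).
Proof.
rewrite /legal inE negbK mem_comp; apply/forall_inP => u; rewrite inE => uQ.
rewrite big1 // => w; rewrite inE negbK => /andP[wQ uw]; case/negP: uQ.
by rewrite -(comp_eq A_sym wQ) inE connect1 // unorientedC.
Qed.

Lemma not_max_legal_comp O m u : u \notin max_legal O m -> u \in comp O q.
Proof.
apply: contraNT => uQ; apply: (subsetP (legal_sub (legal_comp O m))).
by rewrite inE.
Qed.

Definition hat O m : {set 'I_n * 'I_n} :=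
  O :|: [set p | [&& adj p.1 p.2, p.1 \in max_legal O m & p.2 \notin max_legal O m]].

Lemma in_hat O m u w : ((u, w) \in hat O m) =
  ((u, w) \in O) || [&& adj u w, u \in max_legal O m & w \notin max_legal O m].
Proof. by rewrite !inE. Qed.

Lemma sub_hat O m : O \subset hat O m. Proof. exact: subsetUl. Qed.

(** An edge leaving [S] ends in the part of [q], at minimal height, so it is level or already
    oriented this way; raising [S] by half a step adds exactly the missing pairs. *)
Lemma hat_height h m : sink (height_orient h) ->
  hat (height_orient h) m =
  height_orient (fun x => (h x).*2 + (x \in max_legal (height_orient h) m))%N.
Proof.
move=> sk; set S := max_legal _ m; apply/setP => -[u w].
rewrite in_hat !in_height_orient -/S.
case uw: (adj u w) => //=.
have := sink_height_min A_sym u sk.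
have : w \notin S -> h w = h q.
  by move=> wS; apply/eqP; rewrite -(sink_comp A_sym) //; apply: not_max_legal_comp wS.
case: (u \in S); case: (w \in S) => /= H; lia.
Qed.

(** Let [Y] be the vertices outside [S] that no longer reach [q]. No unoriented edge runs from [Y]
    to the outside of [S :|: Y], so this union is legal, and [Y] is empty by maximality of [S]. *)
Lemma sink_hat h m : sink (height_orient h) -> sink (hat (height_orient h) m).
Proof.
move=> sk; set O := height_orient h; set S := max_legal O m.
have outS u : u \notin S -> connect (descends A (hat O m)) u q.
  pose Y := [set u in ~: S | ~~ connect (descends A (hat O m)) u q].
  suff: legal O m (S :|: Y).
    move/legal_sub/subsetP => sub uS; apply: contraT => nu.
    by case/negP: (uS); apply: sub; rewrite !inE uS nu orbT.
  have /andP[qS /forall_inP lS] := max_legalP O m.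
  rewrite /legal !inE negb_or negb_and connect0 orbT andbT; apply/andP; split=> //.
  have stay x w : x \in Y -> w \notin S :|: Y -> ~~ unoriented O x w.
    rewrite !inE negb_or negb_and negbK => /andP[xS nx] /andP[wS].
    rewrite (negPf wS) negbK /= => wq; apply: contraNN nx => /and3P[xw nxw nwx].
    apply: connect_trans wq; apply: connect1; rewrite /descends /= xw in_hat.
    by rewrite (negPf nwx) (negPf wS) andbF.
  apply/forall_inP => x; rewrite inE => /orP[xS|xY]; last first.
    by rewrite big1 // => w /andP[/(stay _ _ xY) /negPf ->].
  apply: leq_trans (lS x xS).
  rewrite [X in (X <= _)%N]big_mkcond [X in (_ <= X)%N]big_mkcond.
  apply: leq_sum => w _; rewrite inE negb_or.
  by case: (w \in S) => //=; case: (w \in Y) => //=; case: ifP.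
apply/sinkP => u; have /sinkP/(_ u) := sk.
apply: (connect_ind_rev (P := fun u => connect (descends A (hat O m)) u q)) => //.
move=> a b bq /andP[ab ba]; have [aS|/outS//] := boolP (a \in S).
apply: connect_trans (connect1 _) bq.
by rewrite /descends /= ab in_hat (negPf ba) aS !andbF.
Qed.

Lemma mexp_notin e u : u \notin e.1 -> mexp e u = 0%N.
Proof. by move=> /negPf nu; rewrite mnmE big1 // => w _; rewrite nu muln0. Qed.

Lemma mexp_in e u : u \in e.1 -> mexp e u = (\sum_(w in e.2) A u w)%N.
Proof.
move=> ue; rewrite mnmE ue [RHS]big_mkcond; apply: eq_bigr => w _ /=.
by case: (w \in e.2); rewrite ?muln1 ?muln0.
Qed.

(** At [U] the only newly unoriented edges leaving [S] go to [W], and [mexp (U, W)] pays for them;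
    elsewhere new unoriented edges end in [U], hence inside [S]. *)
Lemma legal_setD O m U W S :
  (forall u w, u \in U -> unoriented O u w -> w \in U) -> U \subset S ->
  legal (O :\: arc_pairs (U, W)) (m + mexp (U, W))%MM S = legal O m S.
Proof.
move=> closedU /subsetP US; rewrite /legal; congr (_ && _).
apply: eq_forallb_in => u uS; case uU: (u \in U); last first.
  rewrite mnmDE mexp_notin /= ?uU // addn0.
  congr (_ <= _)%N; apply: eq_bigl => w; case wS: (w \in S) => //=.
  rewrite /unoriented /= !in_setDpairs /= uU /=.
  by have -> : (w \in U) = false by apply: contraFF wS; apply: US.
rewrite [X in _ = (X <= _)%N]big1; last first.
  by move=> w /andP[wS /(closedU _ _ uU)/US]; rewrite (negPf wS).
rewrite leq0n mnmDE mexp_in //; apply: leq_trans (leq_addl _ _).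
rewrite [leqLHS]big_mkcond [leqRHS]big_mkcond /=; apply: leq_sum => w _ /=.
case: ifP => // /andP[wS /and3P[uw nuw nwu]].
case wW: (w \in W); first by [].
case/negP: wS; apply: US; case wU: (w \in U) => //; rewrite -wU.
apply: (closedU u) => //; move: nuw nwu.
by rewrite /unoriented /= !in_setDpairs /= wU wW uw andbF /= => -> ->.
Qed.

(** [U] is itself legal before and after, so both largest sets contain it and [legal_setD] applies
    to each. *)
Lemma max_legal_setD O m U W :
  (forall u w, u \in U -> unoriented O u w -> w \in U) -> q \notin U ->
  max_legal (O :\: arc_pairs (U, W)) (m + mexp (U, W))%MM = max_legal O m.
Proof.
move=> closedU qU.
have lU : legal O m U.
  rewrite /legal qU; apply/forall_inP => u uU; rewrite big1 // => w /andP[wU].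
  by move/(closedU _ _ uU); rewrite (negPf wU).
have lU' : legal (O :\: arc_pairs (U, W)) (m + mexp (U, W))%MM U.
  by rewrite legal_setD.
apply/eqP; rewrite eqEsubset; apply/andP; split; apply: legal_sub.
  rewrite -(@legal_setD _ _ U W) //; last exact: legal_sub.
  exact: max_legalP.
by rewrite legal_setD //; [exact: max_legalP|exact: legal_sub].
Qed.

Definition base X : {set {set 'I_n}} :=
  [set T | [&& [exists u, T == comp X u], q \notin T &
    [forall u in T, forall w, ((u, w) \in X) ==> (w \in comp X q)]]].

Lemma baseP X T : reflect [/\ exists u, T = comp X u, q \notin T &
    forall u w, u \in T -> (u, w) \in X -> w \in comp X q] (T \in base X).
Proof.
rewrite inE; apply: (iffP and3P) => -[a qT b]; split=> //.
- by case/existsP: a => u /eqP ->; exists u.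
- by move=> u w uT; move/forall_inP: b => /(_ u uT)/forallP/(_ w)/implyP.
- by apply/existsP; case: a => u ->; exists u.
- by apply/forall_inP => u uT; apply/forallP => w; apply/implyP; apply: b.
Qed.

Definition top_base O m : option {set 'I_n} := [pick T in base (hat O m)].

(** An up cell is matched with a cell having one part more, a down cell with one having one part
    less; a cell that is neither is critical. *)
Definition cell_up O m : bool :=
  if top_base O m is Some T then T \subset comp O q else false.

Definition cell_down O m : bool :=
  if top_base O m is Some T then ~~ (T \subset comp O q) else false.

(** * The two moves of the involution: splitting the part of [q] and contracting onto it *)

Section Base.
Variables (h : 'I_n -> nat) (m : 'X_{1..n}) (T : {set 'I_n}).
Local Notation O := (height_orient h).
Local Notation S := (max_legal O m).
Local Notation X := (hat O m).
Hypothesis sk : sink O.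
Hypothesis T_top : top_base O m = Some T.

Lemma top_base_mem : T \in base X.
Proof. by move: T_top; rewrite /top_base; case: pickP => // ? ? [<-]. Qed.

Lemma top_base_q : q \notin T.
Proof. by case/baseP: top_base_mem. Qed.

Lemma top_base_ne : exists x, x \in T.
Proof. by case/baseP: top_base_mem => -[u ->] _ _; exists u; apply: mem_comp. Qed.

Lemma top_base_comp x : x \in T -> T = comp X x.
Proof. by case/baseP: top_base_mem => -[u ->] _ _ xu; rewrite (comp_eq A_sym xu). Qed.

Lemma top_base_closed u w : u \in T -> unoriented X u w -> w \in T.
Proof. by move=> uT uw; rewrite (top_base_comp uT) inE connect1. Qed.

(** The vertices outside [S] all have the height of [q], and those of [S] have been raised above
    it. *)
Lemma comp_hat_q u : (u \in comp X q) = (u \notin S).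
Proof.
have sX := sink_hat m sk; rewrite hat_height // in sX *.
rewrite (sink_comp A_sym) // (negPf (notin_max_legal _ _)) addn0.
apply/idP/idP => [|uS]; first by case: (u \in _) => //=; lia.
rewrite (negPf uS) addn0; have := not_max_legal_comp uS.
by rewrite (sink_comp A_sym) // => /eqP ->.
Qed.

Lemma top_base_legal x : x \in T -> x \in S.
Proof.
move=> xT; rewrite -[_ \in S]negbK -comp_hat_q; apply/negP => xq.
case/negP: top_base_q; rewrite (top_base_comp xT) (comp_eq A_sym xq).
exact: mem_comp.
Qed.

Lemma top_base_out u w : u \in T -> (u, w) \in X -> w \notin S.
Proof.
case/baseP: top_base_mem => _ _ H uT uw.
by rewrite -comp_hat_q; apply: H uw.
Qed.

Lemma unoriented_hat u w : unoriented X u w -> unoriented O u w.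
Proof.
case/and3P => uw n1 n2; apply/and3P; split=> //.
  by apply: contraNN n1; apply: (subsetP (sub_hat _ _)).
by apply: contraNN n2; apply: (subsetP (sub_hat _ _)).
Qed.

Lemma top_base_sub_comp x : x \in T -> T \subset comp O x.
Proof.
move=> xT; rewrite (top_base_comp xT); apply/subsetP => y; rewrite !inE.
by apply: connect_sub => a b /unoriented_hat; apply: connect1.
Qed.

Lemma exists_leaving O' : sink O' ->
  exists u w, [/\ u \in T, w \notin T & descends A O' u w].
Proof.
move=> /sinkP sk'; apply: contrapT => no; case: top_base_ne => x xT.
case/negP: top_base_q; apply: (connect_ind (P := fun y => y \in T)) xT _ (sk' x).
move=> a b aT ab; apply: contrapT => bT; apply: no; exists a, b; split=> //.
exact/negP.
Qed.

(** Raising [T] orients the edges from [T] to the rest of the part of [q]. Such an edge ends outside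
    [S]: otherwise it would be unoriented in [X] and end in [T]. So legality of [S] bounds [mexp e]
    by [m], and the inserted pairs belong to [X] already. *)
Lemma top_base_split : T \subset comp O q ->
  exists h1, let e := (T, comp O q :\: T) in let O1 := height_orient h1 in
  [/\ forall u w, adj u w -> arr O1 u w = arr O u w + b2z ((u \in e.1) && (w \in e.2)),
      sink O1,
      comp O1 q = e.2 /\ (forall x, x \in T -> comp O1 x = T),
      exists u w, [/\ u \in e.1, w \in e.2 & (u, w) \in O1] &
      (mexp e <= m)%MM /\ hat O1 (m - mexp e)%MM = X].
Proof.
move=> /subsetP TQ; exists (fun x => (h x).*2 + (x \in T))%N.
set e := (T, _); set O1 := height_orient _; move=> /=.
have hT x : x \in T -> h x = h q.
  by move=> /TQ; rewrite (sink_comp A_sym) // => /eqP.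
have qT := top_base_q.
have arrE u w : adj u w -> arr O1 u w = arr O u w + b2z ((u \in e.1) && (w \in e.2)).
  move=> uw; rewrite arr_insert //; congr (_ + b2z _) => /=.
  rewrite inE (sink_comp A_sym) //; case uT: (u \in T); last by rewrite andbF.
  by rewrite (hT _ uT) [h q == _]eq_sym /= andbC.
have eS u w : adj u w -> u \in T -> w \in e.2 -> w \notin S.
  move=> uw uT; rewrite inE => /andP[wT wQ]; apply: contraNN wT => wS.
  have hw : h w = h q by move: wQ; rewrite (sink_comp A_sym) // => /eqP.
  apply: (top_base_closed uT); apply/and3P; split=> //.
    by rewrite in_hat wS !andbF orbF in_height_orient (hT _ uT) hw ltnn andbF.
  by rewrite in_hat (top_base_legal uT) !andbF orbF in_height_orient (hT _ uT) hw ltnn andbF.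
have O1X : O1 \subset X.
  apply/subsetP => -[u w] uw1; have uw : adj u w by move: uw1; rewrite inE => /andP[].
  rewrite in_hat uw /=; have := arrE _ _ uw; rewrite /arr uw1.
  case: (_ \in O) => //=; case ue: (u \in T) => //=; case we: (w \in e.2) => //= _.
  by rewrite (top_base_legal ue) (eS _ _ uw ue we).
have sk1 : sink O1 by apply: sink_sub O1X _; apply: sink_hat.
have compq : comp O1 q = e.2.
  apply/setP => x; rewrite (sink_comp A_sym) // inE (sink_comp A_sym) // (negPf qT).
  by case: (x \in T) => /=; lia.
have compT x : x \in T -> comp O1 x = T.
  move=> xT; apply/setP => y; apply/idP/idP.
    rewrite inE; apply: (connect_ind (P := fun y => y \in T)) => // a b aT.
    by rewrite unoriented_height // aT => /andP[_]; case: (b \in T) => //; lia.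
  rewrite {1}(top_base_comp xT) !inE; apply: connect_sub => a b /and3P[ab n1 n2].
  apply: connect1; apply/and3P; split=> //.
    by apply: contraNN n1; apply: (subsetP O1X).
  by apply: contraNN n2; apply: (subsetP O1X).
have le : (mexp e <= m)%MM.
  apply/mnm_lepP => u; case uT: (u \in T); last by rewrite mexp_notin ?uT.
  rewrite mexp_in //.
  have /andP[_ /forall_inP lS] := max_legalP O m.
  apply: leq_trans (lS u (top_base_legal uT)); rewrite [leqLHS]big_mkcond [leqRHS]big_mkcond /=.
  apply: leq_sum => w _; case we: (w \in e.2) => //.
  case uw: (adj u w); last first.
    by move: uw; rewrite /adj lt0n => /negbFE/eqP->.
  rewrite (eS _ _ uw uT we) unoriented_height // uw (hT _ uT).
  by move: we; rewrite inE (sink_comp A_sym) // => /andP[_ /eqP ->]; rewrite eqxx.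
have S1 : max_legal O1 (m - mexp e)%MM = S.
  have := @max_legal_setD O1 (m - mexp e)%MM T (comp O q :\: T).
  rewrite -/e submK //; have -> : O1 :\: arc_pairs e = O.
    apply/setP => -[u w]; rewrite in_setDpairs /=.
    case uw: (adj u w); last by rewrite !in_height_orient uw andbF.
    have := arrE _ _ uw; rewrite /arr /=; move: (_ \in O) => b.
    by case: (_ && _); case: (_ \in O1); case: b.
  move=> -> // u w uT uw; rewrite -(compT u uT) inE; exact: connect1.
split=> //.
(* A descending path from [T] to [q] has to leave [T], so the new arc contains an edge. *)
- have [u [w [uT wT /andP[uw nwu]]]] := exists_leaving sk1.
  exists u, w; have we : w \in e.2.
    rewrite inE wT (sink_comp A_sym) //; move: nwu.
    rewrite in_height_orient adjC // uw uT (negPf wT) (hT _ uT).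
    have := sink_height_min A_sym w sk; lia.
  by split=> //; have := arrE _ _ uw; rewrite /arr uT we; case: (_ \in O1); case: (_ \in O).
split=> //; apply/setP => -[u w]; rewrite !in_hat S1.
case uw: (adj u w); last by rewrite !in_height_orient uw.
have := arrE _ _ uw; rewrite /arr; case: (_ \in O) => /=; case: (_ \in O1) => //=;
  case ue: (u \in T) => //=; case we: (w \in e.2) => //= _.
by rewrite (top_base_legal ue) (eS _ _ uw ue we).
Qed.

Section Down.
Hypothesis TQ : ~~ (T \subset comp O q).

Lemma top_base_disjoint x : x \in T -> x \notin comp O q.
Proof.
move=> xT; apply: contraNN TQ => xQ.
by rewrite -(comp_eq A_sym xQ) top_base_sub_comp.
Qed.

(** A level edge of [O] that [X] orients lies inside the part of [q], which [T] misses; hence [T] is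
    a whole part of [O]. *)
Lemma top_base_closed_down u w : u \in T -> unoriented O u w -> w \in T.
Proof.
move=> uT uw; apply: (top_base_closed uT); case/and3P: (uw) => auw n1 n2.
have wS : w \in S.
  apply: contraT => /not_max_legal_comp wQ; case/negP: (top_base_disjoint uT).
  by rewrite -(comp_eq A_sym wQ) inE connect1 // unorientedC.
apply/and3P; split=> //; rewrite in_hat negb_or ?n1 ?n2 /= wS ?andbF //.
by rewrite (top_base_legal uT) !andbF.
Qed.

Lemma top_base_comp_down x : x \in T -> comp O x = T.
Proof.
move=> xT; apply/eqP; rewrite eqEsubset top_base_sub_comp // andbT.
apply/subsetP => y; rewrite inE.
by apply: (connect_ind (P := fun y => y \in T)) => // a b; apply: top_base_closed_down.
Qed.

(** The arcs of [O] out of [T] end outside [S], hence in the part of [q]; deleting them amounts to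
    lowering [T] to the height of [q]. *)
Lemma top_base_merge :
  let e := (T, comp O q) in
  exists h0, let O0 := height_orient h0 in
  [/\ O :\: arc_pairs e = O0,
      exists u w, [/\ u \in T, w \in comp O q & (u, w) \in O],
      hat O0 (m + mexp e)%MM = X & comp O0 q = T :|: comp O q].
Proof.
set e := (T, comp O q); pose h0 x := if x \in T then h q else h x.
have outT u w : u \in T -> (u, w) \in O -> w \notin S.
  by move=> uT uw; apply: (top_base_out uT); apply: (subsetP (sub_hat _ _)).
have outQ u w : u \in T -> (u, w) \in O -> w \in comp O q.
  by move=> uT /(outT _ _ uT)/not_max_legal_comp.
have hq := fun u => sink_height_min A_sym u sk.
have OE : O :\: arc_pairs e = height_orient h0.
  apply/setP => -[u w]; rewrite in_setDpairs [RHS]in_height_orient /= /h0.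
  case uw: (adj u w); last by rewrite in_height_orient uw andbF.
  case uT: (u \in T); case wT: (w \in T); rewrite /=.
  - rewrite ltnn; apply/negbTE/andP => -[_ uwO].
    by case/negP: (outT _ _ uT uwO); apply: top_base_legal.
  - rewrite [RHS]ltnNge hq /=; apply/negbTE/andP => -[nw uwO].
    by rewrite (outQ _ _ uT uwO) in nw.
  - rewrite in_height_orient uw /=; have [lt|] := ltnP (h w) (h u).
      by apply/esym; apply: leq_ltn_trans lt.
    rewrite leq_eqVlt => /orP[/eqP E|lt].
      case/negP: (negbT uT); apply: (top_base_closed_down wT).
      by rewrite unoriented_height // adjC // uw E eqxx.
    apply/esym/negbTE; rewrite -leqNgt.
    have : u \in comp O q by apply: (outQ w) => //; rewrite in_height_orient adjC // uw.
    by rewrite (sink_comp A_sym) // => /eqP->.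
  - by rewrite in_height_orient uw.
exists h0; have S0 : max_legal (height_orient h0) (m + mexp e)%MM = S.
  by rewrite -OE; apply: max_legal_setD top_base_q; apply: top_base_closed_down.
have sk0 : sink (height_orient h0).
  by apply: (sink_sub (O2 := O)) => //; rewrite -OE subsetDl.
split=> //.
- have [u [w [uT wT /andP[uw nwu]]]] := exists_leaving (sink_hat m sk).
  have nu : (u, w) \notin X -> False.
    by move=> nuw; case/negP: wT; apply: (top_base_closed uT); apply/and3P.
  have uwX : (u, w) \in X by apply: contraT => /nu.
  have wQ := not_max_legal_comp (top_base_out uT uwX).
  exists u, w; split=> //; rewrite in_height_orient uw /=.
  move: wQ; rewrite (sink_comp A_sym) // => /eqP ->.
  rewrite ltn_neqAle hq andbT eq_sym -(sink_comp A_sym) //.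
  exact: top_base_disjoint.
- apply/setP => -[u w]; rewrite !in_hat S0 -OE in_setDpairs /=.
  case uT: (u \in T) => //=; case uwO: (_ \in O) => /=; last by rewrite !andbF.
  rewrite (outT _ _ uT uwO) (top_base_legal uT).
  by move: uwO; rewrite in_height_orient => /andP[->]; rewrite !orbT.
apply/setP => x; rewrite in_setU !(sink_comp A_sym) // /h0 (negPf top_base_q).
by case: (x \in T); rewrite ?eqxx.
Qed.

(** Contraction keeps [S] and only deletes pairs. If [X] survives, the deleted pairs must leave [S],
    so [W] is the part of [q]. The part of [q] grows at most by [U], so if it now contains [T],
    which it missed before, then [T = U]. *)
Lemma hat_facet U W u0 w0 :
  (forall x, x \in U -> comp O x = U) -> (forall x, x \in W -> comp O x = W) ->
  u0 \in U -> w0 \in W -> (u0, w0) \in O ->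
  let O' := O :\: arc_pairs (U, W) in
  let m' := (m + mexp (U, W))%MM in
  hat O' m' \subset X /\ (hat O' m' = X -> T \subset comp O' q -> (U, W) = (T, comp O q)).
Proof.
move=> cU cW u0U w0W uw0 O' m'.
have qU : q \notin U.
  apply/negP => /cU cqU; move: uw0; rewrite in_height_orient => /andP[_].
  have := sink_height_min A_sym w0 sk; move: u0U; rewrite -cqU (sink_comp A_sym) //.
  by move=> /eqP -> le lt; have := leq_trans lt le; rewrite ltnn.
have closedU u w : u \in U -> unoriented O u w -> w \in U.
  by move=> uU uw; rewrite -(cU u uU) inE connect1.
have S' : max_legal O' m' = S by apply: max_legal_setD.
split=> [|E TQ'].
  by apply/subsetP => -[u w]; rewrite !in_hat S' in_setDpairs => /orP[/andP[_ ->]|->]; rewrite ?orbT.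
have w0Q : w0 \in comp O q.
  have : (u0, w0) \in hat O' m' by rewrite E in_hat uw0.
  by rewrite in_hat S' in_setDpairs /= u0U w0W /= => /and3P[_ _ /not_max_legal_comp].
have WQ : W = comp O q by rewrite -(cW w0 w0W) (comp_eq A_sym w0Q).
have sub x : x \in comp O' q -> x \in comp O q :|: U.
  rewrite inE; apply: (connect_ind (P := fun x => x \in comp O q :|: U)).
    by rewrite inE mem_comp.
  move=> a b aQU /and3P[ab n1 n2].
  have [abO|] := boolP (unoriented O a b).
    case/setUP: aQU => [aQ|aU]; rewrite inE.
      by rewrite -(comp_eq A_sym aQ) inE connect1.
    by rewrite (closedU _ _ aU abO) orbT.
  rewrite in_setU -WQ; move: n1 n2; rewrite !in_setDpairs /unoriented /= ab /=.
  by case: ((a, b) \in O); case: ((b, a) \in O); case: (a \in U); case: (b \in U);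
    case: (a \in W); case: (b \in W).
have [x xT] := top_base_ne; have := sub x (subsetP TQ' x xT).
rewrite inE (negPf (top_base_disjoint xT)) /= => xU.
by rewrite WQ -(cU x xU) (top_base_comp_down xT).
Qed.

End Down.
End Base.

(** The part in [hat O m] of a lowest vertex of [S] would belong to [base]. So [S] is empty, all
    vertices lie in the part of [q], and nothing is oriented. *)
Lemma top_base_none h m : sink (height_orient h) ->
  top_base (height_orient h) m = None ->
  max_legal (height_orient h) m = set0 /\ height_orient h = set0.
Proof.
move=> sk; set O := height_orient h; set S := max_legal O m.
rewrite /top_base; case: pickP => // none _.
have [g gE] : exists g, hat O m = height_orient g by rewrite hat_height //; eexists.
have S0 : S = set0.
  apply/eqP; apply: contraT => /set0Pn[u0 u0S].
  have [u uS umin] := @arg_minnP _ u0 (mem S) g u0S.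
  have := none (comp (hat O m) u); case/baseP; split; first by exists u.
    apply/negP => /(comp_eq A_sym) E.
    have : u \in comp (hat O m) q by rewrite E mem_comp.
    by rewrite comp_hat_q // => /negP.
  move=> x w xu; rewrite comp_hat_q // => xw; apply/negP => wS.
  have := umin _ wS; move: xw xu; rewrite gE => xw /(height_comp A_sym) <-.
  by move: xw; rewrite in_height_orient => /andP[_ lt]; rewrite leqNgt lt.
split=> //; apply/setP => -[u w]; rewrite in_height_orient inE.
have hq x : h x = h q.
  have : x \in comp O q by apply: (@not_max_legal_comp _ m); rewrite -/S S0 inE.
  exact: height_comp.
by rewrite !hq ltnn andbF.
Qed.

End Firing.

(** * The matching on monomial multiples of classes, and its measure *)

Section ClassMatching.
Variables (n : nat) (A : 'M[nat]_n).
Hypothesis A_sym : A^T = A.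
Hypothesis A_conn : connected_set A [set: 'I_n].
Variable q : 'I_n.
Implicit Types (O X : {set 'I_n * 'I_n}) (h : 'I_n -> nat) (C D : part_digraph n).
Implicit Types (e : part_arc n) (S T U W : {set 'I_n}) (s : 'I_n -> int).
Implicit Types (c : {set part_digraph n}) (m b : 'X_{1..n}).

Local Notation AP := (acyclic_partitions A).
Local Notation adj := (adj A).
Local Notation comp := (comp A).
Local Notation ori := (ori A).
Local Notation height_orient := (height_orient A).
Local Notation outv := (outv A).
Local Notation lap := (lap A).
Local Notation mexp := (mexp A).
Local Notation sink := (sink A q).
Local Notation hat := (hat A q).
Local Notation top_base := (top_base A q).

Lemma sum_lap s : \sum_u lap s u = 0.
Proof.
set Y := LHS; suff : Y = - Y by lia.
rewrite {1}/Y /lap exchange_big /= -sumrN; apply: eq_bigr => u _.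
rewrite -sumrN; apply: eq_bigr => w _; rewrite (AC A_sym w u); ring.
Qed.

(** Maximum principle: at a maximum of [s] all terms of [lap s] are nonnegative, so the neighbours
    are maximal too. *)
Lemma lap_eq0_const s x y : (forall u, lap s u = 0) -> s x = s y.
Proof.
move=> s0; have [z _ zmax] := @Order.TotalTheory.arg_maxP _ _ _ x predT s isT.
suff E u : s u = s z by rewrite !E.
apply: (connected_ind A_conn (P := fun u => s u = s z)) => // a b az ab.
have ge w : true -> 0 <= (A a w)%:Z * (s a - s w).
  by move=> _; apply: mulr_ge0 => //; rewrite subr_ge0 az; apply: zmax.
have := psumr_eq0P ge (s0 a) => /(_ b isT); move: ab; rewrite /adj az; clear; nia.
Qed.

Definition fires_to b b' := exists s, [/\ s q = 0, forall u, 0 <= s u &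
  forall u, (b u)%:Z - (b' u)%:Z = lap s u].

(** Firing preserves the degree ([fires_to_mdeg]), so the degree bound loses no reachable monomial
    and makes the count finite. *)
Definition reach_count b : nat :=
  #|[set x : 'X_{1..n < (mdeg b).+1} | `[< fires_to b x >]]|.

Lemma fires_to_mdeg b b' : fires_to b b' -> mdeg b' = mdeg b.
Proof.
have mdegZ x : (mdeg x)%:Z = \sum_u (x u)%:Z.
  by rewrite mdegE -natz natr_sum; apply: eq_bigr => u _; rewrite natz.
case=> s [_ _ E]; have := sum_lap s; under eq_bigr => u _ do rewrite -E.
by rewrite sumrB -!mdegZ => /eqP; rewrite subr_eq0 eq_sym => /eqP[].
Qed.

(** Whatever [b'] reaches, [b] reaches. But [b'] does not reach [b]: the two scripts would add up to
    one with zero Laplacian, hence constant, hence zero as at [q]. *)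
Lemma reach_count_lt b b' s : s q = 0 -> (forall u, 0 <= s u) ->
  (forall u, (b u)%:Z - (b' u)%:Z = lap s u) -> ~ (forall u, s u = 0) ->
  (reach_count b' < reach_count b)%N.
Proof.
move=> sq s0 E ns; have bb' : fires_to b b' by exists s.
rewrite /reach_count (fires_to_mdeg bb'); apply: proper_card; apply/properP; split.
  apply/subsetP => x; rewrite !inE => /asboolP[t [tq t0 F]]; apply/asboolP.
  exists (fun u => s u + t u); split; first by rewrite sq tq.
    by move=> u; apply: addr_ge0.
  by move=> u; rewrite lapD -E -F; ring.
exists (BMultinom (ltnSn (mdeg b))); rewrite inE.
  apply/asboolP; exists (fun _ => 0); split=> // u.
  by rewrite subrr /lap big1 // => w _; rewrite subrr mulr0.
apply/asboolP => -[t [tq t0 F]]; apply: ns => u.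
have L v : lap (fun u => s u + t u) v = 0 by rewrite lapD -E -F /=; ring.
have := lap_eq0_const u q L; have := s0 u; have := t0 u; rewrite sq tq; lia.
Qed.

Definition sink_rep c : part_digraph n :=
  odflt (set0, set0) [pick C in c | sink (ori C)].

Lemma sink_repP k c : c \in chip_classes A k ->
  sink_rep c \in c /\ sink (ori (sink_rep c)).
Proof.
move=> ck; rewrite /sink_rep; case: pickP => [C /andP[]//|no].
have [C Cc sk] := class_sink A_sym A_conn q ck.
by have := no C; rewrite Cc sk.
Qed.

Lemma sink_rep_eq k c C : c \in chip_classes A k -> C \in c -> sink (ori C) ->
  sink_rep c = C.
Proof.
move=> ck Cc sk; have [Rc skR] := sink_repP ck.
exact: (class_sink_unique A_sym A_conn ck Rc Cc skR sk).
Qed.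

Lemma sink_rep_AP k c : c \in chip_classes A k -> sink_rep c \in AP.
Proof. by move=> ck; have [Rc _] := sink_repP ck; have [] := chip_classes_mem A_sym ck Rc. Qed.

Lemma sink_rep_inj k k' c c' : c \in chip_classes A k -> c' \in chip_classes A k' ->
  sink_rep c = sink_rep c' -> c = c'.
Proof.
move=> ck ck' E; have [Rc _] := sink_repP ck; have [Rc' _] := sink_repP ck'.
have [_ _ ->] := chip_classes_mem A_sym ck Rc.
by have [_ _ ->] := chip_classes_mem A_sym ck' Rc'; rewrite E.
Qed.

Definition class_ori c := ori (sink_rep c).
Definition class_up c m := cell_up A q (class_ori c) m.
Definition class_down c m := cell_down A q (class_ori c) m.
Definition divisor c m := (m + outv (class_ori c))%MM.

(** A lexicographic order, divisor before [hat]: a set of vertex pairs has fewer than [(n * n).+1]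
    elements. *)
Definition cell_measure c m : nat :=
  (reach_count (divisor c m) * (n * n).+1 + #|hat (class_ori c) m|)%N.

Lemma cell_measure_lt c m c' m' :
  (reach_count (divisor c m) < reach_count (divisor c' m'))%N \/
  reach_count (divisor c m) = reach_count (divisor c' m') /\
    (#|hat (class_ori c) m| < #|hat (class_ori c') m'|)%N ->
  (cell_measure c m < cell_measure c' m')%N.
Proof.
have le O x : (#|hat O x| < (n * n).+1)%N.
  by rewrite ltnS; apply: leq_trans (max_card _) _; rewrite card_prod card_ord.
rewrite /cell_measure => -[lt|[-> lt]]; last by rewrite ltn_add2l.
have lt' : ((reach_count (divisor c m)).+1 * (n * n).+1 <=
    reach_count (divisor c' m') * (n * n).+1)%N by rewrite leq_mul2r lt orbT.
apply: leq_trans (leq_trans lt' (leq_addr _ _)).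
by rewrite mulSnr ltn_add2l.
Qed.

Definition up_arc c m : part_arc n :=
  let T := odflt set0 (top_base (class_ori c) m) in
  (T, comp (class_ori c) q :\: T).

(** The two cases are those of [facet_firing]: a nonzero script lowers [reach_count], a zero script
    shows the facet on the sink representative. *)
Lemma facet_dichotomy k c e m : c \in chip_classes A k -> class_contractible c e ->
  let c2 := class_contract A c e in
  (reach_count (divisor c2 (m + mexp e)%MM) < reach_count (divisor c m))%N \/
  contractible (sink_rep c) e /\ contract (sink_rep c) e = sink_rep c2.
Proof.
move=> ck ce c2; have [Rc sk] := sink_repP ck.
have c2k := class_contract_classes A_sym ck ce.
have [Rc2 sk2] := sink_repP c2k.
have [s [sq s0 E F]] := facet_firing A_sym ck ce Rc sk Rc2.
have [/F|ns] := pselect (forall u, s u = 0); first by right.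
left; apply: (reach_count_lt sq s0) ns => u.
by rewrite -E !mnmDE -/(class_ori c) -/(class_ori c2) /class_ori !PoszD; ring.
Qed.

Lemma divisor_facet k c e m : c \in chip_classes A k -> contractible (sink_rep c) e ->
  contract (sink_rep c) e = sink_rep (class_contract A c e) ->
  divisor (class_contract A c e) (m + mexp e)%MM = divisor c m.
Proof.
move=> ck ce E; rewrite /divisor /class_ori -E -addmA; congr (_ + _)%MM; apply/esym.
by apply: outv_arc_pairs => u w uw; apply: arr_contract => //; apply: sink_rep_AP ck.
Qed.

Lemma class_contractible_rep k c e : c \in chip_classes A k ->
  contractible (sink_rep c) e -> class_contractible c e.
Proof.
by move=> ck ce; apply/exists_inP; exists (sink_rep c) => //; have [] := sink_repP ck.
Qed.

Lemma sink_contract C e : C \in AP -> contractible C e -> sink (ori C) ->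
  sink (ori (contract C e)).
Proof. by move=> CA ce; rewrite ori_contract //; apply: sink_sub; apply: subsetDl. Qed.

Lemma contract_sink_rep k c e : c \in chip_classes A k ->
  contractible (sink_rep c) e ->
  contract (sink_rep c) e = sink_rep (class_contract A c e).
Proof.
move=> ck ce; have [Rc sk] := sink_repP ck; apply/esym.
apply: (sink_rep_eq (k := k.-1)).
- exact: (class_contract_classes A_sym ck (class_contractible_rep ck ce)).
- exact: (contract_in_class A_sym ck Rc ce).
- exact: (sink_contract (sink_rep_AP ck) ce sk).
Qed.

Definition down_arc c m : part_arc n :=
  (odflt set0 (top_base (class_ori c) m), comp (class_ori c) q).

(** The contraction keeps the divisor and [hat], so the same [T] is chosen again, now inside the
    part of [q], and [up_arc] returns the contracted arc. *)
Lemma down_arcP k c m : c \in chip_classes A k -> class_down c m ->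
  let e := down_arc c m in
  let c0 := class_contract A c e in
  let m0 := (m + mexp e)%MM in
  [/\ contractible (sink_rep c) e, class_up c0 m0,
      up_arc c0 m0 = e & cell_measure c0 m0 = cell_measure c m].
Proof.
move=> ck dn e c0 m0; have CA := sink_rep_AP ck; have [Rc sk] := sink_repP ck.
set C := sink_rep c in CA Rc sk.
have [h hE] := AP_height CA.
move: (dn); rewrite /class_down /cell_down /class_ori -/C.
case topT: (top_base _ _) => [T|//] TQ.
have eE : e = (T, comp (ori C) q) by rewrite /e /down_arc /class_ori -/C topT.
rewrite hE in sk topT TQ.
have [h0 [OE [u [w [uT wQ uw]]] hatE compE]] := top_base_merge A_sym A_conn sk topT TQ.
have eC : e \in C.2.
  apply: (mem_arc A_sym CA (u := u) (w := w)); rewrite ?eE ?hE //=.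
    by rewrite -(top_base_comp_down A_sym A_conn sk topT TQ uT) -hE comp_part.
  by rewrite -hE comp_part.
have ce : contractible C e.
  by apply: (contractible_height A_sym CA eC (h := h0)); rewrite eE hE.
have CE := contract_sink_rep ck ce.
have ori0 : class_ori c0 = height_orient h0.
  by rewrite /class_ori -CE ori_contract // eE hE.
have hat0 : hat (class_ori c0) m0 = hat (height_orient h) m.
  by rewrite ori0 /m0 eE hE.
have top0 : top_base (class_ori c0) m0 = Some T by rewrite -topT /top_base hat0.
split=> //.
- by rewrite /class_up /cell_up top0 ori0 compE subsetUl.
- rewrite /up_arc top0 /= ori0 compE eE hE; congr (_, _); apply/setP => x.
  rewrite !inE; case xT: (x \in T) => //=.
  by have := top_base_disjoint A_sym topT TQ xT; rewrite inE => /negPf ->.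
- rewrite /cell_measure (divisor_facet _ ck ce CE) hat0.
  by rewrite /class_ori -/C hE.
Qed.

(** The strict descent that makes the matching acyclic: either the divisor descends, or the facet is
    one of the sink representative and [hat] shrinks by [hat_facet]. *)
Lemma down_facet k c m e : c \in chip_classes A k -> class_down c m ->
  class_contractible c e -> e != down_arc c m ->
  class_up (class_contract A c e) (m + mexp e)%MM ->
  (cell_measure (class_contract A c e) (m + mexp e)%MM < cell_measure c m)%N.
Proof.
move=> ck dn cce ne up; apply: cell_measure_lt.
have [lt|[ce CE]] := facet_dichotomy m ck cce; first by left.
right; rewrite (divisor_facet _ ck ce CE); split=> //.
have CA := sink_rep_AP ck; have [Rc sk] := sink_repP ck.
move: dn ne; rewrite /class_down /cell_down /down_arc /class_ori.
set C := sink_rep c in CA Rc sk ce CE *.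
have [h hE] := AP_height CA.
case topT: (top_base _ _) => [T|//] TQ ne.
have eC : e \in C.2 by case/andP: ce.
have [e1P e2P _ [u0 [w0 [u0e w0e uw0]]]] := arc_parts CA eC.
have oriE : ori (contract C e) = height_orient h :\: arc_pairs e.
  by rewrite ori_contract ?hE.
have cP U x : U \in C.1 -> x \in U -> comp (height_orient h) x = U.
  by move=> UP xU; rewrite -hE -(part_comp A_sym CA UP xU).
rewrite hE in sk topT TQ uw0.
have [] := hat_facet A_sym A_conn sk topT TQ (cP _^~ e1P) (cP _^~ e2P) u0e w0e uw0.
rewrite -surjective_pairing -oriE hE -CE => sub eqh.
apply: proper_card; rewrite properEneq sub andbT; apply: contraNneq ne => E.
rewrite /= hE; apply/eqP; apply: eqh => //.
move: up; rewrite /class_up /cell_up /class_ori -CE /top_base E.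
by rewrite -/(top_base (height_orient h) m) topT.
Qed.

(** The contracted cell remembers the arc through [up_arc], and reinserting its pairs recovers the
    orientation. *)
Lemma down_arc_inj k k' c c' m m' : c \in chip_classes A k -> c' \in chip_classes A k' ->
  class_down c m -> class_down c' m' ->
  class_contract A c (down_arc c m) = class_contract A c' (down_arc c' m') ->
  (m + mexp (down_arc c m) = m' + mexp (down_arc c' m'))%MM ->
  c = c' /\ m = m'.
Proof.
move=> ck ck' dn dn' Ec Em.
have [ce _ ue _] := down_arcP ck dn; have [ce' _ ue' _] := down_arcP ck' dn'.
have eE : down_arc c m = down_arc c' m' by rewrite -ue -ue' Ec Em.
split; last first.
  by move: Em; rewrite eE => /(congr1 (fun x => x - mexp (down_arc c' m'))%MM); rewrite !addmK.
apply: (sink_rep_inj ck ck').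
have CA := sink_rep_AP ck; have CA' := sink_rep_AP ck'.
apply: (ori_inj A_sym CA CA'); apply/setP => -[u w].
case uw: (adj u w); last by rewrite !in_ori uw.
have := arr_contract A_sym CA ce uw; have := arr_contract A_sym CA' ce' uw.
rewrite (contract_sink_rep ck ce) (contract_sink_rep ck' ce') Ec eE => <-.
by rewrite /arr; case: (_ \in ori _); case: (_ \in ori _).
Qed.

Lemma up_cell k c m : c \in chip_classes A k -> class_up c m ->
  exists c1 m1, [/\ c1 \in chip_classes A k.+1, class_down c1 m1,
    class_contract A c1 (down_arc c1 m1) = c & (m1 + mexp (down_arc c1 m1))%MM = m].
Proof.
move=> ck; have CA := sink_rep_AP ck; have [Rc sk] := sink_repP ck.
rewrite /class_up /cell_up /class_ori; set C := sink_rep c in CA Rc sk *.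
have [h hE] := AP_height CA.
rewrite hE in sk *; case topT: (top_base _ _) => [T|//] TQ.
have [h1 [arrE sk1 [compq compT] [u [w [ue we uw]]] [le hatE]]] := top_base_split A_sym A_conn sk topT TQ.
set e := (T, comp (height_orient h) q :\: T) in arrE compq ue we le hatE.
have [C1 CA1 C1E] := exists_AP A_sym h1.
have T1 : T \in C1.1 by rewrite -(compT u ue) -C1E comp_part.
have Q1 : e.2 \in C1.1 by rewrite -compq -C1E comp_part.
have eC1 : e \in C1.2 by apply: (mem_arc A_sym CA1 (u := u) (w := w)); rewrite ?C1E.
have OE : ori C1 :\: arc_pairs e = height_orient h.
  apply/setP => -[x y]; rewrite in_setDpairs C1E.
  case xy: (adj x y); last by rewrite !in_height_orient xy andbF.
  have := arrE _ _ xy; rewrite /arr.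
  by case: (_ && _); case: (_ \in _); case: (_ \in _).
have ce1 : contractible C1 e by apply: (contractible_height A_sym CA1 eC1 OE).
have CE : contract C1 e = C.
  apply: (ori_inj A_sym) => //; first exact: contract_acyclic_partition.
  by rewrite ori_contract // OE hE.
set c1 := chip_class A C1.
have c1k := chip_class_in CA1 : c1 \in _.
have C1c : C1 \in c1 by apply: mem_chip_class.
have R1 : sink_rep c1 = C1 by apply: sink_rep_eq c1k C1c _; rewrite C1E.
have ccE : class_contract A c1 e = c.
  rewrite (class_contractE A_sym c1k C1c ce1) CE.
  by have [_ _ ->] := chip_classes_mem A_sym ck Rc.
have cce : class_contractible c1 e by apply/exists_inP; exists C1.
(* The size is read off from the contraction; [T] is a part of [C1], so [.-1] does not truncate. *)
have sz : #|C1.1| = k.+1.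
  have := class_contract_classes A_sym c1k cce; rewrite ccE => /(chip_classes_size A_sym ck) ->.
  by rewrite (cardD1 T) T1.
have oE : class_ori c1 = height_orient h1 by rewrite /class_ori R1.
have top1 : top_base (class_ori c1) (m - mexp e)%MM = Some T.
  by rewrite oE /top_base hatE.
have daE : down_arc c1 (m - mexp e)%MM = e by rewrite /down_arc top1 oE compq.
exists c1, (m - mexp e)%MM; rewrite -sz daE ccE submK //; split=> //.
rewrite /class_down /cell_down top1 oE compq; apply/negP => /subsetP/(_ u ue).
by rewrite /= inE [u \in T]ue.
Qed.

Lemma no_arcs_comp C u : ori C = set0 -> comp (ori C) u = setT.
Proof.
move=> C0; apply/setP => x; rewrite [RHS]in_setT; apply/idP.
apply: (connected_ind A_conn (P := fun x => x \in comp (ori C) u)) (mem_comp _ _ _) _ => a b au ab.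
by rewrite -(comp_eq A_sym au) inE connect1 // C0 /unoriented /= ab !inE.
Qed.

Lemma no_arcs_parts C : C \in AP -> ori C = set0 -> C.1 = [set setT].
Proof.
move=> CA C0; apply/setP => U; rewrite inE; apply/idP/eqP => [UP|->].
  by have [u uU] := AP_nonempty CA UP; rewrite (part_comp A_sym CA UP uU) no_arcs_comp.
by rewrite -(no_arcs_comp q C0) comp_part.
Qed.

Lemma class_critical k c m : c \in chip_classes A k -> ~~ class_up c m ->
  ~~ class_down c m -> k = 1%N /\ max_legal A q (class_ori c) m = set0.
Proof.
move=> ck; have CA := sink_rep_AP ck; have [Rc sk] := sink_repP ck.
rewrite /class_up /cell_up /class_down /cell_down /class_ori.
have [_ szC _] := chip_classes_mem A_sym ck Rc.
set C := sink_rep c in CA Rc sk szC *.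
have [h hE] := AP_height CA.
rewrite hE in sk *; case topT: (top_base _ _) => [T|]; first by move=> /negPf ->.
move=> _ _; have [S0 O0] := top_base_none A_sym A_conn sk topT; split=> //.
rewrite -szC (no_arcs_parts CA) ?cards1 //.
by rewrite hE.
Qed.

End ClassMatching.

(** * Exactness from the matching *)

Section Exactness.
Variables (K : fieldType) (n : nat) (A : 'M[nat]_n).
Hypothesis A_sym : A^T = A.
Hypothesis A_conn : connected_set A [set: 'I_n].
Variable sgn : {set part_digraph n} -> part_arc n -> int.
Hypothesis sgnP : sign_system A sgn.
Variable q : 'I_n.
Implicit Types (e : part_arc n) (c : {set part_digraph n}) (m : 'X_{1..n}).

Local Notation mexp := (mexp A).
Local Notation class_up := (class_up A q).
Local Notation class_down := (class_down A q).
Local Notation down_arc := (down_arc A q).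
Local Notation cell_measure := (cell_measure A q).
Local Notation resF := (resF K A).
Local Notation basis := (resF_basis K A).
Local Notation delta := (delta K A sgn).
Local Notation cls k := {c : {set part_digraph n} | c \in chip_classes A k}.

Lemma sgn_unit k c e : c \in chip_classes A k -> class_contractible c e ->
  (sgn c e)%:~R = 1 :> K \/ (sgn c e)%:~R = - 1 :> K.
Proof.
by move=> ck ce; have [/(_ e ce) [->|->] _ _] := sgnP ck; [left|right]; rewrite ?rmorphN.
Qed.

Lemma delta_coef k (v : resF k.+1) (d : cls k.+1) m :
  (delta k v d : {mpoly K[n]})@_m =
  \sum_(c : cls k.+2) \sum_(e | class_contractible (val c) e &&
      (class_contract A (val c) e == val d))
    (sgn (val c) e)%:~R * ((v c : {mpoly K[n]}) * 'X_[mexp e])@_m.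
Proof.
rewrite /Defs.delta sum_ffunE raddf_sum; apply: eq_bigr => c _ /=.
rewrite ffunE sum_ffunE /= /GRing.scale /= mulr_sumr raddf_sum big_mkcondr /=.
apply: eq_bigr => e ce; rewrite !ffunE /= (class_exponentE A_sym (valP c) ce) eq_sym.
rewrite /GRing.scale /=; case: eqP => _; last by rewrite !mulr0 raddf0.
by rewrite mulr1 mulrCA !mulrzl raddfMz.
Qed.

Lemma mcoeffMX_eq0 (p : {mpoly K[n]}) m m0 :
  (forall m', (m' + m)%MM = m0 -> p@_m' = 0) -> (p * 'X_[m])@_m0 = 0.
Proof.
move=> p0; rewrite [p]mpolyE mulr_suml raddf_sum big1 // => m' _ /=.
rewrite -scalerAl mcoeffZ -mpolyXD mcoeffX.
by case: eqP => [/p0 ->|]; rewrite ?mul0r ?mulr0.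
Qed.

Lemma mcoeffMX_addm (p : {mpoly K[n]}) m m0 : (p * 'X_[m])@_(m0 + m) = p@_m0.
Proof. by rewrite addmC mcoeffMX. Qed.

Lemma resF_coefD k (u v : resF k) (c : cls k.+1) m :
  ((u + v) c : {mpoly K[n]})@_m = (u c : {mpoly K[n]})@_m + (v c : {mpoly K[n]})@_m.
Proof. by rewrite ffunE mcoeffD. Qed.

Lemma resF_coefZ k (a : K) (v : resF k) (c : cls k.+1) m :
  ((a%:MP *: v) c : {mpoly K[n]})@_m = a * (v c : {mpoly K[n]})@_m.
Proof. by rewrite ffunE mcoeffCM. Qed.

(** Critical cells are tolerated; by [class_critical] they occur only in degree 0. *)
Definition down_supported k (v : resF k) :=
  forall (c : cls k.+1) m, class_up (val c) m -> (v c : {mpoly K[n]})@_m = 0.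

Definition reducible k (v : resF k) := exists w : resF k.+1, down_supported (v - delta k w).

Lemma reducible_add k (u v : resF k) : reducible u -> reducible v -> reducible (u + v).
Proof.
move=> [w1 H1] [w2 H2]; exists (w1 + w2) => c m up.
have -> : u + v - delta k (w1 + w2) = (u - delta k w1) + (v - delta k w2).
  by rewrite linearD opprD addrACA.
rewrite resF_coefD -[RHS]addr0; congr (_ + _); [exact: H1|exact: H2].
Qed.

Lemma reducible_scale k (a : K) (v : resF k) : reducible v -> reducible (a%:MP *: v).
Proof.
move=> [w H]; exists (a%:MP *: w) => c m up.
have -> : a%:MP *: v - delta k (a%:MP *: w) = a%:MP *: (v - delta k w).
  by rewrite linearZ -scalerBr.
by rewrite resF_coefZ -[RHS](mulr0 a); congr (_ * _); exact: H.
Qed.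

Lemma reducible_delta k (w : resF k.+1) : reducible (delta k w).
Proof. by exists w => c m _; rewrite subrr ffunE mcoeff0. Qed.

Lemma reducible0 k : reducible (0 : resF k).
Proof. by exists 0 => c m _; rewrite linear0 subrr ffunE mcoeff0. Qed.

Lemma reducible_sum k (I : Type) (r : seq I) (P : pred I) (F : I -> resF k) :
  (forall i, P i -> reducible (F i)) -> reducible (\sum_(i <- r | P i) F i).
Proof. by move=> H; apply: big_ind => //; [exact: reducible0|exact: reducible_add]. Qed.

Lemma reducible_not_up k c m : ~~ class_up c m -> reducible ('X_[m] *: basis k c).
Proof.
move=> nup; exists 0 => d m' up; rewrite linear0 subr0 !ffunE.
case: eqP => E; last by rewrite /GRing.scale /= mulr0 mcoeff0.
rewrite /GRing.scale /= mulr1 mcoeffX; case: eqP => // Em.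
by rewrite Em -E up in nup.
Qed.

Lemma delta_cell k c m (ck : c \in chip_classes A k.+2) :
  delta k ('X_[m] *: basis k.+1 c) = \sum_(e | class_contractible c e)
    ((sgn c e)%:~R : K)%:MP *: ('X_[(m + mexp e)%MM] *: basis k (class_contract A c e)).
Proof.
rewrite linearZ /= /Defs.delta (bigD1 (Sub c ck)) //= [X in _ + X]big1 => [|d nd]; last first.
  rewrite [resF_basis _ _ _ _ _]ffunE (_ : (val d == c) = false) ?scale0r //.
  by apply: contraNF nd => /eqP E; apply/eqP/val_inj.
rewrite addr0 [resF_basis _ _ _ _ _]ffunE /= eqxx scale1r scaler_sumr; apply: eq_bigr => e ce.
rewrite !scalerA (class_exponentE A_sym ck ce) mpolyXD rmorph_int; congr (_ *: _).
by rewrite mulrCA.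
Qed.

(** Gaussian elimination along the matching: up to sign, an up cell is [delta] of its partner minus
    the other facets of the partner, and those of them that are up have smaller measure. *)
Lemma reducible_cell k c m : c \in chip_classes A k.+1 -> reducible ('X_[m] *: basis k c).
Proof.
have [N] := ubnP (cell_measure c m); elim: N => // N IH in c m *.
rewrite ltnS => cN ck; have [up|] := boolP (class_up c m); last exact: reducible_not_up.
have [c1 [m1 [c1k dn Ec Em]]] := up_cell A_sym A_conn ck up.
have [ce _ _ muE] := down_arcP A_sym A_conn c1k dn.
have cce := class_contractible_rep A_sym A_conn c1k ce.
set e := down_arc c1 m1 in Ec Em ce muE cce.
have := delta_cell m1 c1k; rewrite (bigD1 e) //= Ec Em => E.
set a : K := (sgn c1 e)%:~R in E.
have aa : a * a = 1.
  by rewrite /a; case: (sgn_unit c1k cce) => ->; rewrite ?mulrNN mulr1.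
(* The matched coefficient [a] is a sign, hence its own inverse. *)
rewrite -[_ *: _]scale1r -[1]mpolyC1 -aa mpolyCM -scalerA.
rewrite -(canLR (addrK _) E).
apply: reducible_scale; apply: reducible_add; first exact: reducible_delta.
rewrite -sumrN; apply: reducible_sum => e' /andP[ce' ne].
rewrite -scaleNr -mpolyCN; apply: reducible_scale.
have c'k := class_contract_in A_sym c1k ce'.
have [up'|] := boolP (class_up (class_contract A c1 e') (m1 + mexp e')%MM);
  last exact: reducible_not_up.
apply: IH => //; apply: leq_trans cN; rewrite -Ec -Em muE.
exact: (down_facet A_sym A_conn c1k dn ce' ne up').
Qed.

Lemma resF_decomp k (v : resF k) :
  v = \sum_(c : cls k.+1) (v c) *: basis k (val c).
Proof.
apply/ffunP => d; rewrite sum_ffunE (bigD1 d) //= [X in _ + X]big1 => [|c nc]; last first.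
  rewrite !ffunE (_ : (val d == val c) = false) ?scaler0 //.
  by apply: contraNF nc => /eqP E; apply/eqP/val_inj.
by rewrite !ffunE eqxx addr0 /GRing.scale /= mulr1.
Qed.

Lemma resF_reducible k (v : resF k) : reducible v.
Proof.
rewrite [v]resF_decomp; apply: reducible_sum => c _.
rewrite [X in X *: _](mpolyE (v c)) scaler_suml; apply: reducible_sum => m _.
rewrite -mul_mpolyC -scalerA; apply: reducible_scale.
exact: reducible_cell (valP c).
Qed.

(** Triangularity: at the matched facet of a cell of largest measure in the support no other cell
    contributes, since by [down_facet] it would have a still larger measure. *)
Lemma down_supported_inj k (v : resF k.+1) :
  (forall (c : cls k.+2) m, (v c : {mpoly K[n]})@_m != 0 -> class_down (val c) m) ->
  delta k v = 0 -> v = 0.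
Proof.
move=> dnv dv0.
(* Any upper bound for the measures in the support would do; the induction descends from it. *)
pose B := (\sum_(c : cls k.+2) \sum_(m <- msupp (v c : {mpoly K[n]})) cell_measure (val c) m)%N.
have leB (c : cls k.+2) m : (v c : {mpoly K[n]})@_m != 0 -> (cell_measure (val c) m <= B)%N.
  rewrite -mcoeff_msupp => mc; rewrite /B (bigD1 c) //= (big_rem m) //=.
  by rewrite -addnA leq_addr.
suff H : forall (c : cls k.+2) m, (v c : {mpoly K[n]})@_m = 0.
  by apply/ffunP => c; rewrite ffunE; apply/mpolyP => m; rewrite H mcoeff0.
suff H N : forall (c : cls k.+2) m, (B < cell_measure (val c) m + N)%N -> (v c : {mpoly K[n]})@_m = 0.
  by move=> c m; apply: (H B.+1); rewrite addnS ltnS leq_addl.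
elim: N => [|N IH] c m.
  by rewrite addn0 => lt; apply/eqP; apply: contraLR lt => /leB; rewrite -leqNgt.
rewrite addnS ltnS => le; apply/eqP; apply/negPn/negP => nz.
have dn := dnv _ _ nz; set e := down_arc (val c) m.
have [ce up _ muE] := down_arcP A_sym A_conn (valP c) dn.
have cce := class_contractible_rep A_sym A_conn (valP c) ce.
pose d : cls k.+1 := exist (fun c => c \in chip_classes A k.+1) _ (class_contract_in A_sym (valP c) cce).
have := delta_coef v d (m + mexp e)%MM; rewrite dv0 ffunE mcoeff0.
rewrite (bigD1 c) //= (bigD1 e) /=; last by rewrite cce eqxx.
have zero (c' : cls k.+2) e' : class_contractible (val c') e' ->
    class_contract A (val c') e' = class_contract A (val c) e ->
    (c' != c) || (e' != e) -> ((v c' : {mpoly K[n]}) * 'X_[mexp e'])@_(m + mexp e)%MM = 0.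
  move=> ce' Ec ne; apply: mcoeffMX_eq0 => m' Em; apply/eqP/negPn/negP => nz'.
  have dn' := dnv _ _ nz'.
  have [E|ne'] := eqVneq e' (down_arc (val c') m').
    move: ne; apply/negP; rewrite negb_or !negbK.
    rewrite E in Ec Em.
    have [Ecc Emm] := down_arc_inj A_sym A_conn (valP c') (valP c) dn' dn Ec Em.
    by rewrite -(inj_eq val_inj) Ecc E Ecc Emm !eqxx.
  have := down_facet A_sym A_conn (valP c') dn' ce' ne'.
  rewrite Ec Em => /(_ up); rewrite muE => lt.
  case/eqP: nz'; apply: IH; apply: leq_ltn_trans le _; by rewrite ltn_add2r.
rewrite [X in _ + X]big1 ?addr0; last first.
  move=> c' nc; rewrite big1 // => e' /andP[ce' /eqP Ec].
  by rewrite zero ?mulr0 // nc.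
rewrite [X in _ + X]big1 ?addr0; last first.
  move=> e' /andP[/andP[ce' /eqP Ec] ne].
  by rewrite zero ?mulr0 // ne orbT.
rewrite mcoeffMX_addm => /esym/eqP; rewrite mulf_eq0 (negPf nz) orbF.
by case: (sgn_unit (valP c) cce) => ->; rewrite ?oppr_eq0 oner_eq0.
Qed.

(** After reduction the remainder is a cycle without up cells; critical cells do not exist in
    positive degree, so it is supported on down cells and vanishes. *)
Lemma resF_exact k (v : resF k.+1) :
  (forall w : resF k.+2, delta k (delta k.+1 w) = 0) ->
  delta k v = 0 -> exists w : resF k.+2, delta k.+1 w = v.
Proof.
move=> dd dv; have [w dw] := resF_reducible v; exists w.
apply/esym/eqP; rewrite -subr_eq0; apply/eqP; apply: down_supported_inj; last first.
  by rewrite linearB /= dv dd subrr.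
move=> c m nz; apply: contraT => ndn.
have nup : ~~ class_up (val c) m by apply: contraNN nz => /dw/eqP.
by have [] := class_critical A_sym A_conn (valP c) nup ndn.
Qed.

End Exactness.

(** * The composition of consecutive differentials *)

(** Each orbit is split by the rank of its two elements instead of halving the sum, so
    characteristic 2 is covered. *)
Lemma big_involution_eq0 (V : zmodType) (I : finType) (P : pred I) (F : I -> V) (i' : I -> I) :
  (forall i, P i -> [/\ P (i' i), i' (i' i) = i, i' i != i & F (i' i) = - F i]) ->
  \sum_(i | P i) F i = 0.
Proof.
move=> H; pose r i := (enum_rank i < enum_rank (i' i))%N.
rewrite (bigID r) /= [X in _ + X](reindex_onto i' i') /=; last first.
  by move=> i /andP[/H[]].
rewrite [X in _ + X](eq_bigl (fun i => P i && r i)); last first.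
  move=> i; rewrite /r; apply/idP/idP => [/andP[/andP[Pi le] /eqP E]|/andP[Pi lt]].
    have [Pi' _ ne _] := H _ Pi; rewrite E in Pi' le ne *; rewrite Pi' /=.
    move: le; rewrite -leqNgt leq_eqVlt => /orP[/eqP/val_inj/enum_rank_inj F'|//].
    by rewrite -F' eqxx in ne.
  have [-> -> _ _] := H _ Pi; by rewrite eqxx andbT -leqNgt ltnW.
rewrite -big_split big1 //= => i /andP[/H[_ _ _ ->] _]; exact: subrr.
Qed.

Section DeltaDelta.
Variables (n : nat) (A : 'M[nat]_n).
Hypothesis A_sym : A^T = A.
Implicit Types (C D E F : part_digraph n) (c : {set part_digraph n}).
Implicit Types (e f g : part_arc n) (U W X Y Z : {set 'I_n}).

Local Notation AP := (acyclic_partitions A).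
Local Notation adj := (adj A).
Local Notation ori := (ori A).
Local Notation height_orient := (height_orient A).
Local Notation mexp := (mexp A).
Local Notation ind e u w := (b2z ((u \in e.1) && (w \in e.2))).

Lemma contractible_mem C e : contractible C e -> e \in C.2.
Proof. by case/andP. Qed.

(* The contractions of C along e then g, and along f then e', agree as soon as
   they delete the same pairs of vertices. *)
Lemma contract_square k c C e f g e' :
  c \in chip_classes A k -> C \in c -> contractible C e ->
  contractible (contract C e) g ->
  f.1 \in C.1 -> f.2 \in C.1 -> f.1 \subset g.1 -> f.2 \subset g.2 ->
  (0 < part_weight A f.1 f.2)%N ->
  e'.1 \in merge_part f @: C.1 -> e'.2 \in merge_part f @: C.1 ->
  e.1 \subset e'.1 -> e.2 \subset e'.2 -> [disjoint e'.1 & e'.2] ->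
  e'.1 :|: e'.2 \in (contract (contract C e) g).1 ->
  (forall u w, adj u w -> ind e u w + ind g u w = ind f u w + ind e' u w) ->
  [/\ class_contractible c f, class_contractible (class_contract A c f) e' &
      class_contract A (class_contract A c e) g = class_contract A (class_contract A c f) e'].
Proof.
move=> ck Cc ce cg f1P f2P /subsetP f1g /subsetP f2g fw e1P e2P /subsetP ee1 /subsetP ee2 dis eE sq.
have [CA _ _] := chip_classes_mem A_sym ck Cc.
have DA := contract_acyclic_partition A_sym CA ce.
have EA := contract_acyclic_partition A_sym DA cg.
set D := contract C e in cg DA EA eE *; set E := contract D g in EA eE *.
have [h hE] := AP_height EA.
have arrE u w : adj u w -> arr (ori C) u w = arr (ori E) u w + ind f u w + ind e' u w.
  move=> uw; rewrite (arr_contract A_sym CA ce uw) (arr_contract A_sym DA cg uw) -!addrA.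
  by congr (_ + _); rewrite addrC sq.
have [u0 u0f [w0 w0f uw0]] : exists2 u, u \in f.1 & exists2 w, w \in f.2 & adj u w.
  by move: fw; rewrite part_weight_pos => /exists_inP[u uf /exists_inP[w wf uw]]; exists u => //; exists w.
have posE u w : 0 <= arr (ori E) u w := arr_ge0 _ _ _.
have ori_pos u w : adj u w -> 0 < arr (ori C) u w -> (u, w) \in ori C.
  by rewrite /arr; case: (_ \in ori C).
have fC : f \in C.2.
  apply: (mem_arc A_sym CA f1P f2P u0f w0f); apply: ori_pos => //.
  rewrite (arr_contract A_sym CA ce uw0) (arr_contract A_sym DA cg uw0).
  by rewrite (f1g _ u0f) (f2g _ w0f) /=; have := posE u0 w0; move: (arr _ _ _); clear; lia.
(* Raising [e'.1] in the total contraction reinserts the pairs of [e'], which leaves [C] without the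
   pairs of [f]. *)
have split u w : adj u w -> arr (height_orient (fun x => (h x).*2 + (x \in e'.1))%N) u w =
    arr (ori E) u w + ind e' u w.
  exact: arr_split.
have OF : ori C :\: arc_pairs f = height_orient (fun x => (h x).*2 + (x \in e'.1))%N.
  apply/setP => -[u w]; case uw: (adj u w); last first.
    by rewrite in_setDpairs in_ori in_height_orient uw andbF.
  have := arrE u w uw; rewrite -addrA [ind f u w + _]addrC addrA -split // in_setDpairs.
  by rewrite /arr; case: (_ && _); case: (_ \in ori C); case: (_ \in height_orient _).
have cf := contractible_height A_sym CA fC OF.
have FA := contract_acyclic_partition A_sym CA cf.
set F := contract C f in FA *.
have FE : ori F = height_orient (fun x => (h x).*2 + (x \in e'.1))%N.
  by rewrite /F ori_contract.
have [_ _ _ [u1 [w1 [u1e w1e uw1]]]] := arc_parts CA (contractible_mem ce).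
have eF : e' \in F.2.
  apply: (mem_arc A_sym FA e1P e2P (ee1 _ u1e) (ee2 _ w1e)).
  have auw1 := ori_adj uw1; have := split _ _ auw1; rewrite -FE (ee1 _ u1e) (ee2 _ w1e) /=.
  have := posE u1 w1; move: (arr (ori E) u1 w1) => a a0; rewrite /arr.
  by case: (_ \in ori F) => //=; move: a0; clear; lia.
have OE : ori F :\: arc_pairs e' = height_orient h.
  apply/setP => -[u w]; case uw: (adj u w); last first.
    by rewrite in_setDpairs in_ori in_height_orient uw andbF.
  have := split u w uw; rewrite -FE in_setDpairs -hE /arr.
  by case: (_ && _); case: (_ \in ori F); case: (_ \in ori E).
have ceF := contractible_height A_sym FA eF OE.
have FE' : contract F e' = E.
  apply: (ori_inj A_sym) => //; first exact: contract_acyclic_partition.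
  by rewrite ori_contract // OE hE.
have cce : class_contractible c e by apply/exists_inP; exists C.
have ccf : class_contractible c f by apply/exists_inP; exists C.
have Dc := contract_in_class A_sym ck Cc ce.
have Fc := contract_in_class A_sym ck Cc cf.
have ek := class_contract_classes A_sym ck cce.
have fk := class_contract_classes A_sym ck ccf.
split=> //; first by apply/exists_inP; exists F.
rewrite (class_contractE A_sym ek Dc cg) (class_contractE A_sym fk Fc ceF).
by rewrite FE'.
Qed.

Lemma setU_not_part C U W Z : C \in AP -> U \in C.1 -> W \in C.1 -> U != W ->
  Z \in C.1 -> (U :|: W == Z) = false.
Proof.
move=> CA UP WP ne ZP; apply: contraNF ne => /eqP E.
have [u uU] := AP_nonempty CA UP; have [w wW] := AP_nonempty CA WP.
have uZ : u \in Z by rewrite -E inE uU.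
have wZ : w \in Z by rewrite -E inE wW orbT.
by rewrite -(AP_pblock CA UP uU) (AP_pblock CA ZP uZ) -(AP_pblock CA ZP wZ) (AP_pblock CA WP wW).
Qed.

Lemma parts_at_most_one C U W Z u : C \in AP -> U \in C.1 -> W \in C.1 -> Z \in C.1 ->
  U != W -> Z != U -> Z != W -> ((u \in U) + (u \in W) + (u \in Z) <= 1)%N.
Proof.
move=> CA UP WP ZP UW ZU ZW.
have d1 := disjoint_parts CA UP WP UW (u := u).
have d2 := disjoint_parts CA ZP UP ZU (u := u).
have d3 := disjoint_parts CA ZP WP ZW (u := u).
move: d1 d2 d3.
by case: (u \in U); case: (u \in W); case: (u \in Z) => //= d1 d2 d3;
  try (have := d1 isT); try (have := d2 isT); try (have := d3 isT).
Qed.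

Lemma part_weight0 U W u w : part_weight A U W = 0%N -> adj u w ->
  (u \in U) && (w \in W) = false.
Proof.
move=> pw uw; apply/negP => /andP[uU wW].
suff: (0 < part_weight A U W)%N by rewrite pw.
rewrite part_weight_pos; apply/exists_inP; exists u => //.
by apply/exists_inP; exists w.
Qed.

Lemma part_weightU U W Z : (0 < part_weight A (U :|: W) Z)%N ->
  (0 < part_weight A U Z)%N || (0 < part_weight A W Z)%N.
Proof.
rewrite !part_weight_pos => /exists_inP[u /setUP[uU|uW] H]; apply/orP; [left|right];
  by apply/exists_inP; exists u.
Qed.

(* The other arc of C through which the codimension 2 contraction factors. *)
Definition swap_arc e g : part_arc n :=
  let: (U, W) := e in let: (X, Y) := g in
  if X == U :|: W then (if (0 < part_weight A W Y)%N then (W, Y) else (U, Y))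
  else if Y == U :|: W then (if (0 < part_weight A X U)%N then (X, U) else (X, W))
  else g.

Arguments swap_arc : simpl never.

(** Exchanges the two orders of contraction with the same composite; the second arc is the old first
    one as seen after the new contraction. *)
Definition swap_pair (p : part_arc n * part_arc n) : part_arc n * part_arc n :=
  (swap_arc p.1 p.2, contract_arc (swap_arc p.1 p.2) p.1).

Lemma mem_merge_parts C e Z : C \in AP -> e.1 \in C.1 -> e.2 \in C.1 ->
  Z \in merge_part e @: C.1 -> Z = e.1 :|: e.2 \/ [/\ Z \in C.1, Z != e.1 & Z != e.2].
Proof.
move=> CA e1P e2P /imsetP[V VP ->]; rewrite /merge_part.
by case: eqVneq => [_|n1]; case: eqVneq => [_|n2] /=; [left..|right].
Qed.

(** If [g] avoids the merged part, the contractions commute. Otherwise three parts become one, and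
    adjacency decides which other arc can come first: for [g = (U :|: W, Y)] it is [(W, Y)] if these
    parts are adjacent, and [(U, Y)] if not. Either way the two orders delete the same edges. *)
Lemma swap_arcP k c e g : c \in chip_classes A k -> class_contractible c e ->
  class_contractible (class_contract A c e) g ->
  let f := swap_arc e g in let e' := contract_arc f e in
  [/\ class_contractible c f, class_contractible (class_contract A c f) e',
      class_contract A (class_contract A c e) g = class_contract A (class_contract A c f) e' &
      [/\ (mexp e + mexp g = mexp f + mexp e')%MM, f != e,
      contract_arc e f = g & swap_arc f e' = e]].
Proof.
move=> ck cce /exists_inP[D Dc cg].
have [C [Cc ce CD]] := contract_lift A_sym ck cce Dc; rewrite -CD in Dc cg.
have [CA _ _] := chip_classes_mem A_sym ck Cc.
have DA := contract_acyclic_partition A_sym CA ce.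
have [e1P e2P ne [u0 [w0 [u0e w0e uw0]]]] := arc_parts CA (contractible_mem ce).
have [g1P g2P ng [x0 [y0 [x0g y0g xy0]]]] := arc_parts DA (contractible_mem cg).
have wt (Z1 Z2 : {set 'I_n}) u w : u \in Z1 -> w \in Z2 -> adj u w -> (0 < part_weight A Z1 Z2)%N.
  move=> uZ wZ uw; rewrite part_weight_pos; apply/exists_inP; exists u => //.
  by apply/exists_inP; exists w.
have wUW := wt _ _ _ _ u0e w0e (ori_adj uw0).
have wXY := wt _ _ _ _ x0g y0g (ori_adj xy0).
have sqmexp (f e' : part_arc n) : (forall u w, adj u w -> ind e u w + ind g u w = ind f u w + ind e' u w) ->
    (mexp e + mexp g = mexp f + mexp e')%MM.
  move=> sq; apply/mnmP => u; rewrite !mnmDE !mnmE -!big_split; apply: eq_bigr => w _ /=.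
  case uw: (adj u w); last by move: uw; rewrite /adj lt0n => /negbFE/eqP->.
  by rewrite -!mulnDr; congr muln; have := sq u w uw;
   case: (_ && _); case: (_ && _); case: (_ && _); case: (_ && _).
have mP f Z : Z \in C.1 -> merge_part f Z \in merge_part f @: C.1 by move=> ZP; apply: imset_f.
have gE : g.1 :|: g.2 \in (contract (contract C e) g).1.
  by apply/imsetP; exists g.1; rewrite // /merge_part eqxx.
have UE (Z : {set 'I_n}) : Z \in (contract C e).1 -> Z != g.1 -> Z != g.2 -> Z \in (contract (contract C e) g).1.
  by move=> ZP n1 n2; apply/imsetP; exists Z; rewrite // /merge_part (negPf n1) (negPf n2).
have UWD : e.1 :|: e.2 \in (contract C e).1.
  by apply/imsetP; exists e.1; rewrite // /merge_part eqxx.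
case: e => U W in cce Dc cg Cc ce CD DA e1P e2P ne u0e w0e g1P g2P wUW sqmexp UE UWD gE xy0 *.
case: g => X Y in cg g1P g2P ng x0g y0g wXY sqmexp UE gE *.
rewrite /= in e1P e2P ne g1P g2P ng wUW wXY UE UWD gE u0e w0e.
(* All five configurations pass through this; what remains for each are identities between sets and
   indicators. *)
have fin f e' : swap_arc (U, W) (X, Y) = f -> contract_arc f (U, W) = e' ->
    f.1 \in C.1 -> f.2 \in C.1 -> f.1 \subset X -> f.2 \subset Y ->
    (0 < part_weight A f.1 f.2)%N -> [disjoint e'.1 & e'.2] ->
    e'.1 :|: e'.2 \in (contract (contract C (U, W)) (X, Y)).1 ->
    (forall u w, adj u w ->
      ind (U, W) u w + ind (X, Y) u w = ind f u w + ind e' u w) ->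
    f != (U, W) -> contract_arc (U, W) f = (X, Y) -> swap_arc f e' = (U, W) ->
  let f := swap_arc (U, W) (X, Y) in let e' := contract_arc f (U, W) in
  [/\ class_contractible c f, class_contractible (class_contract A c f) e',
      class_contract A (class_contract A c (U, W)) (X, Y) =
        class_contract A (class_contract A c f) e' &
      [/\ (mexp (U, W) + mexp (X, Y) = mexp f + mexp e')%MM, f != (U, W),
      contract_arc (U, W) f = (X, Y) & swap_arc f e' = (U, W)]].
  move=> -> E1 f1P f2P f1X f2Y fw dis eE sq nf cf sf; rewrite /= E1.
  have [||||c1 c2 c3] := contract_square (e' := e') ck Cc ce cg f1P f2P f1X f2Y fw _ _ _ _ dis eE sq.
  - by rewrite -E1; apply: mP.
  - by rewrite -E1; apply: mP.
  - by rewrite -E1; apply: sub_merge_part.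
  - by rewrite -E1; apply: sub_merge_part.
  by split=> //; split=> //; apply: sqmexp.
have neW : W != U by rewrite eq_sym.
have disP (Z1 Z2 : {set 'I_n}) : (forall u, ((u \in Z1) + (u \in Z2) <= 1)%N) -> [disjoint Z1 & Z2].
  move=> H; rewrite disjoint_subset; apply/subsetP => u uZ; rewrite !inE; apply/negP => uZ2.
  by have := H u; rewrite uZ uZ2.
case: (mem_merge_parts (e := (U, W)) CA e1P e2P g1P) => [/= EX|[/= XP XU XW]];
  case: (mem_merge_parts (e := (U, W)) CA e1P e2P g2P) => [/= EY|[/= YP YU YW]].
- by rewrite EX EY eqxx in ng.
- have UY : U != Y by rewrite eq_sym.
  have WY : W != Y by rewrite eq_sym.
  have one u := parts_at_most_one u CA e1P e2P YP ne YU YW.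
  have fWY := setU_not_part CA e2P YP WY e1P.
  have sw (b : bool) : (0 < part_weight A W Y)%N = b -> swap_arc (U, W) (X, Y) =
      if b then (W, Y) else (U, Y).
    by move=> <-; rewrite /swap_arc EX eqxx.
  case pw: (0 < part_weight A W Y)%N; have {}sw := sw _ pw.
  + apply: (fin _ (U, W :|: Y) sw) => //=.
    * by rewrite /contract_arc /merge_part /= (negPf ne) (negPf UY) eqxx.
    * by rewrite EX subsetUr.
    * apply: disP => u; rewrite inE; have := one u.
      by case: (u \in U); case: (u \in W); case: (u \in Y).
    * by rewrite setUA -EX.
    * move=> u w uw; rewrite EX !inE; have := one u; have := one w.
      by case: (u \in U); case: (u \in W); case: (u \in Y);
        case: (w \in U); case: (w \in W); case: (w \in Y).
    * by rewrite xpair_eqE (negPf neW).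
    * by rewrite /contract_arc /merge_part /= (negPf YU) (negPf YW) eqxx orbT EX.
    * by rewrite /swap_arc eq_sym fWY eqxx wUW.
  (* No edge joins [W] and [Y], so pairs between them do not matter in the identity of
     indicators. *)
  + move/negbT: pw; rewrite -eqn0Ngt => /eqP pw.
    have pwUY : (0 < part_weight A U Y)%N.
      by move: wXY; rewrite EX => /part_weightU; rewrite pw orbF.
    apply: (fin _ (U :|: Y, W) sw) => //=.
    * by rewrite /contract_arc /merge_part /= (negPf neW) (negPf WY) eqxx.
    * by rewrite EX subsetUl.
    * apply: disP => u; rewrite inE; have := one u.
      by case: (u \in U); case: (u \in W); case: (u \in Y).
    * by rewrite setUAC -EX.
    * move=> u w uw; rewrite EX !inE; have := one u; have := one w.
      have := part_weight0 pw uw.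
      have := part_weight0 pw (u := w) (w := u); rewrite adjC // => /(_ uw).
      by case: (u \in U); case: (u \in W); case: (u \in Y);
        case: (w \in U); case: (w \in W); case: (w \in Y).
    * by rewrite xpair_eqE (negPf YW) andbF.
    * by rewrite /contract_arc /merge_part /= (negPf YU) (negPf YW) eqxx EX.
    * by rewrite /swap_arc eqxx part_weightC // pw.
- have UX : U != X by rewrite eq_sym.
  have WX : W != X by rewrite eq_sym.
  have one u := parts_at_most_one u CA e1P e2P XP ne XU XW.
  have fXW := setU_not_part CA XP e2P XW e1P.
  have sw (b : bool) : (0 < part_weight A X U)%N = b -> swap_arc (U, W) (X, Y) =
      if b then (X, U) else (X, W).
    by move=> <-; rewrite /swap_arc EY eqxx eq_sym (setU_not_part CA e1P e2P ne XP).
  case pw: (0 < part_weight A X U)%N; have {}sw := sw _ pw.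
  + apply: (fin _ (X :|: U, W) sw) => //=.
    * by rewrite /contract_arc /merge_part /= (negPf neW) (negPf WX) eqxx orbT.
    * by rewrite EY subsetUl.
    * apply: disP => u; rewrite inE; have := one u.
      by case: (u \in U); case: (u \in W); case: (u \in X).
    * by rewrite -setUA -EY.
    * move=> u w uw; rewrite EY !inE; have := one u; have := one w.
      by case: (u \in U); case: (u \in W); case: (u \in X);
        case: (w \in U); case: (w \in W); case: (w \in X).
    * by rewrite xpair_eqE (negPf XU).
    * by rewrite /contract_arc /merge_part /= (negPf XU) (negPf XW) eqxx EY.
    * by rewrite /swap_arc eqxx wUW.
  + move/negbT: pw; rewrite -eqn0Ngt => /eqP pw.
    have pwXW : (0 < part_weight A X W)%N.
      move: wXY; rewrite EY part_weightC // => /part_weightU.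
      by rewrite (part_weightC U X) // pw (part_weightC W X).
    apply: (fin _ (U, X :|: W) sw) => //=.
    * by rewrite /contract_arc /merge_part /= (negPf ne) (negPf UX) eqxx orbT.
    * by rewrite EY subsetUr.
    * apply: disP => u; rewrite inE; have := one u.
      by case: (u \in U); case: (u \in W); case: (u \in X).
    * by rewrite setUCA -EY.
    * move=> u w uw; rewrite EY !inE; have := one u; have := one w.
      have := part_weight0 pw uw.
      have := part_weight0 pw (u := w) (w := u); rewrite adjC // => /(_ uw).
      by case: (u \in U); case: (u \in W); case: (u \in X);
        case: (w \in U); case: (w \in W); case: (w \in X).
    * by rewrite xpair_eqE (negPf XU).
    * by rewrite /contract_arc /merge_part /= (negPf XU) (negPf XW) eqxx orbT EY.
    * by rewrite /swap_arc eq_sym fXW eqxx part_weightC // pw.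
have UX : U != X by rewrite eq_sym.
have WX : W != X by rewrite eq_sym.
have UY : U != Y by rewrite eq_sym.
have WY : W != Y by rewrite eq_sym.
have nUWX := setU_not_part CA e1P e2P ne XP.
have nUWY := setU_not_part CA e1P e2P ne YP.
apply: (fin (X, Y) (U, W)) => //=.
- by rewrite /swap_arc eq_sym nUWX eq_sym nUWY.
- by rewrite /contract_arc /merge_part /= (negPf UX) (negPf UY) (negPf WX) (negPf WY).
- by rewrite disjoint_subset; apply/subsetP => x; apply: (disjoint_parts CA e1P e2P ne).
- by apply: UE; rewrite ?nUWX ?nUWY.
- by move=> u w _; rewrite addrC.
- by rewrite xpair_eqE (negPf XU).
- by rewrite /contract_arc /merge_part /= (negPf XU) (negPf XW) (negPf YU) (negPf YW).
- by rewrite /swap_arc eq_sym (setU_not_part CA XP YP ng e1P) eq_sym (setU_not_part CA XP YP ng e2P).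
Qed.

End DeltaDelta.

(** * The toppling ideal *)

Lemma big_two (V : zmodType) (I : finType) (P : pred I) (F : I -> V) a b :
  P a -> P b -> b != a -> (forall i, P i -> i = a \/ i = b) ->
  \sum_(i | P i) F i = F a + F b.
Proof.
move=> Pa Pb ne H; rewrite (bigD1 a) //= (bigD1 b) ?Pb //= big1 ?addr0 //.
by move=> i /andP[/andP[/H[]->]]; rewrite eqxx.
Qed.

Section Ideals.
Variables (R : comNzRingType) (S : R -> Prop).

Lemma ideal_gen_mem p : S p -> ideal_gen S p.
Proof.
move=> Sp; exists [:: (1, p)]; last by rewrite big_seq1 mul1r.
by move=> x; rewrite inE => /eqP ->.
Qed.

Lemma ideal_gen0 : ideal_gen S 0.
Proof. by exists [::] => //; rewrite big_nil. Qed.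

Lemma ideal_gen_add p r : ideal_gen S p -> ideal_gen S r -> ideal_gen S (p + r).
Proof.
move=> [s sS ->] [t tS ->]; exists (s ++ t); last by rewrite big_cat.
by move=> x; rewrite mem_cat => /orP[]; [apply: sS|apply: tS].
Qed.

Lemma ideal_gen_mul a p : ideal_gen S p -> ideal_gen S (a * p).
Proof.
move=> [s sS ->]; exists [seq (a * x.1, x.2) | x <- s].
  by move=> x /mapP[y ys ->]; apply: (sS y ys).
by rewrite big_map mulr_sumr; apply: eq_bigr => x _; rewrite mulrA.
Qed.

Lemma ideal_gen_sum (I : Type) (r : seq I) (P : pred I) (F : I -> R) :
  (forall i, P i -> ideal_gen S (F i)) -> ideal_gen S (\sum_(i <- r | P i) F i).
Proof. by move=> H; apply: big_ind => //; [exact: ideal_gen0|exact: ideal_gen_add]. Qed.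

End Ideals.

(** * Grading, vanishing of the composite, and minimality *)

Section Resolution.
Variables (K : fieldType) (n : nat) (A : 'M[nat]_n).
Hypothesis A_sym : A^T = A.
Hypothesis A_conn : connected_set A [set: 'I_n].
Variable sgn : {set part_digraph n} -> part_arc n -> int.
Hypothesis sgnP : sign_system A sgn.
Variable q : 'I_n.
Implicit Types (e : part_arc n) (c : {set part_digraph n}) (C : part_digraph n).
Implicit Types (m : 'X_{1..n}) (s : 'I_n -> int) (U W : {set 'I_n}).

Local Notation AP := (acyclic_partitions A).
Local Notation adj := (adj A).
Local Notation ori := (ori A).
Local Notation outv := (outv A).
Local Notation lap := (lap A).
Local Notation mexp := (mexp A).
Local Notation class_up := (class_up A q).
Local Notation class_down := (class_down A q).
Local Notation resF := (resF K A).
Local Notation basis := (resF_basis K A).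
Local Notation delta := (delta K A sgn).
Local Notation cls k := {c : {set part_digraph n} | c \in chip_classes A k}.

Lemma delta_coord k (v : resF k.+1) (d : cls k.+1) :
  delta k v d = \sum_(c : cls k.+2) v c * \sum_(e | class_contractible (val c) e)
    ((sgn (val c) e)%:~R * 'X_[mexp e]) * (val d == class_contract A (val c) e)%:R
  :> {mpoly K[n]}.
Proof.
rewrite /Defs.delta sum_ffunE; apply: eq_bigr => c _ /=.
rewrite ffunE sum_ffunE; congr (_ * _); apply: eq_bigr => e ce.
by rewrite !ffunE (class_exponentE A_sym (valP c) ce).
Qed.

(** Each representative of a facet lifts to one of the class whose divisor is larger by exactly
    [mexp e], so the two degrees coincide before passing to classes. *)
Lemma delta_homog k (d : {ffun 'I_n -> int}) (v : resF k.+1) :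
  resF_homog d v -> resF_homog d (delta k v).
Proof.
move=> hv c C m Cc; rewrite mcoeff_msupp (delta_coef A_sym).
apply: contra_neqP => no; rewrite big1 // => c' _; rewrite big1 // => e /andP[ce /eqP Ec].
rewrite mcoeffMX_eq0 ?mulr0 // => m' Em; apply/eqP/negPn/negP => nz; apply: no.
rewrite -Ec in Cc; have [C' [Cc' ce' CE]] := contract_lift A_sym (valP c') ce Cc.
have [CA' _ _] := chip_classes_mem A_sym (valP c') Cc'.
have := hv c' C' m' Cc'; rewrite mcoeff_msupp => /(_ nz).
rewrite (out_vec_ori CA') (outv_arc_pairs (O' := ori C) (e := e)).
  by rewrite out_vec_ori -?CE ?contract_acyclic_partition // addmA Em CE.
by move=> u w uw; rewrite -CE; apply: arr_contract.
Qed.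

Lemma resF_scaleM k (a b : K) (v : resF k) : a%:MP *: (b%:MP *: v) = (a * b)%:MP *: v.
Proof. by rewrite mpolyCM -scalerA. Qed.

(** The terms are indexed by pairs of successive contractions and cancel under [swap_pair] by the
    first sign rule. *)
Lemma delta_delta_basis k c : c \in chip_classes A k.+3 ->
  delta k (delta k.+1 (basis k.+2 c)) = 0.
Proof.
move=> ck; have := delta_cell K A_sym sgn 0%MM ck.
rewrite mpolyX0 scale1r => ->; rewrite linear_sum /=.
rewrite (eq_bigr (fun e => \sum_(g | class_contractible (class_contract A c e) g)
   ((sgn c e * sgn (class_contract A c e) g)%:~R : K)%:MP *:
     ('X_[(mexp e + mexp g)%MM] *: basis k (class_contract A (class_contract A c e) g)))); last first.
  move=> e ce; have ek := class_contract_in A_sym ck ce.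
  rewrite linearZ /= add0m (delta_cell K A_sym sgn _ ek) scaler_sumr.
  apply: eq_bigr => g cg; rewrite intrM; exact: resF_scaleM.
rewrite pair_big_dep /=; apply: (big_involution_eq0 (i' := swap_pair A)) => -[e g] /= /andP[ce cg].
have [cf ce' E [Em nf cE sE]] := swap_arcP A_sym ck ce cg.
rewrite /swap_pair /= cf ce' sE cE; split=> //.
  by apply: contraNneq nf => -[->].
have [_ H _] := sgnP ck.
have := H e (swap_arc A e g); rewrite eq_sym nf cE => /(_ isT ce cf cg ce') ->.
by rewrite -E Em rmorphN /= mpolyCN scaleNr opprK.
Qed.

Lemma delta_delta_scale k (a : {mpoly K[n]}) c : c \in chip_classes A k.+3 ->
  delta k (delta k.+1 (a *: basis k.+2 c)) = 0.
Proof.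
move=> ck; have -> : delta k.+1 (a *: basis k.+2 c) = a *: delta k.+1 (basis k.+2 c).
  exact: linearZ.
have -> : delta k (a *: delta k.+1 (basis k.+2 c)) = a *: delta k (delta k.+1 (basis k.+2 c)).
  exact: linearZ.
by rewrite delta_delta_basis // scaler0.
Qed.

Lemma delta_sum k (I : finType) (F : I -> resF k.+1) :
  delta k (\sum_i F i) = \sum_i delta k (F i).
Proof. exact: linear_sum. Qed.

Lemma delta_delta k (v : resF k.+2) : delta k (delta k.+1 v) = 0.
Proof.
rewrite (resF_decomp v) (@delta_sum k.+1) (@delta_sum k); apply: big1 => c _.
exact: delta_delta_scale (valP c).
Qed.

Lemma card_parts_le C : C \in AP -> (#|C.1| <= n)%N.
Proof.
move=> CA; have := card_partition (AP_partition CA); rewrite cardsT card_ord.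
move=> /esym/eq_leq; apply: leq_trans; rewrite -sum1_card; apply: leq_sum => U UP.
by have [u uU] := AP_nonempty CA UP; apply/card_gt0P; exists u.
Qed.

Lemma delta_top k (w : resF k.+1) : (n < k.+2)%N -> delta k w = 0.
Proof.
move=> nk; rewrite /Defs.delta big1 // => -[c ck] _.
case/imsetP: (ck) => C; rewrite inE => /andP[CA /eqP sz] _.
by have := card_parts_le CA; rewrite sz leqNgt nk.
Qed.

(** An arc contains an edge starting at some [u], so the variable of [u] divides its monomial. *)
Lemma delta_minimal k (v : resF k.+1) (c : cls k.+1) : irrelevant_ideal (delta k v c).
Proof.
rewrite delta_coord; apply: ideal_gen_sum => d _; apply: ideal_gen_mul.
apply: ideal_gen_sum => e ce; rewrite mulrC; apply: ideal_gen_mul; apply: ideal_gen_mul.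
case/exists_inP: ce => C Cd ce.
have [CA _ _] := chip_classes_mem A_sym (valP d) Cd.
have [_ _ _ [u [w [ue we uw]]]] := arc_parts CA (contractible_mem ce).
have pos : (0 < mexp e u)%N.
  rewrite (mexp_in A ue) (bigD1 w) //=; apply: ltn_addr; exact: ori_adj uw.
have -> : mexp e = (mexp e - U_(u) + U_(u))%MM.
  by rewrite submK //; apply/mnm_lepP => i; rewrite mnm1E; case: eqP => // <-.
rewrite mpolyXD; apply: ideal_gen_mul; apply: ideal_gen_mem; by exists u.
Qed.

(** * Classes with one or two parts and the last differential *)

Lemma one_part_ori C : C \in AP -> #|C.1| = 1%N -> ori C = set0.
Proof.
move=> CA /eqP/cards1P[P E]; apply/setP => -[u w]; rewrite [RHS]in_set0 in_ori.
apply/negbTE/negP => /andP[_ uw]; have /acyclic_partitionsP[_ _ _ aC] := CA.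
have := acyclic_arc aC uw; have := pblock_AP u CA; have := pblock_AP w CA.
by rewrite E !inE => /eqP -> /eqP ->; rewrite eqxx => -[].
Qed.

Lemma class1_unique c c' : c \in chip_classes A 1 -> c' \in chip_classes A 1 -> c = c'.
Proof.
case/imsetP => C; rewrite inE => /andP[CA /eqP C1] ->.
case/imsetP => C'; rewrite inE => /andP[CA' /eqP C1'] ->.
by congr chip_class; apply: (ori_inj A_sym) => //; rewrite !one_part_ori.
Qed.

Lemma class1_exists : exists c, c \in chip_classes A 1.
Proof.
have [C CA CE] := exists_AP A_sym (fun _ => 0%N).
have C0 : ori C = set0.
  by rewrite CE; apply/setP => -[u w]; rewrite in_height_orient inE ltnn andbF.
exists (chip_class A C); have := chip_class_in CA.
by rewrite (no_arcs_parts A_sym A_conn q CA C0) cards1.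
Qed.

Lemma class1_ori c : c \in chip_classes A 1 -> class_ori A q c = set0.
Proof.
move=> c1; have [Rc _] := sink_repP A_sym A_conn q c1.
have [CA C1 _] := chip_classes_mem A_sym c1 Rc.
exact: one_part_ori.
Qed.

(** The indicator of [e.1] is a potential between the two orientations of a two-part partition, so
    both directions occur in one class, and their exponents differ by firing [e.1]. *)
Lemma class2_arcs c e : c \in chip_classes A 2 -> class_contractible c e ->
  let e' := (e.2, e.1) in
  [/\ class_contractible c e', e' != e,
      forall f, class_contractible c f -> f = e \/ f = e' &
      exists s, forall u, (mexp e u)%:Z - (mexp e' u)%:Z = lap s u].
Proof.
move=> c2 /exists_inP[C Cc ce] e'.
have [CA C2 _] := chip_classes_mem A_sym c2 Cc.
have eC := contractible_mem ce.
have [e1P e2P ne [u0 [w0 [u0e w0e uw0]]]] := arc_parts CA eC.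
have C1 : C.1 = [set e.1; e.2].
  apply/esym/eqP; rewrite eqEcard C2 cards2 ne andbT.
  by apply/subsetP => x; rewrite !inE => /orP[]/eqP->.
have inW x : (x \in e.2) = (x \notin e.1).
  have := pblock_AP x CA; have := mem_pblock_AP x CA; rewrite C1 !inE => xp /orP[]/eqP E.
    by rewrite -E xp (negPf (disjoint_parts CA e1P e2P ne _)) // -E.
  rewrite eq_sym in ne; rewrite -{1}E xp; apply/esym.
  by apply: (disjoint_parts CA e2P e1P ne); rewrite -E.
have arrC u w : adj u w -> arr (ori C) u w = b2z ((u \in e.1) && (w \in e.2)).
  move=> uw; rewrite (arr_contract A_sym CA ce uw).
  rewrite (_ : ori (contract C e) = set0) ?/arr ?inE ?add0r //.
  apply: one_part_ori; first exact: contract_acyclic_partition.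
  have ccE : class_contractible c e by apply/exists_inP; exists C.
  have := class_contract_in A_sym c2 ccE; have := contract_in_class A_sym c2 Cc ce => H H2.
  by have [] := chip_classes_mem A_sym H2 H.
have [C' CA' CE'] := exists_AP A_sym (fun x => (x \in e.2) : nat).
have arrC' u w : adj u w -> arr (ori C') u w = b2z ((u \in e.2) && (w \in e.1)).
  move=> uw; rewrite CE' arr_height // !inW.
  by case: (u \in e.1); case: (w \in e.1).
have sE : forall u w, adj u w -> b2z (u \in e.1) - b2z (w \in e.1) =
    arr (ori C) u w - arr (ori C') u w.
  by move=> u w uw; rewrite arrC // arrC' // !inW; case: (u \in e.1); case: (w \in e.1).
have equ : orient_equiv A (ori C) (ori C') by exists (fun u => b2z (u \in e.1)).
have C1' : C'.1 = [set e.1; e.2] by rewrite -C1 (orient_equiv_parts A_sym CA CA' equ).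
have Cc' : C' \in c.
  by have [_ _ ->] := chip_classes_mem A_sym c2 Cc; apply/in_chip_class.
have eC' : e' \in C'.2.
  apply: (mem_arc A_sym CA' (u := w0) (w := u0)) => //=; rewrite ?C1' ?in_set2 ?eqxx ?orbT //.
  have uw := ori_adj uw0; have := arrC' w0 u0; rewrite adjC // w0e u0e => /(_ uw).
  by rewrite /arr; case: (_ \in ori C').
have ce' : contractible C' e'.
  apply: (contractible_height A_sym CA' eC' (h := fun _ => 0%N)).
  apply/setP => -[u w]; rewrite in_setDpairs in_height_orient ltnn andbF.
  case uw: (adj u w); last by rewrite in_ori uw andbF.
  by have := arrC' _ _ uw; rewrite /arr /=; case: (_ && _); case: (_ \in ori C').
have all_arcs f : class_contractible c f -> f = e \/ f = e'.
  case/exists_inP => F Fc cf; have [FA _ _] := chip_classes_mem A_sym c2 Fc.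
  have [f1P f2P nf _] := arc_parts FA (contractible_mem cf).
  have F1 : F.1 = [set e.1; e.2].
    rewrite -C1; apply/esym/(orient_equiv_parts A_sym CA FA).
    exact: (chip_classes_mem_equiv A_sym c2).
  move: f1P f2P nf; rewrite F1 !inE [f]surjective_pairing /=.
  move=> /orP[]/eqP-> /orP[]/eqP->; rewrite ?eqxx // => _; [left|by right].
  by rewrite -surjective_pairing.
split=> //.
- by apply/exists_inP; exists C'.
- by apply: contraNneq ne; rewrite [e]surjective_pairing => -[/= -> _].
exists (fun u => b2z (u \in e.1)) => u; rewrite -(outvB_lap sE u).
have OE O (f : part_arc n) : (forall u w, adj u w -> arr O u w = b2z ((u \in f.1) && (w \in f.2))) ->
    outv O = mexp f.
  move=> H; rewrite (@outv_arc_pairs _ A O set0 f); last first.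
    by move=> x y xy; rewrite H // /arr inE add0r.
  apply/mnmP => x; rewrite mnmDE [outv _ _]mnmE big1 ?addn0 // => y _.
  by rewrite inE muln0.
by rewrite (OE _ e arrC) (OE _ e' arrC').
Qed.

Lemma coordD (c0 : cls 1) (u v : resF 0) : (u + v) c0 = u c0 + v c0 :> {mpoly K[n]}.
Proof. by rewrite ffunE. Qed.

Lemma cell_coord (c0 : cls 1) c (a : K) m : c \in chip_classes A 1 ->
  (a%:MP *: ('X_[m] *: basis 0 c)) c0 = a%:MP * 'X_[m] :> {mpoly K[n]}.
Proof.
move=> c1; have E : val c0 = c := class1_unique (valP c0) c1.
by rewrite !ffunE E eqxx /GRing.scale /= mulr1.
Qed.

(** The second sign rule gives the two directions opposite signs, hence a binomial. *)
Lemma delta_class2 (c0 : cls 1) c e m : c \in chip_classes A 2 -> class_contractible c e ->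
  delta 0 ('X_[m] *: basis 1 c) c0 = ((sgn c e)%:~R : K)%:MP *
    ('X_[(m + mexp e)%MM] - 'X_[(m + mexp (e.2, e.1))%MM]) :> {mpoly K[n]}.
Proof.
move=> c2 ce; have [ce' ne' all_arcs _] := class2_arcs c2 ce.
pose cell f : resF 0 := ((sgn c f)%:~R : K)%:MP *:
  ('X_[(m + mexp f)%MM] *: basis 0 (class_contract A c f)).
have -> : delta 0 ('X_[m] *: basis 1 c) = cell e + cell (e.2, e.1).
  by rewrite (delta_cell K A_sym sgn _ c2); apply: big_two.
have ek := class_contract_in A_sym c2 ce; have ek' := class_contract_in A_sym c2 ce'.
have E f (fk : class_contract A c f \in chip_classes A 1) :
    cell f c0 = ((sgn c f)%:~R : K)%:MP * 'X_[(m + mexp f)%MM] :> {mpoly K[n]}.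
  exact: (cell_coord c0 _ _ fk).
apply: etrans (coordD c0 (cell e) (cell (e.2, e.1))) _.
apply: etrans (congr2 (fun x y : {mpoly K[n]} => x + y) (E _ ek) (E _ ek')) _.
have [_ _ /(_ e.1 e.2)] := sgnP c2; rewrite -surjective_pairing => /(_ ce ce') ->.
by rewrite rmorphN /= mpolyCN !mulNr mulrBr opprB addrC.
Qed.

Definition in_image (c0 : cls 1) (p : {mpoly K[n]}) := exists w : resF 1, delta 0 w c0 = p.

Lemma in_image_add (c0 : cls 1) p r : in_image c0 p -> in_image c0 r -> in_image c0 (p + r).
Proof.
move=> [w <-] [w' <-]; exists (w + w').
have -> : delta 0 (w + w') = delta 0 w + delta 0 w' by exact: linearD.
by rewrite ffunE.
Qed.

Lemma in_image_mul (c0 : cls 1) a p : in_image c0 p -> in_image c0 (a * p).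
Proof.
move=> [w <-]; exists (a *: w).
have -> : delta 0 (a *: w) = a *: delta 0 w by exact: linearZ.
by rewrite ffunE.
Qed.

Lemma in_image0 (c0 : cls 1) : in_image c0 0.
Proof.
exists 0; have -> : delta 0 0 = 0 by exact: linear0.
by rewrite ffunE.
Qed.

Lemma in_image_opp (c0 : cls 1) p : in_image c0 p -> in_image c0 (- p).
Proof. by rewrite -mulN1r; apply: in_image_mul. Qed.

(** * Reduced divisors and the image of the last differential *)

Lemma lap_opp s u : lap (fun x => - s x) u = - lap s u.
Proof. by rewrite /lap -sumrN; apply: eq_bigr => w _; ring. Qed.

(** Otherwise the set where [s] is maximal avoids [q] and is legal: its vertices lose at least one
    chip along each edge leaving it, and still end with the nonnegative amount [m2]. *)
Lemma critical_max m1 m2 s u : max_legal A q set0 m1 = set0 ->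
  (forall u, (m1 u)%:Z - (m2 u)%:Z = lap s u) -> s u <= s q.
Proof.
move=> m1c E; have [z _ zmax] := @arg_maxP _ _ _ q predT s isT.
rewrite leNgt; apply/negP => lt.
pose M := [set x | s x == s z].
have zM : z \in M by rewrite inE.
suff: legal A q set0 m1 M.
  by move/legal_sub; rewrite m1c => /subsetP/(_ z zM); rewrite inE.
rewrite /legal inE; apply/andP; split.
  by apply: contraTneq lt => ->; rewrite -leNgt; apply: zmax.
apply/forall_inP => x; rewrite inE => /eqP xz.
rewrite -lez_nat; apply: (@le_trans _ _ (lap s x)); last by rewrite -E; lia.
rewrite -natz natr_sum /lap big_mkcond; apply: ler_sum => w _; rewrite natz.
have le : s w <= s x by rewrite xz; apply: zmax.
case: ifP => [/andP[wM _]|_]; last by apply: mulr_ge0 => //; rewrite subr_ge0.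
have : s w != s x by move: wM; rewrite inE xz.
move: le; clear; nia.
Qed.

(** [critical_max] for [s] and for its opposite makes the script constant. *)
Lemma critical_unique m1 m2 s : max_legal A q set0 m1 = set0 ->
  max_legal A q set0 m2 = set0 -> (forall u, (m1 u)%:Z - (m2 u)%:Z = lap s u) -> m1 = m2.
Proof.
move=> c1 c2 E; have F u : (m2 u)%:Z - (m1 u)%:Z = lap (fun x => - s x) u.
  by rewrite lap_opp -E opprB.
have sc u : s u = s q.
  by have := critical_max u c1 E; have := critical_max u c2 F; lia.
apply/mnmP => u; have := E u; rewrite /lap big1; first by lia.
by move=> w _; rewrite !sc subrr mulr0.
Qed.

(** The elimination of [reducible_cell] in degree 0, on single monomials so that the script is
    recorded: a two-part cell trades a monomial for one linearly equivalent monomial, of smaller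
    measure if that is still up. *)
Lemma reduce_to_critical (c0 : cls 1) m : exists m' s,
  [/\ in_image c0 ('X_[m] - 'X_[m']), max_legal A q set0 m' = set0 &
      forall u, (m u)%:Z - (m' u)%:Z = lap s u].
Proof.
have lap0 u : lap (fun _ => 0) u = 0.
  by rewrite /lap big1 // => w _; rewrite subrr mulr0.
have c01 := valP c0.
have crit m1 : ~~ class_up (val c0) m1 -> max_legal A q set0 m1 = set0.
  move=> nup; rewrite -(class1_ori c01).
  apply: (class_critical A_sym A_conn c01 nup _).2.
  (* With nothing oriented, the part of [q] is everything and contains any [T], so the cell cannot
     be down. *)
  rewrite /class_down /cell_down class1_ori //; case: (top_base _ _ _ _) => // T.
  have [C CA CE] := exists_AP A_sym (fun _ => 0%N).
  have C0 : ori C = set0.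
    by rewrite CE; apply/setP => -[u w]; rewrite in_height_orient [RHS]in_set0 ltnn andbF.
  by rewrite -C0 (no_arcs_comp A_sym A_conn) // negbK subsetT.
have [N] := ubnP (cell_measure A q (val c0) m); elim: N => // N IH in m *.
rewrite ltnS => mN; have [up|nup] := boolP (class_up (val c0) m); last first.
  exists m, (fun _ => 0); rewrite subrr; split; [exact: in_image0|exact: crit|].
  by move=> u; rewrite subrr lap0.
have [c1 [m1 [c1k dn Ec Em]]] := up_cell A_sym A_conn c01 up.
have [ce _ _ muE] := down_arcP A_sym A_conn c1k dn.
have cce := class_contractible_rep A_sym A_conn c1k ce.
set e := down_arc A q c1 m1 in Ec Em ce muE cce.
have [ce' ne' _ [s sE]] := class2_arcs c1k cce.
set e' := (e.2, e.1) in ce' ne' sE; pose m2 := (m1 + mexp e')%MM.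
have c'E : class_contract A c1 e' = val c0.
  by apply: class1_unique => //; apply: class_contract_in.
have mm2 : in_image c0 ('X_[m] - 'X_[m2]).
  have -> : 'X_[m] - 'X_[m2] = ((sgn c1 e)%:~R : K)%:MP *
      (delta 0 ('X_[m1] *: basis 1 c1) c0 : {mpoly K[n]}).
    rewrite (delta_class2 c0 _ c1k cce) Em mulrA -mpolyCM -intrM.
    have [/(_ e cce)[->|->] _ _] := sgnP c1k; by rewrite ?mulrNN mulr1 mpolyC1 mul1r.
  by apply: in_image_mul; exists ('X_[m1] *: basis 1 c1).
have Es u : (m u)%:Z - (m2 u)%:Z = lap s u.
  by rewrite -sE -Em /m2 !mnmDE !PoszD; ring.
have [m' [t [im m'c tE]]] : exists m' t, [/\ in_image c0 ('X_[m2] - 'X_[m']),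
    max_legal A q set0 m' = set0 & forall u, (m2 u)%:Z - (m' u)%:Z = lap t u].
  have [up2|nup2] := boolP (class_up (val c0) m2); last first.
    exists m2, (fun _ => 0); rewrite subrr; split; [exact: in_image0|exact: crit|].
    by move=> u; rewrite subrr lap0.
  apply: IH; apply: leq_trans mN; rewrite -{2}Ec -Em muE -c'E.
  by apply: (down_facet A_sym A_conn c1k dn ce' ne'); rewrite c'E.
exists m', (fun x => s x + t x); split=> //.
  by have := in_image_add mm2 im; rewrite addrA subrK.
by move=> u; rewrite lapD -Es -tE; ring.
Qed.

(** Modulo the image, both terms of a generating binomial reduce to the same reduced monomial.
    Conversely, two-part classes map to binomials with equivalent exponents, up to sign. *)
Lemma image_toppling (c0 : cls 1) (p : {mpoly K[n]}) :
  toppling_ideal A p <-> in_image c0 p.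
Proof.
split=> [[l lS ->]|[w <-]].
  elim: l lS => [|x l IH] lS; first by rewrite big_nil; apply: in_image0.
  rewrite big_cons; apply: in_image_add; last first.
    by apply: IH => y yl; apply: lS; rewrite inE yl orbT.
  apply: in_image_mul; have [u [v [+ ->]]] := lS x (mem_head _ _).
  move=> /(lin_equivP A_sym)[s sE].
  have [u' [t [imu uc tE]]] := reduce_to_critical c0 u.
  have [v' [t' [imv vc t'E]]] := reduce_to_critical c0 v.
  (* The scripts of the equivalence and of the two reductions combine into one from [u'] to [v']. *)
  have uv : u' = v'.
    apply: (critical_unique (s := fun x => s x - t x + t' x)) => // y.
    by have := sE y; rewrite !ffunE lapD lapB -tE -t'E => <-; ring.
  have -> : 'X_[u] - 'X_[v] = ('X_[u] - 'X_[u']) + - ('X_[v] - 'X_[v']) :> {mpoly K[n]}.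
    by rewrite uv; ring.
  by apply: in_image_add => //; apply: in_image_opp.
rewrite (resF_decomp w) delta_sum sum_ffunE; apply: ideal_gen_sum => c _.
have c2 := valP c.
have -> : delta 0 (w c *: basis 1 (val c)) = w c *: delta 0 (basis 1 (val c)).
  exact: linearZ.
rewrite ffunE; apply: ideal_gen_mul.
have [e ce|none] := pickP (class_contractible (val c)); last first.
  rewrite delta_coord; apply: ideal_gen_sum => d _.
  rewrite ffunE; case: eqP => [->|_]; last by rewrite mul0r; apply: ideal_gen0.
  by rewrite big_pred0 // mulr0; apply: ideal_gen0.
rewrite -[basis 1 _]scale1r -mpolyX0 (delta_class2 c0 _ c2 ce).
apply: ideal_gen_mul; apply: ideal_gen_mem.
exists (0 + mexp e)%MM, (0 + mexp (e.2, e.1))%MM; split=> //.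
apply/(lin_equivP A_sym); have [_ _ _ [s sE]] := class2_arcs c2 ce.
by exists s => u; rewrite !ffunE !add0m sE.
Qed.

End Resolution.

Theorem theorem3p1 (K : fieldType) (n : nat) (A : 'M[nat]_n)
    (A_sym : A^T = A) (A_conn : connected_set A [set: 'I_n])
    (sgn : {set part_digraph n} -> part_arc n -> int)
    (sgnP : sign_system A sgn) :
  (* degree-preserving maps for the grading by Z^n / Z^n Lambda_G *)
  (forall (k : nat) (d : {ffun 'I_n -> int}) (v : resF K A k.+1),
      (k.+1 < n)%N -> resF_homog d v -> resF_homog d (delta K A sgn k v))
  (* complex *)
  /\ (forall (k : nat) (v : resF K A k.+2), (k.+2 < n)%N ->
        delta K A sgn k (delta K A sgn k.+1 v) = 0)
  (* exactness at F_(1,k+1), 1 <= k+1 < n-1, and at F_(1,n-1) if n-1 >= 1 *)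
  /\ (forall (k : nat) (v : resF K A k.+1), (k.+2 < n)%N ->
        delta K A sgn k v = 0 ->
        exists w : resF K A k.+2, delta K A sgn k.+1 w = v)
  /\ (forall (k : nat) (v : resF K A k.+1), k.+2 = n ->
        delta K A sgn k v = 0 -> v = 0)
  (* F_(1,0) = R via the coordinate at its only basis element c0, and then   *)
  (* the image of delta_(1,1) is I_G; for n = 1, resF K A 1 is zero          *)
  /\ (exists2 c0 : {c : {set part_digraph n} | c \in chip_classes A 1},
        (forall c : {c : {set part_digraph n} | c \in chip_classes A 1}, c = c0)
        & forall p : {mpoly K[n]}, toppling_ideal A p <->
            exists w : resF K A 1, delta K A sgn 0 w c0 = p)
  (* minimality *)
  /\ (forall (k : nat) (v : resF K A k.+1)
          (c : {c : {set part_digraph n} | c \in chip_classes A k.+1}),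
        (k.+1 < n)%N -> irrelevant_ideal (delta K A sgn k v c)).
Proof.
have [q _] : exists q, q \in [set: 'I_n] by apply/set0Pn; case/andP: A_conn.
have exact_at k (v : resF K A k.+1) : delta K A sgn k v = 0 ->
    exists w : resF K A k.+2, delta K A sgn k.+1 w = v.
  by apply: (resF_exact A_sym A_conn sgnP q) => w; apply: delta_delta.
split; first by move=> k d v _; apply: delta_homog.
split; first by move=> k v _; apply: delta_delta.
split; first by move=> k v _; apply: exact_at.
split.
  (* Here the preimage [w] lies in [F_(1,n)], which is zero: no partition has [n + 1] parts. *)
  by move=> k v kn /exact_at[w <-]; apply: delta_top => //; rewrite -kn.
split; last by move=> k v c _; apply: delta_minimal.
have [c c1] := class1_exists A_sym A_conn q.
exists (exist (fun c => c \in chip_classes A 1) c c1).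
  by move=> d; apply: val_inj; apply: class1_unique (valP d) c1.
by move=> p; apply: image_toppling.
Qed.
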